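(* Let $G$ be a finite group of order $n$ with symmetric generating set $R$, $|R|=m$, $id\notin R$, let $X_t$ be the Gibbs sampler on $\Delta_G$ defined in the context, let $U_G$ be the uniform distribution on $\Delta_G$, and let $\widehat{\gamma}$ be the spectral gap of the walk $Z_t$ on $G$ defined in the context. (Upper bound) If $T > \frac{8C}{\widehat{\gamma}}\log(n)$, $C>\frac{103}{4}$, and $n > \max\left(4096,\ \frac{C}{3}+\frac{10}{3},\ \left(\frac{C}{3}-\frac{13}{12}\right)\log(n)\right)$, then for every starting distribution of $X_0$ on $\Delta_G$, $$\| \mathcal{L}(X_T) - U_G\|_{TV} \le 7\, n^{4.5-\frac{C}{6}}.$$ (Lower bound) Conversely, there is a starting point $X_0\in\Delta_G$ such that for every $k$ and every $T<\frac{k}{\widehat{\gamma}}$, $$\| \mathcal{L}(X_T) - U_G\|_{TV} \ge \frac12 e^{-k} - 4 n^{-\frac13}.$$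
   Context: $\Delta_G=\{X\in\mathbb{R}^G : X[g]\ge 0,\ \sum_{g\in G}X[g]=1\}$, and $U_G$ is the uniform (normalized Lebesgue) probability measure on it. $R$ symmetric means $R^{-1}=R$. Gibbs sampler $X_t$: at each step $t\to t+1$, choose $g\in G$, $r\in R$ and $\lambda\in[0,1]$ independently and uniformly, and set $X_{t+1}[g]=\lambda(X_t[g]+X_t[gr])$, $X_{t+1}[gr]=(1-\lambda)(X_t[g]+X_t[gr])$, and $X_{t+1}[h]=X_t[h]$ for all other $h\in G$. Times $t,T$ are nonnegative integers. Walk $Z_t$ on $G$: at each step choose $g\in G$, $r\in R$ independently and uniformly; set $Z_{t+1}=gr$ if $Z_t=g$, $Z_{t+1}=g$ if $Z_t=gr$, and $Z_{t+1}=Z_t$ otherwise. Its transition matrix is symmetric, with eigenvalues $1=\widehat\lambda_1>\widehat\lambda_2\ge\dots\ge\widehat\lambda_n$, and $\widehat\gamma=1-\widehat\lambda_2$. $\mathcal{L}(X)$ denotes the distribution of $X$, and $\|\mu-\nu\|_{TV}=\sup_A(\mu(A)-\nu(A))$ over measurable sets $A$. *)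

(* Defs.v *)
From HB Require Import structures.
From mathcomp Require Import all_boot all_order all_algebra all_fingroup.
From mathcomp Require Import all_classical all_reals all_analysis.
From mathcomp Require Import measurable_realfun.

Set Implicit Arguments.
Unset Strict Implicit.
Unset Printing Implicit Defensive.

Import Order.TTheory GRing.Theory Num.Theory.

Local Open Scope classical_set_scope.
Local Open Scope ring_scope.

Definition tv_dist d (T : measurableType d) (R : realType)
    (mu nu : set T -> \bar R) : \bar R :=
  ereal_sup [set (mu A - nu A)%E | A in measurable].

(* As [distribution], for measures that are not probabilities. *)
Definition image_measure d d' (T : measurableType d) (T' : measurableType d')
    (R : realType) (mu : {measure set T -> \bar R}) (f : {mfun T >-> T'}) :=
  pushforward mu f.

Section image_measure.
Context d d' (T : measurableType d) (T' : measurableType d') (R : realType).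
Variables (mu : {measure set T -> \bar R}) (f : {mfun T >-> T'}).

Let image_measure0 : image_measure mu f set0 = 0%E.
Proof. exact: measure0. Qed.

Let image_measure_ge0 A : (0 <= image_measure mu f A)%E.
Proof. exact: measure_ge0. Qed.

Let image_measure_sigma_additive : semi_sigma_additive (image_measure mu f).
Proof. exact: measure_semi_sigma_additive. Qed.

HB.instance Definition _ := isMeasure.Build _ _ _ (image_measure mu f)
  image_measure0 image_measure_ge0 image_measure_sigma_additive.

End image_measure.

Section uniform_on_simplex.
Variable R : realType.

Definition simplex n : set (n.-tuple R) :=
  [set X | (forall i, 0 <= tnth X i) /\ \sum_(i < n) tnth X i = 1].

Definition rcons_pair d (p : d.-tuple R * measurableTypeR R) : d.+1.-tuple R :=
  [tuple of rcons p.1 p.2].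

Lemma measurable_rcons_pair d : measurable_fun [set: _] (@rcons_pair d).
Proof.
apply/measurable_fun_tnthP => i.
have [ltid|] := ltnP i d.
  have -> : (@tnth _ _)^~ i \o @rcons_pair d =
      (@tnth _ R)^~ (Ordinal ltid) \o fst.
    apply/funext => -[x y] /=.
    by rewrite !(tnth_nth y) /= nth_rcons size_tuple ltid.
  by apply: measurableT_comp => //; exact: measurable_tnth.
move=> ledi; have -> : (@tnth _ _)^~ i \o @rcons_pair d = snd.
  apply/funext => -[x y] /=; rewrite (tnth_nth y) /= nth_rcons size_tuple.
  by rewrite ltnNge ledi /=; case: ifP.
exact: measurable_snd.
Qed.

HB.instance Definition _ d := @isMeasurableFun.Build _ _ _ _
  (@rcons_pair d) (@measurable_rcons_pair d).

Fixpoint lebesgue_tuple (d : nat) : {measure set (d.-tuple R) -> \bar R} :=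
  if d is d'.+1 then
    image_measure (lebesgue_tuple d' \x @lebesgue_measure R)%E (@rcons_pair d')
  else \d_[tuple].

(* The projection of the simplex forgetting the last coordinate, and the
   inverse affine map: [nth] returns its default value, i.e., the missing
   coordinate 1 - \sum_i y_i, precisely at the last index. *)
Definition corner d : set (d.-tuple R) :=
  [set y | (forall i, 0 <= tnth y i) /\ \sum_(i < d) tnth y i <= 1].
Arguments corner d : clear implicits.

Definition corner_lift n (y : n.-1.-tuple R) : n.-tuple R :=
  [tuple nth (1 - \sum_(i < n.-1) tnth y i) y i | i < n].

Lemma measurable_corner d : measurable (corner d).
Proof.
rewrite (_ : corner d = (\bigcap_(i in [set: 'I_d])
    ((@tnth _ R)^~ i @^-1` `[0, +oo[)) `&`
    ((fun y : d.-tuple R => \sum_(i < d) tnth y i) @^-1` `]-oo, 1])); last first.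
  apply/seteqP; split => y /=.
    move=> [y0 y1]; split; last by rewrite in_itv.
    by move=> i _ /=; rewrite in_itv /= y0.
  move=> [y0]; rewrite in_itv /= => y1; split => // i.
  by have := y0 i I; rewrite /= in_itv /= andbT.
apply: measurableI.
  apply: fin_bigcap_measurable; first exact: finite_finset.
  move=> i _; rewrite -[X in measurable X]setTI.
  by apply: measurable_tnth.
rewrite -[X in measurable X]setTI.
have : measurable_fun [set: d.-tuple R] (fun y => \sum_(i < d) tnth y i).
  by apply: measurable_sum => i; exact: measurable_tnth.
by apply.
Qed.

Lemma measurable_corner_lift n : measurable_fun [set: _] (@corner_lift n).
Proof.
apply/measurable_fun_tnthP => i.
have [ltin|lein] := ltnP i n.-1.
  have -> : (@tnth _ _)^~ i \o @corner_lift n = (@tnth _ R)^~ (Ordinal ltin).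
    apply/funext => y /=.
    by rewrite tnth_mktuple (tnth_nth (1 - \sum_(j < n.-1) tnth y j)).
  exact: measurable_tnth.
have -> : (@tnth _ _)^~ i \o @corner_lift n =
    fun y => 1 - \sum_(i < n.-1) tnth y i.
  by apply/funext => y /=; rewrite tnth_mktuple nth_default // size_tuple.
apply: measurable_funB => //.
by apply: measurable_sum => j; exact: measurable_tnth.
Qed.

HB.instance Definition _ n := @isMeasurableFun.Build _ _ _ _
  (@corner_lift n) (@measurable_corner_lift n).

(* Normalized Lebesgue measure of the simplex, in the affine chart given by
   its first n - 1 coordinates; any affine chart gives the same probability.
   The last argument of [mnormalize] is irrelevant here, being used only for
   a total mass 0 or +oo. *)
Definition uniform_simplex n : probability (n.-tuple R) R :=
  distribution
    (mnormalize (mrestr (lebesgue_tuple n.-1) (@measurable_corner n.-1))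
                \d_([tuple 0 | _ < n.-1] : n.-1.-tuple R))
    (@corner_lift n).

End uniform_on_simplex.
Arguments simplex R n : clear implicits.
Arguments uniform_simplex R n : clear implicits.

Section gibbs_sampler.
Variables (R : realType) (gT : finGroupType).

(* R^G, via the enumeration of G; its library sigma-algebra is generated by
   the coordinates, i.e., it is the Borel one. *)
Notation vec := (#|gT|.-tuple R).

Definition coord (X : vec) (g : gT) : R := tnth X (enum_rank g).

Definition vec_of (f : gT -> R) : vec := [tuple f (enum_val i) | i < #|gT|].

Definition gibbs_move (g r : gT) (p : vec * measurableTypeR R) : vec :=
  let: (X, lambda) := p in
  vec_of (fun h =>
    if h == g then lambda * (coord X g + coord X (g * r)%g)
    else if h == (g * r)%g then (1 - lambda) * (coord X g + coord X (g * r)%g)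
    else coord X h).

Lemma measurable_gibbs_move g r : measurable_fun [set: _] (gibbs_move g r).
Proof.
have mcoord h : measurable_fun [set: vec * measurableTypeR R]
    (fun p => coord p.1 h).
  by apply: (@measurableT_comp _ _ _ _ _ _ (fun X : vec => coord X h)) => //;
     exact: measurable_tnth.
apply/measurable_fun_tnthP => i.
rewrite (_ : _ \o _ = fun p : vec * measurableTypeR R =>
    if enum_val i == g then p.2 * (coord p.1 g + coord p.1 (g * r)%g)
    else if enum_val i == (g * r)%g then
      (1 - p.2) * (coord p.1 g + coord p.1 (g * r)%g)
    else coord p.1 (enum_val i)); last first.
  by apply/funext => -[X l] /=; rewrite tnth_mktuple.
case: (_ == g).
  by apply: measurable_funM; [exact: measurable_snd|exact: measurable_funD].
case: (_ == (g * r)%g) => //.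
apply: measurable_funM; last exact: measurable_funD.
by apply: measurable_funB => //; exact: measurable_snd.
Qed.

HB.instance Definition _ g r := @isMeasurableFun.Build _ _ _ _
  (gibbs_move g r) (@measurable_gibbs_move g r).

Variable S : {set gT}.

(* Law of X_{t+1} when X_t has law mu: g, r are uniform in gT, S, lambda is
   uniform in [0, 1], and X_t, g, r, lambda are independent. *)
Definition gibbs_step (mu : {measure set vec -> \bar R}) (A : set vec) :=
  (((#|gT| * #|S|)%:R^-1)%:E *
   \sum_(g : gT) \sum_(r in S)
     image_measure (mu \x uniform_prob (@ltr01 R)) (gibbs_move g r) A)%E.

Section gibbs_step_measure.
Variable mu : {measure set vec -> \bar R}.

Let gibbs_step0 : gibbs_step mu set0 = 0%E.
Proof. by rewrite /gibbs_step big1 ?mule0// => g _; rewrite big1. Qed.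

Let gibbs_step_ge0 A : (0 <= gibbs_step mu A)%E.
Proof.
apply: mule_ge0; first by rewrite lee_fin invr_ge0.
by apply: sume_ge0 => g _; exact: sume_ge0.
Qed.

Let gibbs_step_sigma_additive : semi_sigma_additive (gibbs_step mu).
Proof.
move=> F mF tF mUF; rewrite /gibbs_step.
under eq_fun => n.
  rewrite -ge0_sume_distrr; last first.
    by move=> i _; apply: sume_ge0 => g _; exact: sume_ge0.
  rewrite exchange_big; under eq_bigr do rewrite exchange_big.
  over.
apply: cvgeZl => //; apply: cvg_nnesum => g _.
  by near=> n; apply: sume_ge0 => r _; exact: sume_ge0.
apply: cvg_nnesum => r _; first by near=> n; exact: sume_ge0.
exact: measure_semi_sigma_additive.
Unshelve. all: end_near. Qed.

HB.instance Definition _ := isMeasure.Build _ _ _ (gibbs_step mu)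
  gibbs_step0 gibbs_step_ge0 gibbs_step_sigma_additive.

End gibbs_step_measure.

Fixpoint gibbs_law (mu0 : {measure set vec -> \bar R}) (t : nat) :
    {measure set vec -> \bar R} :=
  if t is t'.+1 then gibbs_step (gibbs_law mu0 t') else mu0.

(* Probability that Z_{t+1} = y given Z_t = x; the transposition [tperm g h]
   exchanges g and h. *)
Definition walk_prob (x y : gT) : R :=
  (#|gT| * #|S|)%:R^-1 *
  \sum_(g : gT) \sum_(r in S) (tperm g (g * r)%g x == y)%:R.

Definition walk_matrix : 'M[R]_#|gT| :=
  \matrix_(i, j) walk_prob (enum_val i) (enum_val j).

End gibbs_sampler.

(* The eigenvalues of a matrix whose characteristic polynomial splits (as do
   those of all symmetric real matrices), with multiplicities and in
   nonincreasing order; this determines the sequence. *)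
Definition eigenvalues (R : realType) n (A : 'M[R]_n) : seq R :=
  xget [::] [set s | sorted >=%R s /\ char_poly A = \prod_(a <- s) ('X - a%:P)].

Definition spectral_gap (R : realType) (gT : finGroupType) (S : {set gT}) : R :=
  1 - (eigenvalues (walk_matrix R S))`_1.

(* Main.v *)
(* Upper bound. First run two chains with the same moves: the mean of a quadratic
   form in the difference [d] of the two states is again a quadratic form in [d],
   obtained by averaging, over the edges, orthogonal projections for a common inner
   product; the Poincare inequality of the walk makes this average a contraction by
   [1 - gamma / 6] modulo constants, so that [|d|^2] is tiny after the first phase.
   For the second phase condition on the whole sequence of its edges, and merge
   blocks of vertices backwards in time along these edges. At a move which
   joins two blocks, couple the two multipliers by an affine map equating the
   masses of both blocks in the two chains; this fails with probability at most
   (difference) / (mass at the edge), and the mass is at least [eta] with high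
   probability because the second chain is started from the invariant law
   [U_G]. When a single block remains, the chains have coalesced; by the spectral gap
   for indicators of blocks, the expected number of extra blocks decays like
   [(1 - gamma / 2)^t].

   Lower bound. An eigenfunction [phi] of the walk for the second eigenvalue gives
   a linear function of the state which every step multiplies by [1 - gamma / 2] in
   mean, starts at its maximum 1 at a vertex of the simplex, and has second moment
   at most [1 / (n + 1)] under [U_G]. *)
Require Import Defs.
From HB Require Import structures.
From mathcomp Require Import all_boot all_order all_algebra all_fingroup.
From mathcomp Require Import all_classical all_reals all_analysis.
From mathcomp Require Import measurable_realfun.
From mathcomp Require Import complex ring lra.

Set Implicit Arguments.
Unset Strict Implicit.
Unset Printing Implicit Defensive.

Import Order.TTheory GRing.Theory Num.Theory.
Import numFieldNormedType.Exports.

Local Open Scope classical_set_scope.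
Local Open Scope ring_scope.

(** * The spectral gap *)

(** Driving two chains by the same moves brings them close without making them equal in general,
    while the affine coupling makes them meet only if they are already close compared with the mass
    at the edge; hence two phases. The second coupling uses future edges, since the blocks are known
    only once the last edge is; edges and multipliers being independent, all edges may be fixed
    first ([iter_gibbs_opE]). No joint law is built for it: the coupling is a change of variable in
    an integral over [[0, 1]], and its failure is an additive error.

    Up to constants and rounding, the errors are [n^2 eta] (small mass at an edge),
    [n^2 theta / eta] and [n^2 (1 - gamma/6)^t1 / (theta eta)] (remaining distance),
    [n (1 - gamma/2)^t2] (several blocks left). With [eta = n^(-C/4)], [theta = n^(-C/2)], seven
    eighths of the time for the contraction and one eighth for the coalescence, each is at most a
    constant times [n^(2 - C/4)]. In the lower bound the threshold [a = n^(-1/3)] balances its own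
    size against the Chebyshev bound [1 / (n a^2)]. *)

Section symmetric_matrices.
Local Open Scope sesquilinear_scope.
Variables (R : rcfType) (n : nat) (A : 'M[R]_n).
Hypothesis symA : A^T = A.

Local Notation C := (complex R).
Local Notation toC := (real_complex R).

(** A real symmetric matrix becomes hermitian over [complex R], and the spectral diagonal of a
    hermitian matrix is real, so [D] descends to [R]. The change of basis [P] stays complex, which
    is why its rows are later split into real and imaginary parts. *)
Lemma symmetric_unitary_diag :
  exists P : 'M[C]_n, exists D : 'rV[R]_n, P \is unitarymx /\
    map_mx toC A = invmx P *m diag_mx (map_mx toC D) *m P.
Proof.
have Ah : map_mx toC A \is hermsymmx.
  apply: realsym_hermsym.
    by apply/is_hermitianmxP; rewrite expr0 scale1r map_mx_id// map_trmx symA.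
  by apply/mxOverP => i j; rewrite mxE; apply/complex_realP; exists (A i j).
have Dr := hermitian_spectral_diag_real Ah.
have /hermitian_normalmx/orthomx_spectralP Ae := Ah.
exists (spectralmx (map_mx toC A)).
exists (map_mx (@complex.Re R) (spectral_diag (map_mx toC A))).
split; first exact: spectral_unitarymx.
rewrite -map_mx_comp (_ : map_mx _ (spectral_diag _) = spectral_diag (map_mx toC A))//.
by apply/matrixP => i j; rewrite mxE /= RRe_real//; exact: (mxOverP Dr).
Qed.


Lemma symmetric_char_poly (P : 'M[C]_n) (D : 'rV[R]_n) : P \is unitarymx ->
  map_mx toC A = invmx P *m diag_mx (map_mx toC D) *m P ->
  char_poly A = \prod_(i < n) ('X - (D 0 i)%:P).
Proof.
move=> Pu Ae; apply: (@map_poly_inj _ _ toC).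
rewrite map_char_poly Ae /char_poly.
have Pun := unitarymx_unit Pu.
have PV : map_mx polyC (invmx P) *m map_mx polyC P = 1%:M.
  by rewrite -map_mxM mulVmx// map_mx1.
have -> : char_poly_mx (invmx P *m diag_mx (map_mx toC D) *m P) =
    map_mx polyC (invmx P) *m char_poly_mx (diag_mx (map_mx toC D)) *m map_mx polyC P.
  rewrite /char_poly_mx mulmxBr mulmxBl !map_mxM; congr (_ - _).
  by rewrite scalar_mxC -mulmxA PV mulmx1.
rewrite !det_mulmx mulrAC -det_mulmx PV det1 mul1r.
have -> : \det (char_poly_mx (diag_mx (map_mx toC D))) =
    \prod_i ('X - (toC (D 0 i))%:P).
  have := @char_poly_trig _ _ _ (diag_mx_is_trig (map_mx toC D)).
  by rewrite /char_poly => ->; apply: eq_bigr => i _; rewrite !mxE eqxx mulr1n.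
by rewrite map_prod_XsubC.
Qed.

End symmetric_matrices.

(** Unique factorization, by cancelling one common root at a time. It identifies the list picked by
    [eigenvalues] with the diagonal [D], up to order. *)
Lemma prod_XsubC_perm_eq (F : fieldType) (s t : seq F) :
  \prod_(a <- s) ('X - a%:P) = \prod_(a <- t) ('X - a%:P) -> perm_eq s t.
Proof.
elim: s t => [t|a s ih t].
  rewrite big_nil => /(congr1 (size \o val)) /=.
  rewrite size_poly1 (size_prod_XsubC t id) => -[].
  by case: t.
rewrite big_cons => st.
have at_ : a \in t by rewrite -root_prod_XsubC -st rootM root_XsubC eqxx.
rewrite perm_sym (perm_trans (perm_to_rem at_))// perm_cons perm_sym ih//.
move: st; rewrite (big_rem a at_)/= => /mulfI; apply.
by rewrite polyXsubC_eq0.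
Qed.

(** The sorted diagonal is a witness, so [xget] does not fall back on its default [[::]]. *)
Lemma eigenvaluesP (R : realType) n (A : 'M[R]_n) : A^T = A ->
  sorted >=%R (eigenvalues A) /\
  char_poly A = \prod_(a <- eigenvalues A) ('X - a%:P).
Proof.
move=> symA; rewrite /eigenvalues.
have [P [D [Pu Ae]]] := symmetric_unitary_diag symA.
set Q := [set s | _]; apply: (@xgetPex _ [::] Q).
exists (sort >=%R [seq D 0 i | i <- enum 'I_n]); split.
  by apply: sort_sorted => x y; exact: le_total.
rewrite (symmetric_char_poly Pu Ae).
rewrite (perm_big [seq D 0 i | i <- enum 'I_n]) ?perm_sort//.
by rewrite big_map big_enum.
Qed.

Section second_eigenvalue.
Local Open Scope sesquilinear_scope.
Variables (R : realType) (n : nat) (A : 'M[R]_n).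
Hypothesis n1 : (1 < n)%N.
Hypothesis symA : A^T = A.
Hypothesis A1 : (const_mx 1 : 'rV_n) *m A = const_mx 1.
Hypothesis A_le1 : forall d : 'rV_n, (d *m A *m d^T) 0 0 <= (d *m d^T) 0 0.
Hypothesis A_fix : forall d : 'rV_n, d *m A = d -> exists c, d = const_mx c.

Local Notation C := (complex R).
Local Notation toC := (real_complex R).
Local Notation lambda2 := (eigenvalues A)`_1.

Let ReA (d : 'rV[C]_n) :
  map_mx (@complex.Re R) (d *m map_mx toC A) = map_mx (@complex.Re R) d *m A.
Proof.
apply/rowP => j; rewrite !mxE raddf_sum /=; apply: eq_bigr => i _.
by rewrite !mxE; case: (d 0 i) => a b /=; rewrite mulr0 subr0.
Qed.

Let ImA (d : 'rV[C]_n) :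
  map_mx (@complex.Im R) (d *m map_mx toC A) = map_mx (@complex.Im R) d *m A.
Proof.
apply/rowP => j; rewrite !mxE raddf_sum /=; apply: eq_bigr => i _.
by rewrite !mxE; case: (d 0 i) => a b /=; rewrite mulr0 add0r.
Qed.

(** By [A_fix] the eigenvalue 1 is simple, with constant eigenvectors. A vector of sum 0 has no
    component along them, hence only eigenvalues at most [lambda2] occur in its expansion. *)
Lemma second_eigenvalueP :
  [/\ lambda2 < 1,
      (forall d : 'rV_n, \sum_i d 0 i = 0 ->
         (d *m A *m d^T) 0 0 <= lambda2 * (d *m d^T) 0 0) &
      exists2 phi : 'rV_n, phi != 0 &
        phi *m A = lambda2 *: phi /\ \sum_i phi 0 i = 0].
Proof.
have [srt cp] := eigenvaluesP symA.
have [P [D [Pu Ae]]] := symmetric_unitary_diag symA.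
have cpD := symmetric_char_poly Pu Ae.
have pe : perm_eq (eigenvalues A) [tuple D 0 i | i < n].
  apply: prod_XsubC_perm_eq; rewrite -cp cpD big_map big_enum //=.
have /tuple_permP[p Ep] := pe.
have szE : size (eigenvalues A) = n by rewrite (perm_size pe) size_tuple.
have En (j : 'I_n) : (eigenvalues A)`_j = D 0 (p j).
  by rewrite Ep -(tnth_nth 0 [tuple tnth _ (p i) | i < n]) !tnth_mktuple.
have Droot i : root (char_poly A) (D 0 i).
  rewrite cpD -(big_map (fun i => D 0 i) xpredT (fun a => 'X - a%:P)).
  by rewrite root_prod_XsubC; apply/mapP; exists i; rewrite ?mem_index_enum.
have Deig i : exists2 v : 'rV_n, v *m A = D 0 i *: v & v != 0.
  by apply/eigenvalueP; rewrite eigenvalue_root_char.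
have vv_gt0 (v : 'rV[R]_n) : v != 0 -> 0 < (v *m v^T) 0 0.
  move=> v0; rewrite lt_def; apply/andP; split; last first.
    by rewrite mxE sumr_ge0// => i _; rewrite mxE -expr2 sqr_ge0.
  apply: contra v0; rewrite mxE psumr_eq0; last first.
    by move=> i _; rewrite mxE -expr2 sqr_ge0.
  move=> /allP v0; apply/eqP/rowP => i; rewrite mxE; apply/eqP.
  by have := v0 i (mem_index_enum _); rewrite mxE mulf_eq0 orbb.
have D_le1 i : D 0 i <= 1.
  have [v vA v0] := Deig i.
  have := A_le1 v; rewrite vA -scalemxAl mxE.
  by rewrite ger_pMl// vv_gt0.
have PA i : row i P *m map_mx toC A = toC (D 0 i) *: row i P.
  rewrite -row_mul Ae !mulmxA mulmxV ?unitarymx_unit// mul1mx.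
  by rewrite row_mul row_diag_mx -scalemxAl -rowE mxE.
have Pconst i : D 0 i = 1 -> exists c, row i P = const_mx c.
  move=> Di1; have Pf : row i P *m map_mx toC A = row i P.
    by rewrite PA Di1 scale1r.
  (* [A] is real, so the real and the imaginary part of this row are fixed by [A] separately. *)
  have /A_fix[a aE] : map_mx (@complex.Re R) (row i P) *m A = map_mx (@complex.Re R) (row i P).
    by rewrite -ReA Pf.
  have /A_fix[b bE] : map_mx (@complex.Im R) (row i P) *m A = map_mx (@complex.Im R) (row i P).
    by rewrite -ImA Pf.
  exists (Complex a b); apply/rowP => j.
  move: aE bE => /rowP/(_ j) + /rowP/(_ j).
  by rewrite !mxE; case: (P i j) => /= ? ? -> ->.
have orth i j : \sum_k P i k * (P j k)^* = (i == j)%:R.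
  have /unitarymxP/matrixP/(_ i j) := Pu.
  by rewrite !mxE => <-; apply: eq_bigr => k _; rewrite !mxE.
(* Two rows of eigenvalue 1 would both be constant, and two nonzero constant vectors are not
   orthogonal. *)
have Duniq i j : D 0 i = 1 -> D 0 j = 1 -> i = j.
  move=> /Pconst[c /rowP ci] /Pconst[c' /rowP cj]; apply/eqP/negPn/negP => ij.
  have Pi k : P i k = c by have := ci k; rewrite !mxE.
  have Pj k : P j k = c' by have := cj k; rewrite !mxE.
  have := orth i j; have := orth i i; have := orth j j.
  rewrite !eqxx (negbTE ij).
  under eq_bigr do rewrite Pj.
  move=> h1; under eq_bigr do rewrite Pi.
  move=> h2; under eq_bigr do rewrite Pi Pj.
  have SC (z : C) : \sum_(k < n) z = z * n%:R by rewrite sumr_const card_ord mulr_natr.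
  move: h1 h2; rewrite !SC => h1 h2 /eqP.
  rewrite !mulf_eq0 -!orbA => /or3P[/eqP h|/eqP h|/eqP h].
  - by move: h2 => /eqP; rewrite h !mul0r eq_sym oner_eq0.
  - by move: h1 => /eqP; rewrite h mulr0 mul0r eq_sym oner_eq0.
  - by move: h1 => /eqP; rewrite h mulr0 eq_sym oner_eq0.
pose j0 := Ordinal (ltnW n1); pose j1 := Ordinal n1.
have mono (i j : 'I_n) : (i <= j)%N -> D 0 (p j) <= D 0 (p i).
  move=> ij; rewrite -!En.
  have tr : transitive (>=%R : rel R) by move=> x y z /= xy /le_trans; apply.
  have re : reflexive (>=%R : rel R) by move=> x /=.
  by apply: (sorted_leq_nth tr re 0 srt); rewrite ?inE ?szE.
have Dle i : D 0 i <= D 0 (p j0).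
  by rewrite -(permKV p i); apply: mono; rewrite leq0n.
have D0 : D 0 (p j0) = 1.
  apply/eqP; rewrite eq_le D_le1 /=.
  have : root (char_poly A) 1.
    rewrite -eigenvalue_root_char; apply/eigenvalueP.
    exists (const_mx 1); first by rewrite A1 scale1r.
    by apply/eqP => /rowP/(_ j0)/eqP; rewrite !mxE oner_eq0.
  rewrite cpD -(big_map (fun i => D 0 i) xpredT (fun a => 'X - a%:P)).
  rewrite root_prod_XsubC => /mapP[k _ e]. rewrite [X in X <= _]e; exact: Dle.
have l2E : lambda2 = D 0 (p j1) by rewrite -En.
have l2_lt1 : lambda2 < 1.
  rewrite lt_neqAle l2E D_le1 andbT; apply/eqP => D1.
  by have /perm_inj /(congr1 val) := Duniq _ _ D0 D1.
have Dle2 i : i != p j0 -> D 0 i <= lambda2.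
  have -> : i = p ((p^-1)%g i) by rewrite permKV.
  rewrite (inj_eq perm_inj) l2E => ij; apply: mono.
  by rewrite lt0n.
have [c /rowP Pc] := Pconst _ D0.
split => //.
- move=> d d0.
  pose y : 'rV[C]_n := map_mx toC d *m P^t*.
  (* The coordinate along the top eigenvector is a constant times the sum of [d]. *)
  have y0 : y 0 (p j0) = 0.
    rewrite mxE; under eq_bigr => k _.
      have := Pc k; rewrite !mxE => ->; over.
    by rewrite -mulr_suml -rmorph_sum d0 rmorph0 mul0r.
  have dE : map_mx toC d = y *m P.
    by rewrite /y -mulmxA -invmx_unitary// mulVmx ?mulmx1// unitarymx_unit.
  have dtE : (map_mx toC d)^T = P^t* *m y^t*.
    have -> : (map_mx toC d)^T = (map_mx toC d)^t*.
      by apply/matrixP => i j; rewrite !mxE; apply/esym/CrealP/complex_realP; exists (d j i).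
    by rewrite -map_mxM -trmx_mul -dE.
  have PP : P *m P^t* = 1%:M by apply/unitarymxP.
  have ddE : toC ((d *m d^T) 0 0) = \sum_i `|y 0 i| ^+ 2.
    have -> : toC ((d *m d^T) 0 0) = (map_mx toC (d *m d^T)) 0 0 by rewrite [RHS]mxE.
    rewrite map_mxM -map_trmx dtE dE mulmxA -(mulmxA y) PP mulmx1.
    by rewrite mxE; apply: eq_bigr => i _; rewrite !mxE normCK.
  have dAE : toC ((d *m A *m d^T) 0 0) = \sum_i toC (D 0 i) * `|y 0 i| ^+ 2.
    have -> : toC ((d *m A *m d^T) 0 0) = (map_mx toC (d *m A *m d^T)) 0 0 by rewrite [RHS]mxE.
    rewrite !map_mxM -map_trmx dtE dE Ae invmx_unitary// !mulmxA.
    rewrite -(mulmxA y) PP mulmx1 -(mulmxA _ P) PP mulmx1.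
    rewrite mxE; apply: eq_bigr => i _; rewrite mul_mx_diag !mxE normCK.
    by rewrite -mulrA mulrCA.
  rewrite -lecR rmorphM /= dAE ddE mulr_sumr; apply: ler_sum => i _.
  have [->|ij] := eqVneq i (p j0); first by rewrite y0 normr0 expr0n !mulr0.
  by rewrite ler_wpM2r ?exprn_ge0// lecR Dle2.
- have [phi phiA phi0] := Deig (p j1); exists phi => //.
  rewrite l2E; split => //.
  (* Pairing [phi *m A] with the constants gives [lambda2 * s = s] for the sum [s] of [phi], and
     [lambda2 < 1]. *)
  have : (phi *m A *m (const_mx 1 : 'rV_n)^T) 0 0 = lambda2 * \sum_i phi 0 i.
    rewrite phiA -l2E. rewrite -scalemxAl mxE; congr (_ * _).
    by rewrite mxE; apply: eq_bigr => i _; rewrite !mxE mulr1.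
  rewrite -mulmxA -{1}symA -trmx_mul A1 => /eqP.
  have -> : (phi *m (const_mx 1 : 'rV_n)^T) 0 0 = \sum_i phi 0 i.
    by rewrite mxE; apply: eq_bigr => i _; rewrite !mxE mulr1.
  rewrite eq_sym -subr_eq0 -{2}(mul1r (\sum_i _)) -mulrBl mulf_eq0.
  by rewrite subr_eq0 lt_eqF//= => /eqP.
Qed.
End second_eigenvalue.

(** * The walk on the group: Dirichlet form and Poincare inequality *)

Section walk_gap.
Variables (R : realType) (gT : finGroupType) (S : {set gT}).
Hypothesis S_gen : <<S>>%g = [set: gT]%SET.
Hypothesis S_id : 1%g \notin S.
Hypothesis gT1 : (1 < #|gT|)%N.

Local Notation w := ((#|gT| * #|S|)%:R^-1 : R).
Local Notation gamma := (spectral_gap R S).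

Lemma card_gen_gt0 : (0 < #|S|)%N.
Proof.
rewrite lt0n; apply/eqP => /cards0_eq S0.
move: S_gen; rewrite S0 gen0 => /(congr1 (fun A : {set gT} => #|A|)).
by rewrite cards1 cardsT => h; move: gT1; rewrite -h.
Qed.

Lemma edge_weight_gt0 : 0 < w.
Proof. by rewrite invr_gt0 ltr0n muln_gt0 card_gen_gt0 (ltnW gT1). Qed.

Lemma edge_weight_sum (c : R) : w * (\sum_(g : gT) \sum_(r in S) c) = c.
Proof.
under eq_bigr do rewrite sumr_const.
rewrite sumr_const -mulrnA -[c *+ _]mulr_natl mulrA [(#|S| * _)%N]mulnC.
by rewrite mulVf ?mul1r// -invr_eq0 gt_eqF// edge_weight_gt0.
Qed.

Lemma edge_neq (g r : gT) : r \in S -> g != (g * r)%g.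
Proof.
move=> rS; apply: contra S_id => /eqP.
by rewrite -[X in X = _]mulg1 => /mulgI ->.
Qed.

Lemma sum_tperm_sub (d : gT -> R) (a b : gT) : a != b ->
  \sum_x d x * (d x - d (tperm a b x)) = (d a - d b) ^+ 2.
Proof.
move=> ab; rewrite (bigD1 a)//= (bigD1 b) 1?eq_sym//= tpermL tpermR.
rewrite big1 => [|x /andP[xa xb]]; last by rewrite tpermD 1?eq_sym// subrr mulr0.
by rewrite addr0; ring.
Qed.

(** The Dirichlet form [<d, (1 - P) d>] of the walk; there is no factor 1/2 because one pair [g, r]
    moves both of its endpoints. *)
Definition edge_energy (d : gT -> R) : R :=
  w * \sum_g \sum_(r in S) (d g - d (g * r)%g) ^+ 2.

Lemma edge_energy_ge0 d : 0 <= edge_energy d.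
Proof.
apply: mulr_ge0; first exact/ltW/edge_weight_gt0.
by apply: sumr_ge0 => g _; apply: sumr_ge0 => r _; exact: sqr_ge0.
Qed.

Local Notation fun_row d := (\row_j d (enum_val j) : 'rV[R]_#|gT|).

Lemma sum_enum_val (V : nmodType) (F : gT -> V) :
  \sum_(i < #|gT|) F (enum_val i) = \sum_x F x.
Proof. by rewrite [RHS](reindex_onto enum_val enum_rank) //= => [|x _];
  [apply: eq_bigl => i; rewrite enum_valK eqxx|rewrite enum_rankK]. Qed.

Lemma walk_prob_sum (d : gT -> R) x :
  \sum_y d y * walk_prob R S y x =
  w * \sum_g \sum_(r in S) d (tperm g (g * r)%g x).
Proof.
under eq_bigr do rewrite /walk_prob mulrCA.
rewrite -mulr_sumr; congr (_ * _).
under eq_bigr do rewrite mulr_sumr.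
rewrite exchange_big; apply: eq_bigr => g _ /=.
under eq_bigr do rewrite mulr_sumr.
rewrite exchange_big; apply: eq_bigr => r _ /=.
rewrite (bigD1 (tperm g (g * r)%g x))//= tpermK eqxx mulr1 big1 ?addr0// => y yx.
case: eqP => [xE|]; last by rewrite mulr0.
by move: yx; rewrite -xE tpermK eqxx.
Qed.

Lemma walk_matrix_mulE (d : gT -> R) j :
  (fun_row d *m walk_matrix R S) 0 j =
  w * \sum_g \sum_(r in S) d (tperm g (g * r)%g (enum_val j)).
Proof.
rewrite -walk_prob_sum mxE -sum_enum_val; apply: eq_bigr => i _.
by rewrite !mxE.
Qed.

Lemma walk_matrix_form (d : gT -> R) :
  (fun_row d *m walk_matrix R S *m (fun_row d)^T) 0 0 =
  \sum_x d x ^+ 2 - edge_energy d.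
Proof.
rewrite mxE; under eq_bigr => j _ do rewrite walk_matrix_mulE !mxE.
rewrite (sum_enum_val (fun x => w * (\sum_g \sum_(r in S) d (tperm g (g * r)%g x)) * d x)).
apply/esym/eqP; rewrite subr_eq addrC -subr_eq /edge_energy.
under [X in _ - X]eq_bigr do rewrite -mulrA.
rewrite -mulr_sumr -[X in X - _ == _]edge_weight_sum -mulrBr; apply/eqP; congr (_ * _).
under [X in _ - X]eq_bigr do rewrite mulr_suml.
rewrite [X in _ - X]exchange_big -sumrB; apply: eq_bigr => g _ /=.
under [X in _ - X]eq_bigr do rewrite mulr_suml.
rewrite [X in _ - X]exchange_big -sumrB; apply: eq_bigr => r rS /=.
rewrite -sum_tperm_sub ?edge_neq// -sumrB; apply: eq_bigr => x _.
by rewrite mulrBr expr2 [d (tperm _ _ _) * _]mulrC.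
Qed.

Lemma walk_matrix_sym : (walk_matrix R S)^T = walk_matrix R S.
Proof.
apply/matrixP => i j; rewrite !mxE /walk_prob; congr (_ * _).
apply: eq_bigr => g _; apply: eq_bigr => r _; congr (_%:R).
by rewrite eq_sym (can2_eq (tpermK _ _) (tpermK _ _)).
Qed.

(** Zero energy makes [d] invariant under right multiplication by [S], and every element of the
    group is a product of elements of [S]. *)
Lemma edge_energy_eq0 d : edge_energy d = 0 -> forall x y, d x = d y.
Proof.
move=> /eqP; rewrite mulf_eq0 gt_eqF ?edge_weight_gt0//= psumr_eq0; last first.
  by move=> g _; apply: sumr_ge0 => r _; exact: sqr_ge0.
move=> /allP d0.
have dr g r : r \in S -> d (g * r)%g = d g.
  move=> rS; have := d0 g (mem_index_enum _).
  rewrite psumr_eq0 => [|? _]; last exact: sqr_ge0.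
  move=> /allP/(_ r (mem_index_enum _)); rewrite rS /= sqrf_eq0 subr_eq0.
  by move=> /eqP.
suff d1 x : d x = d 1%g by move=> x y; rewrite d1 [RHS]d1.
have : x \in <<S>>%g by rewrite S_gen inE.
move=> /gen_prodgP[k [c cS ->]]; elim: k c cS => [|k ih] c cS.
  by rewrite big_ord0.
by rewrite big_ord_recr /= dr ?cS// ih.
Qed.

Lemma row_funP (d : 'rV[R]_#|gT|) : exists f : gT -> R, d = fun_row f.
Proof.
by exists (fun x => d 0 (enum_rank x)); apply/rowP => j; rewrite mxE enum_valK.
Qed.

Lemma row_sqr (d : gT -> R) : (fun_row d *m (fun_row d)^T) 0 0 = \sum_x d x ^+ 2.
Proof.
rewrite mxE -sum_enum_val; apply: eq_bigr => i _.
by rewrite !mxE expr2.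
Qed.

Lemma sum_fun_row (d : gT -> R) : \sum_i fun_row d 0 i = \sum_x d x.
Proof. by rewrite -sum_enum_val; apply: eq_bigr => i _; rewrite mxE. Qed.

Let walkP :
  let lambda2 := (eigenvalues (walk_matrix R S))`_1 in
  [/\ lambda2 < 1,
      (forall d : 'rV_#|gT|, \sum_i d 0 i = 0 ->
         (d *m walk_matrix R S *m d^T) 0 0 <= lambda2 * (d *m d^T) 0 0) &
      exists2 phi : 'rV_#|gT|, phi != 0 &
        phi *m walk_matrix R S = lambda2 *: phi /\ \sum_i phi 0 i = 0].
Proof.
apply: second_eigenvalueP gT1 walk_matrix_sym _ _ _.
- have -> : (const_mx 1 : 'rV[R]_#|gT|) = fun_row (fun=> 1) by apply/rowP => i; rewrite !mxE.
  by apply/rowP => j; rewrite [LHS](walk_matrix_mulE (fun=> 1)) edge_weight_sum mxE.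
- move=> d; have [f ->] := row_funP d.
  by rewrite walk_matrix_form row_sqr lerBlDr lerDl edge_energy_ge0.
- move=> d dP; have [f dE] := row_funP d.
  have := walk_matrix_form f; rewrite -dE dP {1 2}dE row_sqr => /esym/eqP.
  rewrite subr_eq addrC -subr_eq subrr eq_sym => /eqP/edge_energy_eq0 h.
  by exists (f 1%g); rewrite dE; apply/rowP => j; rewrite !mxE (h _ 1%g).
Qed.

Lemma spectral_gap_gt0 : 0 < gamma.
Proof. by have [? _ _] := walkP; rewrite subr_gt0. Qed.

Lemma edge_energy_ge (d : gT -> R) : \sum_x d x = 0 ->
  gamma * \sum_x d x ^+ 2 <= edge_energy d.
Proof.
move=> d0; have [_ + _] := walkP.
move=> /(_ (fun_row d)); rewrite sum_fun_row d0 => /(_ erefl).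
by rewrite walk_matrix_form row_sqr /spectral_gap mulrBl mul1r !lerBlDr addrC => ->.
Qed.

Lemma spectral_gap_eigenfunction : exists2 phi : gT -> R,
  (exists x, phi x != 0) & \sum_x phi x = 0 /\
  forall x, w * \sum_g \sum_(r in S) phi (tperm g (g * r)%g x) = (1 - gamma) * phi x.
Proof.
have [_ _ [p p0 [pP ps]]] := walkP.
have [f fE] := row_funP p; exists f.
  apply/existsP; apply: contraNT p0; rewrite negb_exists => /forallP h.
  apply/eqP/rowP => i; rewrite fE !mxE; apply/eqP/negPn; exact: h.
split; first by rewrite -sum_fun_row -fE.
move=> x; have /= := congr1 (fun u : 'rV_#|gT| => u 0 (enum_rank x)) pP.
rewrite fE walk_matrix_mulE enum_rankK => ->.
by rewrite !mxE enum_rankK /spectral_gap opprB addrC subrK.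
Qed.

Lemma edge_energy_le (d : gT -> R) :
  edge_energy d <= 4 / #|gT|%:R * \sum_x d x ^+ 2.
Proof.
have h : \sum_g \sum_(r in S) (d g - d (g * r)%g) ^+ 2 <=
    4 * #|S|%:R * \sum_x d x ^+ 2.
  apply: (@le_trans _ _ (\sum_g \sum_(r in S) (2 * d g ^+ 2 + 2 * d (g * r)%g ^+ 2))).
    apply: ler_sum => g _; apply: ler_sum => r _.
    rewrite -subr_ge0 (_ : _ - _ = (d g + d (g * r)%g) ^+ 2) ?sqr_ge0//; ring.
  under eq_bigr do rewrite big_split /=.
  rewrite big_split /= [X in _ + X]exchange_big /=.
  have shift r : \sum_i d (i * r)%g ^+ 2 = \sum_x d x ^+ 2.
    by rewrite [RHS](reindex_inj (mulIg r)).
  under [X in _ + X]eq_bigr do rewrite -mulr_sumr shift.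
  under eq_bigr do rewrite sumr_const.
  rewrite sumr_const sumrMnl -mulr_sumr -mulrnDl.
  by rewrite -mulr_natr le_eqVlt; apply/orP; left; apply/eqP; ring.
rewrite /edge_energy; apply: (@le_trans _ _ (w * (4 * #|S|%:R * \sum_x d x ^+ 2))).
  by rewrite ler_pM2l ?edge_weight_gt0.
rewrite mulrA ler_wpM2r ?sumr_ge0// => [x _|]; first exact: sqr_ge0.
rewrite natrM le_eqVlt; apply/orP; left; apply/eqP.
have mn0 : (#|S|%:R : R) != 0 by rewrite pnatr_eq0 -lt0n card_gen_gt0.
have nn0 : (#|gT|%:R : R) != 0 by rewrite pnatr_eq0 -lt0n ltnW.
by field; rewrite mn0 nn0.
Qed.

(** A step touches only two of the [n] points, so an energy is at most [4 / n] times the square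
    norm; an eigenfunction turns this into a bound on the gap. It is what keeps [1 - gamma / 2] and
    [1 - gamma / 6] nonnegative later. *)
Lemma spectral_gap_le : gamma <= 4 / #|gT|%:R.
Proof.
have [phi [x phix] [phi0 _]] := spectral_gap_eigenfunction.
have p0 : 0 < \sum_x phi x ^+ 2.
  rewrite (bigD1 x)//= ltr_pwDl ?sumr_ge0// => [|? _]; last exact: sqr_ge0.
  by rewrite exprn_even_gt0.
rewrite -(ler_pM2r p0); apply: le_trans (edge_energy_le _).
exact: edge_energy_ge.
Qed.

End walk_gap.

(** * Integrals over the simplex *)

Lemma ge0_integral_image d d' (T : measurableType d) (T' : measurableType d')
    (R : realType) (mu : {measure set T -> \bar R}) (f : {mfun T >-> T'})
    (g : T' -> \bar R) :
  measurable_fun [set: T'] g -> (forall x, 0 <= g x)%E ->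
  (\int[image_measure mu f]_x g x = \int[mu]_x g (f x))%E.
Proof. by move=> mg g0; rewrite /image_measure ge0_integral_pushforward. Qed.

(** * Affine changes of variable on the line *)

Section affine_substitution.
Variable R : realType.
Local Notation mu := (@lebesgue_measure R).

Definition affine (a b : R) (x : measurableTypeR R) : measurableTypeR R := a + b * x.

Lemma measurable_affine (a b : R) : measurable_fun [set: measurableTypeR R] (affine a b).
Proof. by apply: measurable_funD => //; exact: measurable_funM. Qed.

HB.instance Definition _ a b := @isMeasurableFun.Build _ _ _ _
  (affine a b) (measurable_affine a b).

(** Lebesgue measure is characterized by its values on the intervals []u, v]], and the scaled image
    measure agrees with it there. *)
Lemma lebesgue_measure_affine (a b : R) (b0 : 0 < b) (A : set R) : measurable A ->
  mu A = (b%:E * mu ((fun x => a + b * x)%R @^-1` A))%E.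
Proof.
move=> mA.
pose b' : {nonneg R} := NngNum (ltW b0).
have := @lebesgue_measure_unique R (mscale b' (pushforward mu (affine a b))).
move=> /(_ (measurable_affine a b) _ A mA); rewrite /mscale /= /pushforward; apply.
move=> _ [[u v]] _ <- /=.
change (mu `]u, v]%classic = b%:E * mu (affine a b @^-1` `]u, v]%classic))%E.
have -> : affine a b @^-1` `]u, v]%classic = [set` `](u - a) / b, (v - a) / b]].
  by apply/seteqP; split => x; rewrite /= !in_itv /= /affine
    ltr_pdivrMr// ler_pdivlMr// ltrBlDl lerBrDl [b * x]mulrC.
rewrite !lebesgue_measure_itv/= !lte_fin ltr_pM2r ?invr_gt0// ltrBlDr subrK.
case: ifP => uv; last by rewrite mule0.
rewrite -!EFinD -EFinM; congr EFin; field; lra.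
Qed.

Lemma integral_affine (a b : R) (f : R -> \bar R) : 0 < b ->
  measurable_fun [set: R] f -> (forall x, 0 <= f x)%E ->
  (\int[mu]_x f x = b%:E * \int[mu]_x f (a + b * x)%R)%E.
Proof.
move=> b0 mf f0.
pose b' : {nonneg R} := NngNum (ltW b0).
transitivity (\int[mscale b' (image_measure mu (affine a b))]_x f x)%E.
  apply: eq_measure_integral => A mA _; rewrite /mscale/= /image_measure /pushforward.
  exact: lebesgue_measure_affine.
rewrite ge0_integral_mscale//=; congr (_ * _)%E.
by rewrite ge0_integral_image.
Qed.

Lemma integral_reflection (a : R) (f : R -> \bar R) :
  measurable_fun [set: R] f -> (forall x, 0 <= f x)%E ->
  (\int[mu]_x f x = \int[mu]_x f (a - x)%R)%E.
Proof.
move=> mf f0.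
transitivity (\int[pushforward mu (-%R : measurableTypeR R -> measurableTypeR R)]_x f x)%E.
  by apply: eq_measure_integral => A mA _; exact/esym/lebesgue_measureN.
rewrite ge0_integral_pushforward//=.
rewrite (@integral_affine (- a) 1)//; last first.
  by apply: measurableT_comp.
rewrite mul1e; apply: eq_integral => x _ /=; congr (f _); ring.
Qed.

End affine_substitution.

Section sigma_finite_pack.
Context d (T : measurableType d) (R : realType) (m : {measure set T -> \bar R}).
Hypothesis m_sf : sigma_finite [set: T] m.

Let m_isSFinite := isSFinite.Build _ _ _ _ (sfinite_measure_sigma_finite m_sf).
Let m_isSigmaFinite := isSigmaFinite.Build _ _ _ _ m_sf.

(** The same measure, carrying the structure that Tonelli's theorem asks for: [lebesgue_tuple] and
    the laws of the chain are typed as bare measures. *)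
Definition sigma_finite_pack : {sigma_finite_measure set T -> \bar R} :=
  HB.pack_for (SigmaFiniteMeasure.type T R) (Measure.sort m)
    m_isSFinite m_isSigmaFinite.

End sigma_finite_pack.

(** * Integration over tuples, one coordinate at a time *)

Section lebesgue_tuple_integral.
Variable R : realType.
Local Notation mu := (@lebesgue_measure R).

Definition belast_pair d (t : d.+1.-tuple R) : d.-tuple R * measurableTypeR R :=
  ([tuple tnth t (widen_ord (leqnSn d) i) | i < d], tnth t ord_max).

Lemma rcons_pairK d : cancel (@rcons_pair R d) (@belast_pair d).
Proof.
move=> [y u]; rewrite /belast_pair; congr pair.
  apply: eq_from_tnth => i; rewrite tnth_mktuple !(tnth_nth 0) /=.
  by rewrite nth_rcons size_tuple ltn_ord.
by rewrite (tnth_nth 0) /= nth_rcons size_tuple ltnn eqxx.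
Qed.

Lemma measurable_belast_pair d : measurable_fun [set: _] (@belast_pair d).
Proof.
apply/measurable_fun_pairP; split; last exact: measurable_tnth.
apply/measurable_fun_tnthP => i.
rewrite (_ : _ \o _ = @tnth _ R ^~ (widen_ord (leqnSn d) i)).
  exact: measurable_tnth.
by apply/funext => t /=; rewrite tnth_mktuple.
Qed.

Lemma sigma_finite_lebesgue_tuple d : sigma_finite [set: d.-tuple R] (lebesgue_tuple R d).
Proof.
elim: d => [|d ih].
  exists (fun=> setT); first by rewrite bigcup_const.
  by move=> _; split => //=; rewrite diracT ltry.
have /sigma_finiteP[F [TF ndF Foo]] := ih.
have /sigma_finiteP[G [TG ndG Goo]] := sigma_finiteT mu.
exists (fun n => @belast_pair d @^-1` (F n `*` G n)).
  rewrite -preimage_bigcup (_ : \bigcup_k _ = setT) ?preimage_setT//.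
  apply/seteqP; split => // -[x y] _.
  have [n _ Fnx] : (\bigcup_i F i) x by rewrite -TF.
  have [k _ Gky] : (\bigcup_i G i) y by rewrite -TG.
  exists (maxn n k) => //; split.
    by move: x Fnx; exact/subsetPset/ndF/leq_maxl.
  by move: y Gky; exact/subsetPset/ndG/leq_maxr.
move=> n; have [mF Fn] := Foo n; have [mG Gn] := Goo n; split.
  rewrite -[X in measurable X]setTI; apply: measurable_belast_pair => //.
  exact: measurableX.
rewrite /= /image_measure /pushforward -comp_preimage.
rewrite (_ : _ @^-1` (F n `*` G n) = F n `*` G n); last first.
  by apply/seteqP; split => x; rewrite /preimage /mkset /comp (rcons_pairK x).
by rewrite product_measure1E// lte_mul_pinfty// ge0_fin_numE.
Qed.

Lemma integral_lebesgue_tupleS d (f : d.+1.-tuple R -> \bar R) :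
  measurable_fun [set: _] f -> (forall x, 0 <= f x)%E ->
  (\int[lebesgue_tuple R d.+1]_x f x =
   \int[lebesgue_tuple R d]_y \int[mu]_u f (rcons_pair (y, u)))%E.
Proof.
move=> mf f0; rewrite [LHS]ge0_integral_image//.
rewrite -[LHS]/(\int[sigma_finite_pack (@sigma_finite_lebesgue_tuple d) \x mu]_x f (rcons_pair x))%E.
rewrite (@fubini_tonelli1 _ _ _ _ _ _ _ (f \o @rcons_pair R d))//; last first.
  by move=> x; exact: f0.
by apply: measurableT_comp => //; exact: measurable_rcons_pair.
Qed.

Lemma measurable_integral_rcons d (f : d.+1.-tuple R -> \bar R) :
  measurable_fun [set: _] f -> (forall x, 0 <= f x)%E ->
  measurable_fun [set: d.-tuple R] (fun y => \int[mu]_u f (rcons_pair (y, u)))%E.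
Proof.
move=> mf f0.
apply: (@measurable_fun_fubini_tonelli_F _ _ _ _ _ _ (f \o @rcons_pair R d)).
  by apply: measurableT_comp => //; exact: measurable_rcons_pair.
by move=> x; exact: f0.
Qed.

Definition upd d (y : d.-tuple R) (k : 'I_d) (v : measurableTypeR R) : d.-tuple R :=
  [tuple if i == k then v else tnth y i | i < d].

Lemma tnth_upd d (y : d.-tuple R) k v i :
  tnth (upd y k v) i = if i == k then v else tnth y i.
Proof. by rewrite tnth_mktuple. Qed.

Lemma tnth_rcons_pair d (y : d.-tuple R) u i :
  tnth (rcons_pair (y, u)) (widen_ord (leqnSn d) i) = tnth y i.
Proof. by rewrite !(tnth_nth 0) /= nth_rcons size_tuple ltn_ord. Qed.

Lemma tnth_rcons_pair_max d (y : d.-tuple R) u :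
  tnth (rcons_pair (y, u)) ord_max = u.
Proof. by rewrite (tnth_nth 0) /= nth_rcons size_tuple ltnn eqxx. Qed.

Lemma ord_widen_max d (i : 'I_d.+1) :
  i = ord_max \/ exists j : 'I_d, i = widen_ord (leqnSn d) j.
Proof.
have [id|di] := ltnP i d; last first.
  by left; apply/val_inj/eqP; rewrite eqn_leq di -ltnS ltn_ord.
by right; exists (Ordinal id); exact: val_inj.
Qed.

Lemma widen_ord_neq_max d (j : 'I_d) : (widen_ord (leqnSn d) j == ord_max) = false.
Proof. by apply/negbTE; rewrite -val_eqE /= ltn_eqF. Qed.

Lemma upd_rcons_max d (y : d.-tuple R) u v :
  upd (rcons_pair (y, u)) ord_max v = rcons_pair (y, v).
Proof.
apply: eq_from_tnth => i; rewrite tnth_upd.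
have [->|[j ->]] := ord_widen_max i; first by rewrite eqxx tnth_rcons_pair_max.
by rewrite widen_ord_neq_max !tnth_rcons_pair.
Qed.

Lemma upd_rcons_widen d (y : d.-tuple R) u k v :
  upd (rcons_pair (y, u)) (widen_ord (leqnSn d) k) v = rcons_pair (upd y k v, u).
Proof.
apply: eq_from_tnth => i; rewrite tnth_upd.
have [->|[j ->]] := ord_widen_max i.
  by rewrite eq_sym widen_ord_neq_max !tnth_rcons_pair_max.
by rewrite -val_eqE /= val_eqE !tnth_rcons_pair tnth_upd.
Qed.

Lemma measurable_upd d (k : 'I_d) :
  measurable_fun [set: d.-tuple R * measurableTypeR R] (fun p => upd p.1 k p.2).
Proof.
apply/measurable_fun_tnthP => i.
rewrite (_ : _ \o _ = fun p : d.-tuple R * measurableTypeR R =>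
  if i == k then p.2 else tnth p.1 i); last first.
  by apply/funext => p /=; rewrite tnth_upd.
case: (i == k); first exact: measurable_snd.
have mt : measurable_fun [set: d.-tuple R] (fun y => tnth y i) by exact: measurable_tnth.
exact: (measurableT_comp mt measurable_fst).
Qed.

(** Tonelli in an arbitrary coordinate [k], phrased as a comparison so that the remaining
    coordinates need not be named. The last coordinate is the innermost integral by construction;
    for another [k], the integrals over [k] and over the last coordinate are exchanged and the
    induction hypothesis is applied to the partially integrated functions. *)
Lemma lebesgue_tuple_fiber_eq d (k : 'I_d) (f g : d.-tuple R -> \bar R) :
  measurable_fun [set: _] f -> (forall x, 0 <= f x)%E ->
  measurable_fun [set: _] g -> (forall x, 0 <= g x)%E ->
  (forall y, \int[mu]_v f (upd y k v) = \int[mu]_v g (upd y k v))%E ->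
  (\int[lebesgue_tuple R d]_y f y = \int[lebesgue_tuple R d]_y g y)%E.
Proof.
elim: d k f g => [[]//|d ih] k f g mf f0 mg g0 fg.
rewrite !integral_lebesgue_tupleS//.
have [kE|[j kE]] := ord_widen_max k.
  apply: eq_integral => y _; have := fg (rcons_pair (y, 0)).
  rewrite kE; under eq_integral do rewrite upd_rcons_max.
  by under [in RHS]eq_integral do rewrite upd_rcons_max.
have mrc y (h : d.+1.-tuple R -> \bar R) : measurable_fun setT h ->
    measurable_fun [set: measurableTypeR R * measurableTypeR R]
      (fun p => h (rcons_pair (upd y j p.1, p.2))).
  move=> mh; apply: measurableT_comp => //.
  apply: (measurableT_comp (@measurable_rcons_pair R d)).
  apply/measurable_fun_pairP; split; last exact: measurable_snd.
  exact: (measurableT_comp (measurable_upd j) (measurable_fun_pair (measurable_cst y) measurable_fst)).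
apply: (ih j (fun y => \int[mu]_u f (rcons_pair (y, u)))%E
  (fun y => \int[mu]_u g (rcons_pair (y, u)))%E).
- exact: measurable_integral_rcons.
- by move=> y; apply: integral_ge0.
- exact: measurable_integral_rcons.
- by move=> y; apply: integral_ge0.
move=> y.
rewrite (fubini_tonelli (fun p : measurableTypeR R * measurableTypeR R => f (rcons_pair (upd y j p.1, p.2))))//; last exact: mrc.
rewrite (fubini_tonelli (fun p : measurableTypeR R * measurableTypeR R => g (rcons_pair (upd y j p.1, p.2))))//; last exact: mrc.
apply: eq_integral => u _ /=.
have := fg (rcons_pair (y, u)).
rewrite kE; under eq_integral do rewrite upd_rcons_widen.
by under [in RHS]eq_integral do rewrite upd_rcons_widen.
Qed.

End lebesgue_tuple_integral.

Section interval_substitution.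
Variable R : realType.
Local Notation mu := (@lebesgue_measure R).

Lemma integral_itv_affine (a b p q : R) (h : R -> \bar R) : 0 < b ->
  measurable_fun [set: R] h -> (forall x, 0 <= h x)%E ->
  (\int[mu]_(v in `[(a + b * p)%R, (a + b * q)%R]) h v =
   b%:E * \int[mu]_(l in `[p, q]) h (a + b * l)%R)%E.
Proof.
move=> b0 mh h0; rewrite integral_mkcond (integral_affine a b0); last 2 first.
- by apply/(measurable_restrictT _ _).1 => //; exact: measurable_funTS.
- by move=> x; apply: erestrict_ge0 => y _; exact: h0.
congr (_ * _)%E; rewrite [RHS]integral_mkcond; apply: eq_integral => l _.
rewrite !patchE !mem_setE !in_itv /= !lerD2l. by rewrite !ler_pM2l.
Qed.

Lemma integral_itv_reflection (a p q : R) (h : R -> \bar R) :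
  measurable_fun [set: R] h -> (forall x, 0 <= h x)%E ->
  (\int[mu]_(v in `[p, q]) h v =
   \int[mu]_(v in `[(a - q)%R, (a - p)%R]) h (a - v)%R)%E.
Proof.
move=> mh h0; rewrite integral_mkcond (integral_reflection a); last 2 first.
- by apply/(measurable_restrictT _ _).1 => //; exact: measurable_funTS.
- by move=> x; apply: erestrict_ge0 => y _; exact: h0.
rewrite [RHS]integral_mkcond; apply: eq_integral => l _.
rewrite !patchE !mem_setE !in_itv /=.
by rewrite (_ : (p <= a - l <= q) = (a - q <= l <= a - p))//; apply/idP/idP; lra.
Qed.

End interval_substitution.

(** * Resampling a pair of coordinates *)

Section moves.
Variables (R : realType) (n : nat).
Local Notation mu := (@lebesgue_measure R).
Implicit Types (x : n.-tuple R) (i j k : 'I_n) (f : n.-tuple R -> \bar R).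

Definition move i j x (l : R) : n.-tuple R :=
  [tuple if k == i then l * (tnth x i + tnth x j)
         else if k == j then (1 - l) * (tnth x i + tnth x j)
         else tnth x k | k < n].

(* The operator [move_int i j] is the conditional expectation given all coordinates
   but [i] and [j], for the uniform distribution on the simplex. *)
Definition move_int i j f x : \bar R := (\int[mu]_(l in `[0%R, 1%R]) f (move i j x l))%E.

Definition swap i j x : n.-tuple R := [tuple tnth x (tperm i j k) | k < n].

Lemma tnth_move i j x l k : tnth (move i j x l) k =
  if k == i then l * (tnth x i + tnth x j)
  else if k == j then (1 - l) * (tnth x i + tnth x j) else tnth x k.
Proof. by rewrite tnth_mktuple. Qed.

Lemma tnth_swap i j x k : tnth (swap i j x) k = tnth x (tperm i j k).
Proof. by rewrite tnth_mktuple. Qed.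

Lemma move_sym i j x l : i != j -> move j i x l = move i j x (1 - l).
Proof.
move=> ij; apply: eq_from_tnth => k; rewrite !tnth_move.
have [->|kj] := eqVneq k j; last by case: eqP => // _; congr (_ * _); ring.
by rewrite eq_sym (negbTE ij); congr (_ * _); ring.
Qed.

(** Conjugation by a transposition changes the second index of a move. This reduces every pair to
    one containing the last coordinate, the one that the chart of the simplex eliminates. *)
Lemma move_swap i j m x l : i != j -> i != m ->
  move i j (swap j m x) l = swap j m (move i m x l).
Proof.
move=> ij im; apply: eq_from_tnth => k; rewrite tnth_swap !tnth_move !tnth_swap.
have si : tperm j m i = i by rewrite tpermD// eq_sym.
have ki : (tperm j m k == i) = (k == i).
  by rewrite -[X in _ == X]si (inj_eq perm_inj).
have km : (tperm j m k == m) = (k == j).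
  by rewrite -[X in _ == X](tpermL j m) (inj_eq perm_inj).
by rewrite tpermL si ki km.
Qed.

Lemma measurable_move i j :
  measurable_fun [set: n.-tuple R * measurableTypeR R] (fun p => move i j p.1 p.2).
Proof.
have mt k : measurable_fun [set: n.-tuple R * measurableTypeR R] (fun p => tnth p.1 k).
  have mt : measurable_fun [set: n.-tuple R] (fun y => tnth y k) by exact: measurable_tnth.
  exact: (measurableT_comp mt measurable_fst).
apply/measurable_fun_tnthP => k.
rewrite (_ : _ \o _ = fun p : n.-tuple R * measurableTypeR R =>
    if k == i then p.2 * (tnth p.1 i + tnth p.1 j)
    else if k == j then (1 - p.2) * (tnth p.1 i + tnth p.1 j)
    else tnth p.1 k); last first.
  by apply/funext => p /=; rewrite tnth_move.
case: (k == i).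
  by apply: measurable_funM; [exact: measurable_snd|exact: measurable_funD].
case: (k == j); last exact: mt.
apply: measurable_funM; last exact: measurable_funD.
by apply: measurable_funB => //; exact: measurable_snd.
Qed.

Lemma measurable_move1 i j x : measurable_fun [set: measurableTypeR R] (move i j x).
Proof.
have : measurable_fun [set: measurableTypeR R] (fun l : measurableTypeR R => (x, l)).
  exact: pair1_measurable.
by move/(measurableT_comp (measurable_move i j)).
Qed.

Lemma measurable_swap i j : measurable_fun [set: n.-tuple R] (swap i j).
Proof.
apply/measurable_fun_tnthP => k.
rewrite (_ : _ \o _ = @tnth _ R ^~ (tperm i j k)); first exact: measurable_tnth.
by apply/funext => x /=; rewrite tnth_swap.
Qed.

Lemma move_int_ge0 i j f : (forall x, 0 <= f x)%E -> forall x, (0 <= move_int i j f x)%E.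
Proof. by move=> f0 x; apply: integral_ge0. Qed.

Lemma measurable_move_int i j f : measurable_fun [set: _] f -> (forall x, 0 <= f x)%E ->
  measurable_fun [set: _] (move_int i j f).
Proof.
move=> mf f0.
rewrite (_ : move_int i j f = fun x => \int[mu]_l
   ((fun p : n.-tuple R * measurableTypeR R => f (move i j p.1 p.2)) \_ (setT `*` `[0%R, 1%R])) (x, l))%E; last first.
  apply/funext => x; rewrite /move_int integral_mkcond; apply: eq_integral => l _.
  by rewrite !patchE; congr (if _ then _ else _); apply/idP/idP; rewrite !inE/= => -[].
apply: (@measurable_fun_fubini_tonelli_F _ _ _ _ _ mu) => //.
  apply/(measurable_restrictT _ _).1; first exact: measurableX.
  apply: measurable_funTS; apply: measurableT_comp => //; exact: measurable_move.
by move=> p; apply: erestrict_ge0 => q _; exact: f0.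
Qed.

Lemma move_int_sym i j f x : i != j ->
  measurable_fun [set: _] f -> (forall x, 0 <= f x)%E ->
  move_int j i f x = move_int i j f x.
Proof.
move=> ij mf f0; rewrite /move_int [RHS](integral_itv_reflection 1)//.
  rewrite subrr subr0; apply: eq_integral => l _.
  by rewrite move_sym.
by apply: measurableT_comp => //; exact: measurable_move1.
Qed.

End moves.

(** * Invariance of the integral over the simplex under moves *)

Section simplex_invariance.
Variables (R : realType) (d : nat).
Local Notation mu := (@lebesgue_measure R).
Local Notation lift := (@corner_lift R d.+1).
Local Notation wd := (widen_ord (leqnSn d)).

Lemma tnth_lift_widen (y : d.-tuple R) k : tnth (lift y) (wd k) = tnth y k.
Proof. by rewrite tnth_mktuple [RHS](tnth_nth (1 - \sum_(i < d) tnth y i)). Qed.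

Lemma tnth_lift_max (y : d.-tuple R) : tnth (lift y) ord_max = 1 - \sum_(i < d) tnth y i.
Proof. by rewrite tnth_mktuple nth_default // size_tuple. Qed.

Lemma measurable_lift : measurable_fun [set: d.-tuple R] lift.
Proof. exact: (@measurable_corner_lift R d.+1). Qed.

Lemma lift_simplex (y : d.-tuple R) : corner y -> simplex R d.+1 (lift y).
Proof.
move=> [y0 y1]; split.
  move=> i; have [->|[j ->]] := ord_widen_max i.
    by rewrite tnth_lift_max subr_ge0.
  by rewrite tnth_lift_widen.
rewrite big_ord_recr /= tnth_lift_max; under eq_bigr do rewrite tnth_lift_widen.
by rewrite addrC subrK.
Qed.

Definition simplex_int (f : d.+1.-tuple R -> \bar R) : \bar R :=
  (\int[lebesgue_tuple R d]_(y in @corner R d) f (lift y))%E.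

Local Notation slack y k := (1 - \sum_(i < d | i != k) tnth y i).

Definition others_ge0 (y : d.-tuple R) k := forall i, i != k -> 0 <= tnth y i.

Lemma upd_corner (y : d.-tuple R) k v :
  corner (upd y k v) <-> others_ge0 y k /\ 0 <= v <= slack y k.
Proof.
rewrite /corner /= (bigD1 k)//= tnth_upd eqxx.
under eq_bigr => i ik do rewrite tnth_upd (negbTE ik).
rewrite -lerBrDr; split => [[y0 y1]|[y0 /andP[v0 v1]]].
  split; last by rewrite y1 andbT; have := y0 k; rewrite tnth_upd eqxx.
  by move=> i ik; have := y0 i; rewrite tnth_upd (negbTE ik).
by split => // i; rewrite tnth_upd; case: eqVneq => // ik; exact: y0.
Qed.

Lemma tnth_lift_upd (y : d.-tuple R) k v i :
  tnth (lift (upd y k v)) i =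
  if i == wd k then v else if i == ord_max then slack y k - v else tnth (lift y) i.
Proof.
have [->|[j ->]] := ord_widen_max i.
  rewrite [_ == wd k]eq_sym widen_ord_neq_max eqxx tnth_lift_max.
  rewrite (bigD1 k)//= tnth_upd eqxx.
  under eq_bigr => j jk do rewrite tnth_upd (negbTE jk).
  ring.
rewrite widen_ord_neq_max !tnth_lift_widen tnth_upd.
by rewrite -[wd j == wd k]val_eqE /= val_eqE.
Qed.

(** On a fibre of the chart, a move of the coordinate [k] and the last one forgets the position [v]
    and puts a uniform point on the segment from 0 to the slack: the conditional law of the pair
    given the other coordinates. *)
Lemma move_lift_upd (y : d.-tuple R) k v l :
  move (wd k) ord_max (lift (upd y k v)) l = lift (upd y k (slack y k * l)).
Proof.
apply: eq_from_tnth => i; rewrite tnth_move !tnth_lift_upd !eqxx.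
rewrite [ord_max == _]eq_sym widen_ord_neq_max.
case: eqP => // _; first by ring.
by case: eqP => // _; ring.
Qed.

Lemma swap_lift_upd (y : d.-tuple R) k v :
  swap (wd k) ord_max (lift (upd y k v)) = lift (upd y k (slack y k - v)).
Proof.
apply: eq_from_tnth => i; rewrite tnth_swap !tnth_lift_upd.
case: tpermP => [->|->|/eqP ik /eqP im].
- by rewrite eqxx eq_sym widen_ord_neq_max eqxx.
- by rewrite !eqxx eq_sym widen_ord_neq_max; ring.
- by rewrite (negbTE ik) (negbTE im).
Qed.

Lemma fiber_corner (y : d.-tuple R) k (h : R -> \bar R) :
  (\int[mu]_v ((fun z : d.-tuple R => h (tnth z k)) \_ (@corner R d)) (upd y k v) =
   if `[< others_ge0 y k >]
   then \int[mu]_(v in `[0%R, slack y k]) h v else 0)%E.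
Proof.
case: asboolP => y0; last first.
  rewrite integral0_eq// => v _; rewrite patchE memNset//.
  by move=> /upd_corner[].
rewrite [RHS]integral_mkcond; apply: eq_integral => v _.
rewrite !patchE tnth_upd eqxx mem_setE in_itv /=.
have [vc|vc] := boolP (0 <= v <= slack y k).
  by rewrite mem_set//; apply/upd_corner.
by rewrite memNset// => /upd_corner[_]; apply/negP.
Qed.

Lemma measurable_corner_patch (f : d.-tuple R -> \bar R) :
  measurable_fun [set: _] f -> measurable_fun [set: _] (f \_ (@corner R d)).
Proof.
move=> mf; apply/(measurable_restrictT _ _).1; first exact: measurable_corner.
exact: measurable_funTS.
Qed.

Lemma measurable_lift_upd (y : d.-tuple R) k :
  measurable_fun [set: measurableTypeR R] (fun v => lift (upd y k v)).
Proof.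
have : measurable_fun [set: measurableTypeR R] (fun l : measurableTypeR R => (y, l)).
  exact: pair1_measurable.
move/(measurableT_comp (measurable_upd k)) => /=.
by move/(measurableT_comp (@measurable_corner_lift R d.+1)).
Qed.

Lemma simplex_int_fiber (f g : d.+1.-tuple R -> \bar R) k :
  measurable_fun [set: _] f -> (forall x, 0 <= f x)%E ->
  measurable_fun [set: _] g -> (forall x, 0 <= g x)%E ->
  (forall y, (0 <= slack y k)%R ->
    \int[mu]_(v in `[0%R, slack y k]) f (lift (upd y k v)) =
    \int[mu]_(v in `[0%R, slack y k]) g (lift (upd y k v)))%E ->
  simplex_int f = simplex_int g.
Proof.
move=> mf f0 mg g0 fg; rewrite /simplex_int integral_mkcond [RHS]integral_mkcond.
have key (h : d.+1.-tuple R -> \bar R) y :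
    (\int[mu]_v (((h \o lift) \_ (@corner R d)) (upd y k v)) =
    if `[< others_ge0 y k >]
    then \int[mu]_(v in `[0%R, slack y k]) h (lift (upd y k v)) else 0)%E.
  rewrite -(fiber_corner y k (fun v => h (lift (upd y k v)))).
  apply: eq_integral => v _; rewrite !patchE tnth_upd eqxx /=.
  by case: ifP.
apply: (lebesgue_tuple_fiber_eq (k := k)).
- exact: (measurable_corner_patch (measurableT_comp mf measurable_lift)).
- by move=> y; apply: erestrict_ge0 => z _; exact: f0.
- exact: (measurable_corner_patch (measurableT_comp mg measurable_lift)).
- by move=> y; apply: erestrict_ge0 => z _; exact: g0.
move=> y; rewrite !key; case: asboolP => // y0.
have [s0|s0] := leP 0 (slack y k); first exact: fg.
by rewrite set_itv_ge ?bnd_simp -?ltNge// !integral_set0.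
Qed.

(** On a fibre of positive length the resampled function is constant, equal to the mean of [f] over
    the fibre, so both have the same integral there; a fibre of length 0 contributes nothing. *)
Lemma simplex_int_move_max k f : measurable_fun [set: _] f -> (forall x, 0 <= f x)%E ->
  simplex_int (move_int (wd k) ord_max f) = simplex_int f.
Proof.
move=> mf f0; apply: (simplex_int_fiber (k := k)) => //.
- exact: measurable_move_int.
- exact: move_int_ge0.
move=> y; set c := slack y k; rewrite le_eqVlt => /predU1P[<-|c0].
  by rewrite set_itv1 !integral_set1.
have mh : measurable_fun [set: R] (fun v => f (lift (upd y k v))).
  by apply: measurableT_comp => //; exact: measurable_lift_upd.
have := integral_itv_affine 0 0 1 c0 mh (fun=> f0 _).
rewrite mulr0 mulr1 !add0r => ->.
rewrite (eq_integral (cst (\int[mu]_(l in `[0%R, 1%R]) f (lift (upd y k (0 + c * l)%R)))%E)).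
  rewrite integral_cst//= lebesgue_measure_itv/= lte_fin c0 muleC -EFinD subr0.
  by [].
move=> v _; apply: eq_integral => l _.
by rewrite move_lift_upd add0r.
Qed.

Lemma simplex_int_swap_max k f : measurable_fun [set: _] f -> (forall x, 0 <= f x)%E ->
  simplex_int (f \o swap (wd k) ord_max) = simplex_int f.
Proof.
move=> mf f0; apply: (simplex_int_fiber (k := k)) => //.
- by apply: measurableT_comp => //; exact: measurable_swap.
- by move=> x; exact: f0.
move=> y c0.
have mh : measurable_fun [set: R] (fun v => f (lift (upd y k v))).
  by apply: measurableT_comp => //; exact: measurable_lift_upd.
rewrite [RHS](integral_itv_reflection (slack y k))// subr0 subrr.
by apply: eq_integral => v _ /=; rewrite swap_lift_upd.
Qed.

Lemma simplex_int_move i j f : i != j ->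
  measurable_fun [set: _] f -> (forall x, 0 <= f x)%E ->
  simplex_int (move_int i j f) = simplex_int f.
Proof.
move=> + mf f0.
have [->|[i' ->]] := ord_widen_max i; have [->|[j' ->]] := ord_widen_max j.
- by rewrite eqxx.
- move=> ij; have -> : move_int ord_max (wd j') f = move_int (wd j') ord_max f.
    by apply/funext => x; rewrite move_int_sym// eq_sym.
  exact: simplex_int_move_max.
- by move=> _; exact: simplex_int_move_max.
(* Neither index is the last one: conjugate by the exchange of [j] with the last coordinate. *)
move=> ij; rewrite -(simplex_int_swap_max j'); last 2 first.
- exact: measurable_move_int.
- exact: move_int_ge0.
have -> : move_int (wd i') (wd j') f \o swap (wd j') ord_max =
    move_int (wd i') ord_max (f \o swap (wd j') ord_max).
  apply/funext => x; apply: eq_integral => l _ /=.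
  by rewrite move_swap// widen_ord_neq_max.
rewrite simplex_int_move_max.
- exact: simplex_int_swap_max.
- by apply: measurableT_comp => //; exact: measurable_swap.
- by move=> x; exact: f0.
Qed.

Lemma simplex_int_swap i f : measurable_fun [set: _] f -> (forall x, 0 <= f x)%E ->
  simplex_int (f \o swap i ord_max) = simplex_int f.
Proof.
move=> mf f0; have [->|[k ->]] := ord_widen_max i; last exact: simplex_int_swap_max.
congr simplex_int; apply/funext => x /=; congr f.
by apply: eq_from_tnth => k; rewrite tnth_swap tperm1 perm1.
Qed.

End simplex_invariance.

Lemma sume_const (R : realType) (I : finType) (P : {pred I}) (v : \bar R) : (0 <= v)%E ->
  (\sum_(i in P) v = #|P|%:R%:E * v)%E.
Proof.
move=> v0; rewrite big_const; elim: #|P| => [|m ih] /=; first by rewrite mul0e.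
by rewrite ih -[X in (X + _)%E]mul1e -ge0_muleDl ?lee_fin// -EFinD -natr1 addrC.
Qed.

Lemma ge0_integral_mrestr d (T : measurableType d) (R : realType)
    (m : {measure set T -> \bar R}) (D : set T) (mD : measurable D) (f : T -> \bar R) :
  measurable_fun [set: T] f -> (forall x, 0 <= f x)%E ->
  (\int[mrestr m mD]_x f x = \int[m]_(x in D) f x)%E.
Proof.
move=> mf f0; rewrite -(setUv D) ge0_integral_setU//; last 3 first.
- exact: measurableC.
- by rewrite setUv.
- exact/disj_setPCl.
rewrite [X in (_ + X)%E](_ : _ = 0%E) ?adde0; last first.
  apply: null_set_integral => //; first exact: measurableC.
    exact: measurable_funTS.
  by rewrite /= /mrestr setICl measure0.
by apply: eq_measure_integral => A mA AD; rewrite /= /mrestr setIidl.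
Qed.

(** * Volume, tails and second moments of the uniform distribution *)

Section simplex_volume.
Variable R : realType.
Local Notation mu := (@lebesgue_measure R).
Local Notation one d := (cst 1%E : d.+1.-tuple R -> \bar R).

Definition coord_abs n (i : 'I_n) (x : n.-tuple R) : \bar R := `|tnth x i|%:E.

Lemma measurable_coord_abs n (i : 'I_n) : measurable_fun [set: n.-tuple R] (coord_abs i).
Proof.
apply/measurable_EFinP; apply: measurableT_comp => //.
by apply: measurable_tnth.
Qed.

Lemma simplex_int_cst d (c : R) : 0 <= c ->
  simplex_int (cst c%:E : d.+1.-tuple R -> \bar R) = (c%:E * simplex_int (one d))%E.
Proof.
move=> c0; rewrite /simplex_int -ge0_integralZl//.
- by apply: eq_integral => y _ /=; rewrite mule1.
- exact: measurable_corner.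
Qed.

Lemma simplex_int_sum d n (f : 'I_n -> d.+1.-tuple R -> \bar R) :
  (forall i, measurable_fun [set: _] (f i)) -> (forall i x, 0 <= f i x)%E ->
  simplex_int (fun x => \sum_i f i x)%E = (\sum_i simplex_int (f i))%E.
Proof.
move=> mf f0; rewrite /simplex_int ge0_integral_sum//; first exact: measurable_corner.
move=> i; apply: measurable_funTS.
have := measurableT_comp (mf i) (@measurable_lift R d). by apply.
Qed.

Lemma eq_simplex_int d (f g : d.+1.-tuple R -> \bar R) :
  (forall x, simplex R d.+1 x -> f x = g x) -> simplex_int f = simplex_int g.
Proof.
move=> fg; apply: eq_integral => y; rewrite inE => cy; apply: fg.
exact: lift_simplex.
Qed.

Lemma corner_rcons d (y : d.-tuple R) u : corner (rcons_pair (y, u)) <->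
  (forall i, 0 <= tnth y i) /\ 0 <= u <= 1 - \sum_(i < d) tnth y i.
Proof.
rewrite /corner /= big_ord_recr /= tnth_rcons_pair_max.
under eq_bigr do rewrite tnth_rcons_pair.
rewrite -lerBrDl; split => [[y0 ->]|[y0 /andP[u0 ->]]].
  have := y0 ord_max; rewrite tnth_rcons_pair_max andbT; split => // i.
  by have := y0 (widen_ord (leqnSn d) i); rewrite tnth_rcons_pair.
split => // i; have [->|[j ->]] := ord_widen_max i.
  by rewrite tnth_rcons_pair_max.
by rewrite tnth_rcons_pair.
Qed.

(** The [d + 1] coordinates sum to 1 and have equal integrals by symmetry, so [d + 1] times the
    integral of the last one is the volume. The last coordinate at [y] is also the length of the
    fibre above [y] in the next dimension, so its integral is the next volume. *)
Lemma simplex_volumeS d :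
  (d.+1%:R%:E * simplex_int (one d.+1) =
   simplex_int (one d))%E.
Proof.
have sym i : simplex_int (@coord_abs d.+1 i) = simplex_int (@coord_abs d.+1 ord_max).
  rewrite -(simplex_int_swap i (@measurable_coord_abs _ i)); last first.
    by move=> x; rewrite lee_fin.
  congr simplex_int; apply/funext => x /=.
  by rewrite /coord_abs tnth_swap tpermL.
have sum1 : (\sum_i simplex_int (@coord_abs d.+1 i) =
    simplex_int (one d))%E.
  rewrite -simplex_int_sum; last 2 first.
  - by move=> i; exact: measurable_coord_abs.
  - by move=> i x; rewrite lee_fin.
  apply: eq_simplex_int => x [x0 x1]; rewrite sumEFin /= -x1; congr EFin.
  by apply: eq_bigr => i _; rewrite ger0_norm.
rewrite -sum1; under eq_bigr do rewrite sym.
rewrite sume_const ?card_ord; last by apply: integral_ge0 => y _; rewrite lee_fin.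
congr (_ * _)%E.
rewrite /simplex_int integral_mkcond integral_lebesgue_tupleS; last 2 first.
- exact: measurable_corner_patch.
- by move=> y; apply: erestrict_ge0.
rewrite [RHS]integral_mkcond; apply: eq_integral => y _.
rewrite [RHS]patchE.
have rc u := corner_rcons y u.
have [ycor|ycor] := boolP (y \in _).
  have [y0 y1] := set_mem ycor.
  rewrite /coord_abs tnth_lift_max ger0_norm ?subr_ge0//.
  transitivity (\int[mu]_(u in `[0%R, (1 - \sum_(i < d) tnth y i)%R]) (cst 1 u))%E.
    rewrite [RHS]integral_mkcond; apply: eq_integral => u _.
    rewrite !patchE mem_setE in_itv /=; congr (if _ then _ else _).
    by apply/idP/idP => [/set_mem/rc[]//|u01]; apply/mem_set/rc.
  rewrite integral_cst//= mul1e lebesgue_measure_itv/= lte_fin.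
  case: ltP => [_|]; first by rewrite -EFinB subr0.
  by move=> y1'; congr EFin; apply/le_anti; rewrite subr_ge0 y1.
rewrite integral0_eq// => u _; rewrite patchE memNset// => /rc[y0 /andP[u0 uy]].
move/negP: ycor; apply; apply/mem_set; split => //.
by rewrite -subr_ge0 (le_trans u0).
Qed.

Lemma simplex_volume d :
  simplex_int (one d) = (d`!%:R^-1)%:E.
Proof.
elim: d => [|d ih].
  have -> : simplex_int (one 0) = (\int[lebesgue_tuple R 0]_(y in setT) cst 1 y)%E.
    rewrite /simplex_int; congr (integral _ _ _); apply/seteqP; split => // y _.
    by split => [[]//|]; rewrite big_ord0.
  by rewrite integral_cst//= diracT mul1e invr1.
have := simplex_volumeS d; rewrite ih.
set v := simplex_int _ => h.
have vfin : v \is a fin_num.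
  rewrite ge0_fin_numE; last by apply: integral_ge0.
  rewrite ltey; apply: contra_eqN h => /eqP ->.
  by rewrite mulry gtr0_sg ?mul1e.
move: h; rewrite -(fineK vfin) -EFinM => -[] h; congr EFin.
by rewrite factS natrM invfM -h mulrA mulVf ?mul1r ?pnatr_eq0.
Qed.

End simplex_volume.

Lemma integral01_poly (R : realType) (p q : {poly R}) : q^`() = p ->
  (\int[@lebesgue_measure R]_(l in `[0%R, 1%R]) (p.[l])%:E = (q.[1] - q.[0])%:E)%E.
Proof.
move=> qp; rewrite (@continuous_FTC2 _ _ (fun x => q.[x]))//.
- by apply: continuous_subspaceT => x; exact: continuous_horner.
- split.
  + by move=> x _; exact: derivable_horner.
  + by apply: cvg_at_right_filter; exact: continuous_horner.
  + by apply: cvg_at_left_filter; exact: continuous_horner.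
- by move=> x _; have <- := congr1 (fun f => f x) (derive.derivE q); rewrite qp.
Qed.

Lemma integral01_quadratic (R : realType) (A B C : R) :
  (\int[@lebesgue_measure R]_(l in `[0%R, 1%R]) (A + B * l + C * l ^+ 2)%:E =
   (A + B / 2 + C / 3)%:E)%E.
Proof.
pose q : {poly R} := A *: 'X + (B / 2) *: 'X^2 + (C / 3) *: 'X^3.
have h := integral01_poly (erefl q^`()).
transitivity (q.[1] - q.[0])%:E; last first.
  congr EFin; by rewrite /q !(hornerD, hornerZ, hornerX, hornerXn); ring.
rewrite -h; apply: eq_integral => l _; congr EFin.
rewrite /q !poly.derivE !(hornerD, hornerZ, hornerX, hornerXn, hornerMn, hornerC) /=.
by rewrite !expr1; lra.
Qed.

Section uniform_simplex_theory.
Variable R : realType.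
Local Notation mu := (@lebesgue_measure R).

Lemma integral_uniform_simplex d (f : d.+1.-tuple R -> \bar R) :
  measurable_fun [set: _] f -> (forall x, 0 <= f x)%E ->
  (\int[uniform_simplex R d.+1]_x f x = d`!%:R%:E * simplex_int f)%E.
Proof.
move=> mf f0.
pose c : {nonneg R} := NngNum (ler0n R d`!).
have mfl : measurable_fun [set: d.-tuple R] (f \o (@corner_lift R d.+1)).
  exact: (measurableT_comp mf (@measurable_lift R d)).
rewrite /uniform_simplex ge0_integral_distribution//.
set m := mrestr _ _.
have mT : m setT = (d`!%:R^-1)%:E.
  rewrite -simplex_volume /simplex_int integral_cst; last exact: measurable_corner.
  by rewrite mul1e /m /mrestr setTI.
transitivity (\int[mscale c m]_y (f \o (@corner_lift R d.+1)) y)%E.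
  apply: eq_measure_integral => A mA _; rewrite /= /mnormalize /=.
  set e := mrestr _ _ setT; have -> : e = (d`!%:R^-1)%:E := mT.
  by rewrite eqe gt_eqF ?invr_gt0 ?ltr0n ?fact_gt0//= invrK /mscale /= muleC.
rewrite ge0_integral_mscale//= /simplex_int; congr (_ * _)%E.
by rewrite ge0_integral_mrestr.
Qed.

Variable n : nat.
Implicit Types (i j : 'I_n) (f g : n.-tuple R -> \bar R).
Local Notation U := (uniform_simplex R n).

Lemma uniform_move i j f : i != j ->
  measurable_fun [set: _] f -> (forall x, 0 <= f x)%E ->
  (\int[U]_x move_int i j f x = \int[U]_x f x)%E.
Proof.
case: n i j f => [[]//|d] i j f ij mf f0.
rewrite !integral_uniform_simplex//; first by rewrite simplex_int_move.
- exact: measurable_move_int.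
- exact: move_int_ge0.
Qed.

Lemma eq_uniform f g : (0 < n)%N ->
  measurable_fun [set: _] f -> (forall x, 0 <= f x)%E ->
  measurable_fun [set: _] g -> (forall x, 0 <= g x)%E ->
  (forall x, simplex R n x -> f x = g x) ->
  (\int[U]_x f x = \int[U]_x g x)%E.
Proof.
case: n f g => [//|d] f g _ mf f0 mg g0 fg.
by rewrite !integral_uniform_simplex//; congr (_ * _)%E; exact: eq_simplex_int.
Qed.

Lemma le_uniform f g : (0 < n)%N ->
  measurable_fun [set: _] f -> (forall x, 0 <= f x)%E ->
  measurable_fun [set: _] g -> (forall x, 0 <= g x)%E ->
  (forall x, simplex R n x -> f x <= g x)%E ->
  (\int[U]_x f x <= \int[U]_x g x)%E.
Proof.
case: n f g => [//|d] f g _ mf f0 mg g0 fg.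
rewrite !integral_uniform_simplex//; apply: lee_wpmul2l; first by rewrite lee_fin ler0n.
apply: ge0_le_integral => //.
- exact: measurable_corner.
- by apply: measurable_funTS; have := measurableT_comp mf (@measurable_lift R d); apply.
- by apply: measurable_funTS; have := measurableT_comp mg (@measurable_lift R d); apply.
- by move=> y cy; apply: fg; exact: lift_simplex.
Qed.

Lemma measurable_simplex : measurable (simplex R n).
Proof.
have mt i : measurable_fun [set: n.-tuple R] (fun x => tnth x i) by exact: measurable_tnth.
rewrite (_ : simplex R n = (\bigcap_(i in [set: 'I_n])
    ((fun x => tnth x i) @^-1` `[0, +oo[)) `&`
    ((fun x : n.-tuple R => \sum_(i < n) tnth x i) @^-1` [set 1])); last first.
  apply/seteqP; split => x /=.
    by move=> [x0 x1]; split => // i _ /=; rewrite in_itv /= x0.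
  move=> [x0 x1]; split => // i.
  by have := x0 i I; rewrite /= in_itv /= andbT.
apply: measurableI.
  apply: fin_bigcap_measurable; first exact: finite_finset.
  by move=> i _; rewrite -[X in measurable X]setTI; exact: mt.
rewrite -[X in measurable X]setTI.
have : measurable_fun [set: n.-tuple R] (fun x => \sum_(i < n) tnth x i).
  exact: measurable_sum.
by apply.
Qed.

Definition tail i (e : R) (x : n.-tuple R) : \bar R := ((tnth x i < e)%R%:R)%:E.

Lemma tail_ge0 i e x : (0 <= tail i e x)%E.
Proof. by rewrite lee_fin. Qed.

Lemma measurable_tail i e : measurable_fun [set: n.-tuple R] (tail i e).
Proof.
apply/measurable_EFinP.
have mA : measurable [set x : n.-tuple R | tnth x i < e].
  have mt : measurable_fun [set: n.-tuple R] (fun x => tnth x i) by exact: measurable_tnth.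
  rewrite (_ : mkset _ = (fun x => tnth x i) @^-1` `]-oo, e[); last first.
    by apply/seteqP; split => x /=; rewrite in_itv.
  by rewrite -[X in measurable X]setTI; exact: mt.
rewrite (_ : (fun _ => _) = \1_[set x : n.-tuple R | tnth x i < e]).
  exact: measurable_indic.
by apply/funext => x; rewrite indicE; congr (_%:R); congr nat_of_bool;
  apply/idP/idP => [h|/set_mem//]; apply/mem_set.
Qed.

End uniform_simplex_theory.

Section uniform_tail.
Variable R : realType.
Local Notation mu := (@lebesgue_measure R).

(** The last but one coordinate is chosen because it is the innermost variable of integration in the
    chart. Each fibre has length at most [e] below level [e], and the base of the fibration is the
    corner of one dimension less, whence the volume on the right. *)
Lemma simplex_int_tail d (e : R) : 0 <= e ->
  (simplex_int (tail (widen_ord (leqnSn d.+1) ord_max) e) <=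
   e%:E * simplex_int (cst 1%E : d.+1.-tuple R -> \bar R))%E.
Proof.
move=> e0; rewrite -simplex_int_cst// /simplex_int.
rewrite integral_mkcond integral_lebesgue_tupleS; last 2 first.
- have := measurableT_comp (measurable_tail (widen_ord (leqnSn d.+1) ord_max) e) (@measurable_lift R d.+1).
  by move=> h; exact: measurable_corner_patch.
- by move=> y; apply: erestrict_ge0 => x _; exact: tail_ge0.
rewrite [leRHS]integral_mkcond; apply: ge0_le_integral => //.
- by move=> y _; apply: integral_ge0 => u _; apply: erestrict_ge0 => x _; exact: tail_ge0.
- apply: measurable_integral_rcons.
    have := measurableT_comp (measurable_tail (widen_ord (leqnSn d.+1) ord_max) e) (@measurable_lift R d.+1).
    by move=> h; exact: measurable_corner_patch.
  by move=> y; apply: erestrict_ge0 => x _; exact: tail_ge0.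
- exact: measurable_corner_patch.
move=> y _; have [ycor|ycor] := boolP (y \in @corner R d); last first.
  rewrite integral0_eq; first by rewrite patchE (negbTE ycor).
  move=> u _; rewrite patchE memNset// => /corner_rcons[y0 /andP[u0 uy]].
  move/negP: ycor; apply; apply/mem_set; split => //.
  by rewrite -subr_ge0 (le_trans u0).
rewrite patchE ycor.
have -> : cst e%:E (corner_lift (n:=d.+1) y) =
    (\int[mu]_(u in `[0%R, e]) cst 1%E u)%E.
  rewrite integral_cst//= mul1e lebesgue_measure_itv/= lte_fin.
  case: ltP => [_|h]; first by rewrite -EFinB subr0.
  by congr EFin; apply/le_anti; rewrite h e0.
rewrite [leRHS]integral_mkcond; apply: ge0_le_integral => //.
- by move=> u _; apply: erestrict_ge0 => x _; exact: tail_ge0.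
- have h := measurableT_comp (measurable_tail (widen_ord (leqnSn d.+1) ord_max) e) (@measurable_lift R d.+1).
  have /measurable_corner_patch {}h := h.
  have : measurable_fun [set: measurableTypeR R] (fun l : measurableTypeR R => (y, l)).
    exact: pair1_measurable.
  move/(measurableT_comp (@measurable_rcons_pair R d)).
  by move/(measurableT_comp h).
- by apply/(measurable_restrictT _ _).1.
move=> u _; rewrite !patchE; case: ifPn => [/set_mem/corner_rcons[_ /andP[u0 _]]|_].
  rewrite /tail tnth_lift_widen tnth_rcons_pair_max mem_setE in_itv /= u0 /=.
  have [ue|eu] := ltP u e; first by rewrite (ltW ue).
  by case: ifP => _; rewrite lee_fin.
by case: ifP => _ //; rewrite lee_fin.
Qed.

Lemma uniform_tail n (i : 'I_n) (e : R) : (1 < n)%N -> 0 <= e ->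
  (\int[uniform_simplex R n]_x tail i e x <= (n%:R * e)%:E)%E.
Proof.
case: n i => [//|[//|d]] i _ e0.
rewrite integral_uniform_simplex//; [|exact: measurable_tail|exact: tail_ge0].
have sym (j : 'I_d.+2) : simplex_int (tail j e) = simplex_int (@tail R d.+2 ord_max e).
  rewrite -(simplex_int_swap j (measurable_tail j e)); last exact: tail_ge0.
  apply: eq_simplex_int => x _ /=.
  by rewrite /tail tnth_swap tpermL.
rewrite sym -(sym (widen_ord (leqnSn d.+1) ord_max)).
apply: (@le_trans _ _ (d.+1`!%:R%:E * (e%:E * simplex_int (cst 1%E : d.+1.-tuple R -> \bar R))))%E.
  by apply: lee_wpmul2l; [rewrite lee_fin ler0n|exact: simplex_int_tail].
rewrite simplex_volume -!EFinM lee_fin factS natrM.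
have f0 : (d`!%:R : R) != 0 by rewrite pnatr_eq0 -lt0n fact_gt0.
(* The ratio of the two volumes is [d + 1], that is [n - 1], then bounded by [n]. *)
have -> : d.+1%:R * d`!%:R * (e / d`!%:R) = d.+1%:R * e :> R by field.
by rewrite ler_wpM2r// ler_nat.
Qed.

End uniform_tail.

Section uniform_moments.
Variables (R : realType) (n : nat).
Hypothesis n1 : (1 < n)%N.
Local Notation U := (uniform_simplex R n).
Local Notation mu := (@lebesgue_measure R).

Let n0 : (0 < n)%N. Proof. exact: ltnW. Qed.

(* The absolute value is harmless on the simplex and gives an integrand that is
   nonnegative everywhere, so that no integrability has to be discussed. *)
Definition coord_prod (i j : 'I_n) (x : n.-tuple R) : \bar R := `|tnth x i * tnth x j|%:E.

Lemma measurable_coord_prod i j : measurable_fun [set: n.-tuple R] (coord_prod i j).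
Proof.
apply/measurable_EFinP; apply: measurableT_comp => //.
by apply: measurable_funM; apply: measurable_tnth.
Qed.

Lemma coord_prod_ge0 i j x : (0 <= coord_prod i j x)%E.
Proof. by rewrite lee_fin. Qed.

Hint Resolve coord_prod_ge0 measurable_coord_prod : core.

Lemma coord_prodE i j x : simplex R n x -> coord_prod i j x = (tnth x i * tnth x j)%:E.
Proof. by move=> [x0 _]; rewrite /coord_prod ger0_norm// mulr_ge0. Qed.

Lemma move_simplex i j x l : i != j -> 0 <= l <= 1 -> simplex R n x ->
  simplex R n (move i j x l).
Proof.
move=> ij /andP[l0 l1] [x0 x1]; split => [k|].
  rewrite tnth_move; case: eqP => _; first by rewrite mulr_ge0// addr_ge0.
  by case: eqP => _ //; rewrite mulr_ge0 ?subr_ge0// addr_ge0.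
rewrite -x1 (bigD1 i)//= (bigD1 j) 1?eq_sym//= [RHS](bigD1 i)//= [X in _ = _ + X](bigD1 j) 1?eq_sym//=.
rewrite !tnth_move eqxx [j == i]eq_sym (negbTE ij) eqxx !addrA; congr (_ + _); first by ring.
by apply: eq_bigr => k /andP[ki kj]; rewrite tnth_move (negbTE ki) (negbTE kj).
Qed.

Lemma uniform_one : (\int[U]_x cst 1%E x = 1)%E.
Proof. by rewrite integral_cst// mul1e; exact: (probability_setT U). Qed.

Definition moment i j : R := fine (\int[U]_x coord_prod i j x)%E.

Lemma momentE i j : (\int[U]_x coord_prod i j x = (moment i j)%:E)%E.
Proof.
rewrite fineK// ge0_fin_numE ?integral_ge0//.
apply: (@le_lt_trans _ _ (\int[U]_x cst 1%E x)%E).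
  apply: le_uniform => // x sx; rewrite coord_prodE// lee_fin.
  have [x0 x1] := sx.
  have le1 k : tnth x k <= 1.
    by rewrite -x1 (bigD1 k)//= lerDl sumr_ge0.
  by rewrite mulr_ile1.
by rewrite uniform_one ltry.
Qed.

Lemma measurable_coord_comb (c : 'I_n -> 'I_n -> R) :
  measurable_fun [set: n.-tuple R] (fun x => \sum_i \sum_j (c i j)%:E * coord_prod i j x)%E.
Proof.
apply: emeasurable_sum => i; apply: emeasurable_sum => j.
exact: emeasurable_funM.
Qed.

Lemma integral_coord_comb (c : 'I_n -> 'I_n -> R) : (forall i j, 0 <= c i j) ->
  (\int[U]_x (\sum_i \sum_j (c i j)%:E * coord_prod i j x) =
   (\sum_i \sum_j c i j * moment i j)%:E)%E.
Proof.
move=> c0; rewrite ge0_integral_sum//; last 2 first.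
- by move=> i; apply: emeasurable_sum => j; exact: emeasurable_funM.
- by move=> i x _; apply: sume_ge0 => j _; rewrite mule_ge0 ?lee_fin.
rewrite -sumEFin; apply: eq_bigr => i _.
rewrite ge0_integral_sum//; last 2 first.
- by move=> j; exact: emeasurable_funM.
- by move=> j x _; rewrite mule_ge0 ?lee_fin.
rewrite -sumEFin; apply: eq_bigr => j _.
by rewrite ge0_integralZl ?lee_fin// momentE.
Qed.

Lemma moment_sym i j : moment i j = moment j i.
Proof.
rewrite /moment; congr fine; apply: eq_integral => x _.
by rewrite /coord_prod mulrC.
Qed.

(** By invariance a moment is unchanged when the pair [i, j] is resampled; if the resampled product
    depends on [x_i + x_j] only, this is a linear relation between moments. *)
Lemma moment_move (i j a b : 'I_n) (c : R) : i != j -> 0 <= c ->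
  (forall x, simplex R n x ->
     move_int i j (coord_prod a b) x = (c * (tnth x i + tnth x j) ^+ 2)%:E) ->
  moment a b = c * (moment i i + 2 * moment i j + moment j j).
Proof.
move=> ij c0 h; apply: EFin_inj; rewrite -momentE -(uniform_move ij)//.
have mc u v k : measurable_fun [set: n.-tuple R] (fun x => k%:E * coord_prod u v x)%E.
  by exact: emeasurable_funM.
have pc u v (k : R) x : 0 <= k -> (0 <= k%:E * coord_prod u v x)%E.
  by move=> k0; rewrite mule_ge0 ?lee_fin.
transitivity (\int[U]_x (c%:E * coord_prod i i x + (2 * c)%:E * coord_prod i j x
   + c%:E * coord_prod j j x))%E.
  apply: eq_uniform => //.
  - exact: measurable_move_int.
  - exact: move_int_ge0.
  - by apply: emeasurable_funD => //; exact: emeasurable_funD.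
  - by move=> x; rewrite !adde_ge0// pc// mulr_ge0.
  move=> x sx; rewrite h// !coord_prodE// -!EFinM -!EFinD; congr EFin; ring.
have c20 : 0 <= 2 * c by rewrite mulr_ge0.
rewrite ge0_integralD//; last 3 first.
- by move=> x _; rewrite adde_ge0// pc.
- exact: emeasurable_funD.
- by move=> x _; rewrite pc.
rewrite ge0_integralD//; last 2 first.
- by move=> x _; rewrite pc.
- by move=> x _; rewrite pc.
rewrite !ge0_integralZl ?lee_fin// !momentE -!EFinM -!EFinD; congr EFin; ring.
Qed.

(* Resampling the pair [i, j] gives [E x_i^2 = E (x_i + x_j)^2 / 3] and
   [E x_i x_j = E (x_i + x_j)^2 / 6]. *)
Lemma moment_diag2 i j : i != j -> moment i i = 2 * moment i j.
Proof.
move=> ij.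
have h1 : moment i i = 3^-1 * (moment i i + 2 * moment i j + moment j j).
  apply: moment_move => // x [x0 _].
  have := integral01_quadratic 0 0 ((tnth x i + tnth x j) ^+ 2).
  rewrite mul0r !add0r mulrC => <-; apply: eq_integral => l _.
  rewrite /coord_prod tnth_move eqxx -expr2 ger0_norm ?sqr_ge0//; congr EFin; ring.
have h2 : moment i j = 6^-1 * (moment i i + 2 * moment i j + moment j j).
  apply: moment_move => // x [x0 _].
  have := integral01_quadratic 0 ((tnth x i + tnth x j) ^+ 2) (- (tnth x i + tnth x j) ^+ 2).
  rewrite add0r (_ : _ / 2 + _ = 6^-1 * (tnth x i + tnth x j) ^+ 2); last by field.
  move=> <-; apply: eq_integral => l; rewrite inE/= in_itv/= => /andP[l0 l1].
  rewrite /coord_prod !tnth_move eqxx [j == i]eq_sym (negbTE ij) eqxx.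
  rewrite ger0_norm; first by congr EFin; ring.
  by rewrite mulr_ge0// mulr_ge0 ?subr_ge0// addr_ge0.
by lra.
Qed.

(** All diagonal moments equal some [a] and all others [a / 2], by [moment_diag2]; expanding
    [(sum x_i)^2 = 1] gives [a n (n + 1) / 2 = 1]. *)
Lemma momentP : exists2 a : R, a = 2 / (n%:R * n.+1%:R) &
  forall i j, moment i j = a / 2 * (1 + (i == j)%:R).
Proof.
pose i0 := Ordinal n0; pose a := moment i0 i0.
have diag i : moment i i = a.
  have [->//|ii0] := eqVneq i i0.
  by rewrite (moment_diag2 ii0) moment_sym -moment_diag2// eq_sym.
have mE i j : moment i j = a / 2 * (1 + (i == j)%:R).
  have [->|ij] := eqVneq i j; first by rewrite diag mulr1n; lra.
  by rewrite -(diag i) (moment_diag2 ij) mulr0n; lra.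
exists a => //.
have : (\sum_i \sum_j 1 * moment i j) = 1.
  apply: EFin_inj; rewrite -(integral_coord_comb (c := fun _ _ => 1))//.
  transitivity (\int[U]_x cst 1%E x)%E; last exact: uniform_one.
  apply: eq_uniform => //.
  - exact: measurable_coord_comb.
  - by move=> x; apply: sume_ge0 => i _; apply: sume_ge0 => j _; rewrite mule_ge0 ?lee_fin.
  move=> x sx; have [_ x1] := sx.
  under eq_bigr do under eq_bigr do rewrite coord_prodE// -EFinM mul1r.
  under eq_bigr do rewrite sumEFin -mulr_sumr x1 mulr1.
  by rewrite sumEFin x1.
have sumc (i : 'I_n) : \sum_j 1 * moment i j = a / 2 * (n%:R + 1).
  under eq_bigr do rewrite mul1r mE.
  rewrite -mulr_sumr big_split /= sumr_const card_ord; congr (_ * (_ + _)).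
  rewrite (bigD1 i)//= eqxx big1 ?addr0// => j /negbTE.
  by rewrite eq_sym => ->.
under eq_bigr do rewrite sumc.
rewrite sumr_const card_ord -[X in X = _]mulr_natr => h.
have nn : (n%:R : R) != 0 by rewrite pnatr_eq0 -lt0n.
have n1n : (n%:R + 1 : R) != 0 by rewrite natr1 pnatr_eq0.
rewrite -[n.+1%:R]natr1; apply: (@mulIf _ (n%:R * (n%:R + 1))); first by rewrite mulf_neq0.
rewrite /= divfK ?mulf_neq0//; lra.
Qed.

Lemma uniform_linear_var (phi : 'I_n -> R) :
  (forall i, `|phi i| <= 1) -> \sum_i phi i = 0 ->
  (\int[U]_x ((\sum_i phi i * tnth x i) ^+ 2)%:E <= (n.+1%:R^-1)%:E)%E.
Proof.
move=> phi1 phi0.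
have mf : measurable_fun [set: n.-tuple R] (fun x => \sum_i phi i * tnth x i).
  by apply: measurable_sum => i; apply: measurable_funM => //; exact: measurable_tnth.
have mf2 : measurable_fun [set: n.-tuple R] (fun x => ((\sum_i phi i * tnth x i) ^+ 2)%:E).
  by apply/measurable_EFinP; exact: measurable_funX.
have c0 i j : 0 <= phi i * phi j + 1.
  rewrite -lerBlDr sub0r lerNl; apply: (le_trans (ler_norm _)).
  by rewrite normrN normrM mulr_ile1.
(* Adding [1 = (sum x_i)^2] makes every coefficient [phi i * phi j + 1] nonnegative, so that only
   integrals of nonnegative functions occur. *)
have h : (\int[U]_x ((\sum_i phi i * tnth x i) ^+ 2)%:E + 1 =
    (\sum_i \sum_j (phi i * phi j + 1) * moment i j)%:E)%E.
  rewrite -uniform_one -ge0_integralD//; last by move=> x _; rewrite lee_fin sqr_ge0.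
  rewrite -integral_coord_comb//.
  apply: eq_uniform => //.
  - exact: emeasurable_funD.
  - by move=> x; rewrite adde_ge0// lee_fin sqr_ge0.
  - exact: measurable_coord_comb.
  - by move=> x; apply: sume_ge0 => i _; apply: sume_ge0 => j _; rewrite mule_ge0 ?lee_fin.
  move=> x sx; have [_ x1] := sx.
  under [RHS]eq_bigr => i _.
    under eq_bigr => j _ do rewrite coord_prodE// -EFinM.
    rewrite sumEFin.
    under eq_bigr => j _.
      rewrite (_ : (phi i * phi j + 1) * (tnth x i * tnth x j) = phi i * tnth x i * (phi j * tnth x j) + tnth x i * tnth x j); last by ring.
      over.
    rewrite big_split /= -!mulr_sumr x1 mulr1.
    over.
  rewrite sumEFin big_split /= x1 -mulr_suml -EFinD expr2.
  by [].
have [a aE mE] := momentP.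
have s2 : \sum_i \sum_j (phi i * phi j + 1) * moment i j =
    a / 2 * (\sum_i phi i ^+ 2 + n%:R * (n%:R + 1)).
  have cst_sum (v : R) : \sum_(j < n) v = n%:R * v.
    by rewrite sumr_const card_ord mulr_natl.
  have inner i : \sum_j (phi i * phi j + 1) * moment i j = a / 2 * (phi i ^+ 2 + (1 + n%:R)).
    have -> : \sum_j (phi i * phi j + 1) * moment i j =
        a / 2 * (\sum_j (phi i * phi j + 1) + \sum_j (i == j)%:R * (phi i * phi j + 1)).
      by rewrite -big_split mulr_sumr; apply: eq_bigr => j _; rewrite mE /=; ring.
    rewrite big_split /= -mulr_sumr phi0 mulr0 add0r cst_sum.
    rewrite (bigD1 i)//= eqxx big1 => [|j /negbTE]; last first.
      by rewrite eq_sym => ->; rewrite mul0r.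
    by rewrite mulr1n; ring.
  under eq_bigr do rewrite inner.
  by rewrite -mulr_sumr big_split /= cst_sum [1 + _]addrC.
have s3 : \sum_i phi i ^+ 2 <= n%:R.
  rewrite -[leRHS]mulr1 mulr_natl -[X in _ *+ X]card_ord -sumr_const ler_sum// => i _.
  by rewrite -real_normK ?num_real// expr_le1.
rewrite s2 in h.
have nn : (n%:R : R) != 0 by rewrite pnatr_eq0 -lt0n.
have n1n : (n.+1%:R : R) != 0 by rewrite pnatr_eq0.
rewrite -(leeD2rE _ _ (_ : 1%:E \is a fin_num))// h -EFinD lee_fin.
have -> : n.+1%:R^-1 + 1 = a / 2 * (n%:R + n%:R * (n%:R + 1)) :> R.
  by rewrite aE natr1; move: nn n1n; rewrite -[n.+1%:R]natr1 => nn n1n; field; rewrite nn n1n.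
rewrite ler_wpM2l ?lerD2r// aE mulr_ge0 ?invr_ge0// divr_ge0 ?mulr_ge0//.
Qed.

End uniform_moments.

(** * The transition operator *)

Section random_maps.
Context d (X : measurableType d) (R : realType) (I : finType) (Q : {pred I}).
Variable F : I -> X -> measurableTypeR R -> X.
Hypothesis mF : forall i, measurable_fun [set: X * measurableTypeR R] (fun p => F i p.1 p.2).
Hypothesis Q0 : (0 < #|Q|)%N.
Local Notation mu := (@lebesgue_measure R).
Local Notation w := (#|Q|%:R^-1 : R).
Implicit Types f g : X -> \bar R.

Definition rint i f x : \bar R := (\int[mu]_(l in `[0%R, 1%R]) f (F i x l))%E.

(** Transition operator of the chain that picks [i] uniformly in [Q] and [l] uniformly in [[0, 1]].
    The maps are left arbitrary because it serves twice: for one chain, and for two chains driven by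
    the same moves. *)
Definition rop f x : \bar R := (w%:E * \sum_(i in Q) rint i f x)%E.

Let mF1 i x : measurable_fun [set: measurableTypeR R] (F i x).
Proof.
have : measurable_fun [set: measurableTypeR R] (fun l : measurableTypeR R => (x, l)).
  exact: pair1_measurable.
by move/(measurableT_comp (mF i)).
Qed.

Let w0 : (0 <= w%:E)%E. Proof. by rewrite lee_fin invr_ge0. Qed.

Lemma rint_ge0 i f : (forall x, 0 <= f x)%E -> forall x, (0 <= rint i f x)%E.
Proof. by move=> f0 x; apply: integral_ge0. Qed.

Lemma rop_ge0 f : (forall x, 0 <= f x)%E -> forall x, (0 <= rop f x)%E.
Proof. by move=> f0 x; rewrite mule_ge0// sume_ge0// => i _; exact: rint_ge0. Qed.

Lemma measurable_rint i f : measurable_fun [set: X] f -> (forall x, 0 <= f x)%E ->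
  measurable_fun [set: X] (rint i f).
Proof.
move=> mf f0.
rewrite (_ : rint i f = fun x => \int[mu]_l
   ((fun p : X * measurableTypeR R => f (F i p.1 p.2)) \_ (setT `*` `[0%R, 1%R])) (x, l))%E; last first.
  apply/funext => x; rewrite /rint integral_mkcond; apply: eq_integral => l _.
  by rewrite !patchE; congr (if _ then _ else _); apply/idP/idP; rewrite !inE/= => -[].
apply: (@measurable_fun_fubini_tonelli_F _ _ _ _ _ mu) => //.
  apply/(measurable_restrictT _ _).1; first exact: measurableX.
  by apply: measurable_funTS; apply: measurableT_comp => //; exact: mF.
by move=> p; apply: erestrict_ge0 => q _; exact: f0.
Qed.

Lemma measurable_rop f : measurable_fun [set: X] f -> (forall x, 0 <= f x)%E ->
  measurable_fun [set: X] (rop f).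
Proof.
move=> mf f0; apply: emeasurable_funM => //.
under eq_fun do rewrite -big_enum /=.
by apply: emeasurable_sum => i; exact: measurable_rint.
Qed.

Lemma rintD i f g x : measurable_fun [set: X] f -> (forall x, 0 <= f x)%E ->
  measurable_fun [set: X] g -> (forall x, 0 <= g x)%E ->
  rint i (fun x => f x + g x)%E x = (rint i f x + rint i g x)%E.
Proof.
move=> mf f0 mg g0; rewrite /rint ge0_integralD//.
- by apply: measurable_funTS; have := measurableT_comp mf (mF1 i x).
- by apply: measurable_funTS; have := measurableT_comp mg (mF1 i x).
Qed.

Lemma rintZ i f x (c : R) : 0 <= c -> measurable_fun [set: X] f -> (forall x, 0 <= f x)%E ->
  rint i (fun x => c%:E * f x)%E x = (c%:E * rint i f x)%E.
Proof.
move=> c0 mf f0; rewrite /rint ge0_integralZl//.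
by apply: measurable_funTS; have := measurableT_comp mf (mF1 i x).
Qed.

Lemma rint_cst i (c : R) x : rint i (fun=> c%:E) x = c%:E.
Proof.
rewrite /rint integral_cst// -[RHS]mule1; congr (_ * _)%E.
by rewrite /= lebesgue_measure_itv/= lte_fin ltr01 -EFinB subr0.
Qed.

Lemma ropD f g x : measurable_fun [set: X] f -> (forall x, 0 <= f x)%E ->
  measurable_fun [set: X] g -> (forall x, 0 <= g x)%E ->
  rop (fun x => f x + g x)%E x = (rop f x + rop g x)%E.
Proof.
move=> mf f0 mg g0; rewrite /rop; under eq_bigr do rewrite rintD//.
rewrite big_split/= ge0_muleDr//; apply: sume_ge0 => i _; exact: rint_ge0.
Qed.

Lemma ropZ f x (c : R) : 0 <= c -> measurable_fun [set: X] f -> (forall x, 0 <= f x)%E ->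
  rop (fun x => c%:E * f x)%E x = (c%:E * rop f x)%E.
Proof.
move=> c0 mf f0; rewrite /rop; under eq_bigr do rewrite rintZ//.
rewrite -ge0_sume_distrr; first by rewrite muleCA.
by move=> i _; exact: rint_ge0.
Qed.

Lemma rop_cst (c : R) x : 0 <= c -> rop (fun=> c%:E) x = c%:E.
Proof.
move=> c0; rewrite /rop; under eq_bigr do rewrite rint_cst.
rewrite sumEFin sumr_const -EFinM -[c *+ _]mulr_natl mulrA mulVf ?mul1r//.
by rewrite pnatr_eq0 -lt0n.
Qed.

Section domain.
Variable D : set X.
Hypothesis FD : forall i x l, i \in Q -> 0 <= l <= 1 -> D x -> D (F i x l).

Lemma le_rint i f g : i \in Q ->
  measurable_fun [set: X] f -> (forall x, 0 <= f x)%E ->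
  measurable_fun [set: X] g -> (forall x, 0 <= g x)%E ->
  (forall x, D x -> f x <= g x)%E -> forall x, D x -> (rint i f x <= rint i g x)%E.
Proof.
move=> iQ mf f0 mg g0 fg x Dx; apply: ge0_le_integral => //.
- by apply: measurable_funTS; have := measurableT_comp mf (mF1 i x).
- by apply: measurable_funTS; have := measurableT_comp mg (mF1 i x).
- by move=> l /=; rewrite in_itv/= => l01; apply: fg; exact: FD.
Qed.

Lemma eq_rint i f g : i \in Q ->
  (forall x, D x -> f x = g x)%E -> forall x, D x -> (rint i f x = rint i g x)%E.
Proof.
move=> iQ fg x Dx; apply: eq_integral => l; rewrite inE/= in_itv/= => l01.
by apply: fg; exact: FD.
Qed.

Lemma le_rop f g :
  measurable_fun [set: X] f -> (forall x, 0 <= f x)%E ->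
  measurable_fun [set: X] g -> (forall x, 0 <= g x)%E ->
  (forall x, D x -> f x <= g x)%E -> forall x, D x -> (rop f x <= rop g x)%E.
Proof.
move=> mf f0 mg g0 fg x Dx; apply: lee_wpmul2l => //.
by apply: lee_sum => i iQ; exact: le_rint.
Qed.

Lemma eq_rop f g : (forall x, D x -> f x = g x)%E -> forall x, D x -> (rop f x = rop g x)%E.
Proof.
move=> fg x Dx; congr (_ * _)%E; apply: eq_bigr => i iQ.
exact: eq_rint.
Qed.

End domain.

Section iterates.

Lemma iter_rop_ge0 f : (forall x, 0 <= f x)%E -> forall t x, (0 <= iter t rop f x)%E.
Proof. by move=> f0; elim=> [//|t ih] x; rewrite iterS; exact: rop_ge0. Qed.

Lemma measurable_iter_rop f t : measurable_fun [set: X] f -> (forall x, 0 <= f x)%E ->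
  measurable_fun [set: X] (iter t rop f).
Proof.
by move=> mf f0; elim: t => [//|t ih]; rewrite iterS; apply: measurable_rop => // x;
  exact: iter_rop_ge0.
Qed.

Lemma iter_ropD f g t x : measurable_fun [set: X] f -> (forall x, 0 <= f x)%E ->
  measurable_fun [set: X] g -> (forall x, 0 <= g x)%E ->
  iter t rop (fun x => f x + g x)%E x = (iter t rop f x + iter t rop g x)%E.
Proof.
move=> mf f0 mg g0; elim: t x => [//|t ih] x; rewrite !iterS.
have -> : iter t rop (fun x => f x + g x)%E = (fun x => iter t rop f x + iter t rop g x)%E.
  exact/funext.
by rewrite ropD//; [exact: measurable_iter_rop|exact: iter_rop_ge0|
  exact: measurable_iter_rop|exact: iter_rop_ge0].
Qed.

Lemma iter_ropZ f t x (c : R) : 0 <= c -> measurable_fun [set: X] f -> (forall x, 0 <= f x)%E ->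
  iter t rop (fun x => c%:E * f x)%E x = (c%:E * iter t rop f x)%E.
Proof.
move=> c0 mf f0; elim: t x => [//|t ih] x; rewrite !iterS.
have -> : iter t rop (fun x => c%:E * f x)%E = (fun x => c%:E * iter t rop f x)%E.
  exact/funext.
by rewrite ropZ//; [exact: measurable_iter_rop|exact: iter_rop_ge0].
Qed.

Lemma iter_rop_cst (c : R) t x : 0 <= c -> iter t rop (fun=> c%:E) x = c%:E.
Proof.
move=> c0; elim: t x => [//|t ih] x; rewrite iterS.
have -> : iter t rop (fun=> c%:E) = (fun=> c%:E) by exact/funext.
exact: rop_cst.
Qed.

(** Since [D] is stable under the maps, a bound valid on [D] alone survives any number of steps; [D]
    will be the simplex or its square. *)
Lemma le_iter_rop (D : set X) f g t :
  (forall i x l, i \in Q -> 0 <= l <= 1 -> D x -> D (F i x l)) ->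
  measurable_fun [set: X] f -> (forall x, 0 <= f x)%E ->
  measurable_fun [set: X] g -> (forall x, 0 <= g x)%E ->
  (forall x, D x -> f x <= g x)%E -> forall x, D x -> (iter t rop f x <= iter t rop g x)%E.
Proof.
move=> FD mf f0 mg g0 fg; elim: t => [//|t ih] x Dx; rewrite !iterS.
by apply: (le_rop FD) => //; try exact: measurable_iter_rop; exact: iter_rop_ge0.
Qed.

Lemma eq_iter_rop (D : set X) f g t :
  (forall i x l, i \in Q -> 0 <= l <= 1 -> D x -> D (F i x l)) ->
  (forall x, D x -> f x = g x)%E -> forall x, D x -> (iter t rop f x = iter t rop g x)%E.
Proof.
move=> FD fg; elim: t => [//|t ih] x Dx; rewrite !iterS.
exact: (eq_rop FD).
Qed.

End iterates.

End random_maps.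

Section gibbs_operator.
Variables (R : realType) (gT : finGroupType) (S : {set gT}).
Hypothesis S0 : (0 < #|S|)%N.
Local Notation vec := (#|gT|.-tuple R).
Local Notation mu := (@lebesgue_measure R).

Definition edges : {pred gT * gT} := [pred p | p.2 \in S].

Lemma sum_edges (V : nmodType) (f : gT * gT -> V) :
  \sum_(p in edges) f p = \sum_g \sum_(r in S) f (g, r).
Proof. by rewrite pair_big_dep; apply: eq_big => -[]. Qed.

Lemma card_edges : #|edges| = (#|gT| * #|S|)%N.
Proof.
rewrite -cardsT -cardsX; by apply: eq_card => -[g r]; rewrite finset.in_setX finset.in_setT.
Qed.

Lemma card_edges_gt0 : (0 < #|edges|)%N.
Proof. by rewrite card_edges muln_gt0 S0 andbT; apply/card_gt0P; exists 1%g. Qed.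

Definition edge_map (p : gT * gT) (x : vec) (l : measurableTypeR R) : vec :=
  gibbs_move p.1 p.2 (x, l).

Lemma measurable_edge_map p :
  measurable_fun [set: vec * measurableTypeR R] (fun z => edge_map p z.1 z.2).
Proof.
rewrite (_ : (fun _ => _) = @gibbs_move R gT p.1 p.2); first exact: measurable_gibbs_move.
by apply/funext => -[].
Qed.

Definition gibbs_op := @rop _ vec R _ edges edge_map.

Lemma edge_mapE p x l :
  edge_map p x l = move (enum_rank p.1) (enum_rank (p.1 * p.2)%g) x l.
Proof.
apply: eq_from_tnth => k; rewrite tnth_move tnth_mktuple /Defs.coord.
have e h : (enum_val k == h) = (k == enum_rank h).
  by rewrite (can2_eq (@enum_valK _) (@enum_rankK _)).
by rewrite !e enum_valK.
Qed.

(** Duality between laws and functions: the chain is then studied through its operator acting on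
    nonnegative functions. Total mass 1 gives the sigma-finiteness needed by Tonelli. *)
Lemma integral_gibbs_step (m : {measure set vec -> \bar R}) (f : vec -> \bar R) :
  m setT = 1%E -> measurable_fun [set: _] f -> (forall x, 0 <= f x)%E ->
  (\int[gibbs_step S m]_x f x = \int[m]_x gibbs_op f x)%E.
Proof.
move=> m1 mf f0.
have msf : sigma_finite [set: vec] m.
  by exists (fun=> setT); rewrite ?bigcup_const// => _; split => //; rewrite m1 ltry.
have N0 := card_edges_gt0.
pose mm (k : nat) : {measure set vec -> \bar R} :=
  let p := nth (1%g, 1%g) (enum edges) k in
  image_measure (m \x uniform_prob (@ltr01 R))%E (gibbs_move p.1 p.2).
have w0 : 0 <= (#|edges|%:R^-1 : R) by rewrite invr_ge0.
pose c : {nonneg R} := NngNum w0.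
(* The double sum over [g] and [r] becomes a finite sum of measures indexed by the enumeration of
   the edges. *)
transitivity (\int[mscale c (msum mm #|edges|)]_x f x)%E.
  apply: eq_measure_integral => A mA _.
  rewrite /= /gibbs_step /mscale /= -card_edges; congr (_ * _)%E.
  rewrite /msum -(sum_edges (fun p => image_measure _ (gibbs_move p.1 p.2) A)).
  rewrite -big_enum /= (big_nth (1%g, 1%g)) big_mkord.
  by rewrite -cardE.
rewrite ge0_integral_mscale// ge0_integral_measure_sum//.
rewrite -(big_mkord xpredT (fun k => \int[mm k]_x f x)%E) cardE.
rewrite -(big_nth (1%g, 1%g) xpredT (fun p => \int[image_measure (m \x uniform_prob (@ltr01 R)) (gibbs_move p.1 p.2)]_x f x)%E).
rewrite big_enum /=.
have ie p : (\int[image_measure (m \x uniform_prob (@ltr01 R)) (gibbs_move p.1 p.2)]_x f x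
   = \int[m]_x rint edge_map p f x)%E.
  rewrite ge0_integral_image//.
  rewrite -[LHS]/(\int[sigma_finite_pack msf \x uniform_prob (@ltr01 R)]_x f (gibbs_move p.1 p.2 x))%E.
  rewrite (@fubini_tonelli1 _ _ _ _ _ _ _ (f \o @gibbs_move R gT p.1 p.2))//; last 2 first.
  - by apply: measurableT_comp => //; exact: measurable_gibbs_move.
  - by move=> x; exact: f0.
  apply: eq_integral => x _; rewrite /fubini_F integral_uniform//; last 2 first.
  - have : measurable_fun [set: measurableTypeR R] (fun l : measurableTypeR R => (x, l)).
      exact: pair1_measurable.
    move/(measurableT_comp (measurable_gibbs_move p.1 p.2)).
    by move/(measurableT_comp mf).
  - by move=> l; exact: f0.
  by rewrite subr0 invr1 mul1e.
under eq_bigr do rewrite ie.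
rewrite -big_enum -ge0_integral_sum//; last 2 first.
- by move=> p; apply: measurable_rint => //; exact: measurable_edge_map.
- by move=> p x _; exact: rint_ge0.
rewrite -ge0_integralZl//.
- by apply: eq_integral => x _; rewrite big_enum.
- by apply: emeasurable_sum => p; apply: measurable_rint => //; exact: measurable_edge_map.
- by move=> x _; apply: sume_ge0 => p _; exact: rint_ge0.
Qed.

Lemma gibbs_law_setT (m : {measure set vec -> \bar R}) t :
  m setT = 1%E -> gibbs_law S m t setT = 1%E.
Proof.
move=> m1; elim: t => [//|t ih].
have := @integral_gibbs_step (gibbs_law S m t) (cst 1%E) ih.
rewrite integral_cst// mul1e /= => -> //.
have -> : gibbs_op (cst 1%E) = cst 1%E.
  by apply/funext => x; rewrite /gibbs_op rop_cst//; exact: card_edges_gt0.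
by rewrite integral_cst// mul1e.
Qed.

Lemma integral_gibbs_law (m : {measure set vec -> \bar R}) t (f : vec -> \bar R) :
  m setT = 1%E -> measurable_fun [set: _] f -> (forall x, 0 <= f x)%E ->
  (\int[gibbs_law S m t]_x f x = \int[m]_x iter t gibbs_op f x)%E.
Proof.
move=> m1; elim: t f => [//|t ih] f mf f0.
rewrite [LHS]integral_gibbs_step//; last exact: gibbs_law_setT.
rewrite ih.
- by apply: eq_integral => x _; rewrite -iterSr.
- apply: measurable_rop => // p; exact: measurable_edge_map.
- exact: rop_ge0.
Qed.

End gibbs_operator.

(** * Coalescence along a fixed sequence of edges *)

Section interval_coupling.
Variable R : realType.
Local Notation mu := (@lebesgue_measure R).

Lemma integral01_le1 (f : R -> \bar R) : measurable_fun [set: R] f ->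
  (forall l, 0 <= f l)%E -> (forall l, f l <= 1)%E ->
  (\int[mu]_(l in `[0%R, 1%R]) f l <= 1)%E.
Proof.
move=> mf f0 f1; apply: (@le_trans _ _ (\int[mu]_(l in `[0%R, 1%R]) cst 1 l)%E).
  by apply: ge0_le_integral => //; exact: measurable_funTS.
by rewrite integral_cst//= mul1e lebesgue_measure_itv/= lte_fin ltr01 -EFinB subr0.
Qed.

Lemma integral01_split (p q : R) (f : R -> \bar R) : measurable_fun [set: R] f ->
  (forall l, 0 <= f l)%E -> (forall l, f l <= 1)%E ->
  0 <= p -> p <= q -> q <= 1 ->
  (\int[mu]_(l in `[0%R, 1%R]) f l <=
   \int[mu]_(l in `[p, q]) f l + (1 - (q - p))%:E)%E.
Proof.
move=> mf f0 f1 p0 pq q1.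
have sub : `[p, q] `<=` `[0%R, 1%R].
  by move=> l /=; rewrite !in_itv/= => /andP[pl lq]; rewrite (le_trans p0)// (le_trans lq).
rewrite -(setDUK sub) ge0_integral_setU//; last 3 first.
- exact: measurableD.
- by apply: measurable_funTS.
- by apply/disj_setPS => l [h [_ /(_ h)]].
apply: leeD => //.
apply: (@le_trans _ _ (\int[mu]_(l in `[0%R, 1%R] `\` `[p, q]) cst 1 l)%E).
  apply: ge0_le_integral => //; first exact: measurableD.
  exact: measurable_funTS.
rewrite integral_cst//=; last exact: measurableD.
rewrite mul1e measureD//=; last by rewrite lebesgue_measure_itv/= lte_fin ltr01 -EFinB ltry.
rewrite setIidr// !lebesgue_measure_itv/= !lte_fin ltr01 -EFinB subr0.
case: ltP => [_|qp]; first by rewrite -!EFinB.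
by rewrite sube0 lee_fin lerBrDl gerDr subr_le0.
Qed.

(** [a + l' w] and [a' + l w'] are uniform on two intervals whose endpoints differ by at most [M].
    On the overlap [[m1, m2]] they are made equal by the substitution [l' = al + be * l]; what is
    lost is the part of the longer interval outside the overlap, of length at most [2 M] out of at
    least [eta]. *)
Lemma interval_coupling (a w a' w' M eta : R) (f g : R -> \bar R) :
  measurable_fun [set: R] f -> (forall l, 0 <= f l)%E -> (forall l, f l <= 1)%E ->
  measurable_fun [set: R] g -> (forall l, 0 <= g l)%E ->
  0 < eta -> eta <= w' ->
  `|a - a'| <= M -> `|(a + w) - (a' + w')| <= M ->
  (forall l l', 0 <= l <= 1 -> 0 <= l' <= 1 -> a + l' * w = a' + l * w' ->
    (f l' <= g l)%E) ->
  (\int[mu]_(l in `[0%R, 1%R]) f l <=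
   \int[mu]_(l in `[0%R, 1%R]) g l + (2 * M / eta)%:E)%E.
Proof.
move=> mf f0 f1 mg g0 eta0 etaw' aM bM fg.
have M0 : 0 <= M := le_trans (normr_ge0 _) aM.
(* If [w'] is at most [2 M], the error term is at least 1. Otherwise the two intervals overlap. *)
have [w'M|Mw'] := leP w' (2 * M).
  apply: (@le_trans _ _ 1%E); first exact: integral01_le1.
  rewrite -[leLHS]add0e; apply: leeD; first exact: integral_ge0.
  by rewrite lee_fin ler_pdivlMr// mul1r (le_trans etaw').
have w'0 : 0 < w' := lt_le_trans eta0 etaw'.
move: aM bM; rewrite !ler_norml => /andP[aM1 aM2] /andP[bM1 bM2].
have w0 : 0 < w by lra.
pose m1 := Num.max a a'; pose m2 := Num.min (a + w) (a' + w').
have [am1 a'm1] : a <= m1 /\ a' <= m1 by rewrite !le_max !lexx orbT.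
have [m2b m2b'] : m2 <= a + w /\ m2 <= a' + w' by rewrite !ge_min !lexx orbT.
have m1M : m1 - a <= M /\ m1 - a' <= M.
  by rewrite /m1; case: (leP a a') => _; split; lra.
have m2M : a + w - m2 <= M /\ a' + w' - m2 <= M.
  by rewrite /m2; case: (leP (a + w) (a' + w')) => _; split; lra.
have m12 : m1 <= m2 by lra.
pose p' := (m1 - a) / w; pose q' := (m2 - a) / w.
pose p := (m1 - a') / w'; pose q := (m2 - a') / w'.
pose al := (a' - a) / w; pose be := w' / w.
have be0 : 0 < be by rewrite divr_gt0.
have p'E : p' = al + be * p.
  by rewrite /p' /al /be /p; field; rewrite !gt_eqF.
have q'E : q' = al + be * q.
  by rewrite /q' /al /be /q; field; rewrite !gt_eqF.
have p0 : 0 <= p by rewrite divr_ge0// ?subr_ge0// ltW.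
have p'0 : 0 <= p' by rewrite divr_ge0// ?subr_ge0// ltW.
have q1 : q <= 1 by rewrite ler_pdivrMr// mul1r; lra.
have q'1 : q' <= 1 by rewrite ler_pdivrMr// mul1r; lra.
have pq : p <= q by rewrite ler_pM2r ?invr_gt0//; lra.
have pq' : p' <= q' by rewrite ler_pM2r ?invr_gt0//; lra.
apply: (le_trans (integral01_split mf f0 f1 p'0 pq' q'1)).
rewrite {1}p'E {1}q'E (integral_itv_affine _ _ _ be0 mf f0).
set E := (\int[mu]_(l in `[p, q]) f (al + be * l)%R)%E.
have mfa : measurable_fun [set: R] (fun l => f (al + be * l)).
  exact: (measurableT_comp mf (measurable_affine al be)).
have E0 : (0 <= E)%E by apply: integral_ge0.
have sub : `[p, q] `<=` `[0%R, 1%R].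
  by move=> l /=; rewrite !in_itv/= => /andP[pl lq]; rewrite (le_trans p0)// (le_trans lq).
have Eg : (E <= \int[mu]_(l in `[0%R, 1%R]) g l)%E.
  apply: (@le_trans _ _ (\int[mu]_(l in `[p, q]) g l)%E); last first.
    by apply: ge0_subset_integral => //; exact: measurable_funTS.
  apply: ge0_le_integral => //.
  - exact: measurable_funTS.
  - exact: measurable_funTS.
  move=> l /= /[dup] lpq /sub /=; rewrite in_itv/= => l01.
  apply: fg => //; last first.
    by rewrite /al /be; field; rewrite gt_eqF.
  move: lpq; rewrite in_itv/= => /andP[pl lq].
  apply/andP; split.
    by apply: (le_trans p'0); rewrite p'E lerD2l ler_pM2l.
  by apply: le_trans q'1; rewrite q'E lerD2l ler_pM2l.
have Eq : (E <= (q - p)%:E)%E.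
  apply: (@le_trans _ _ (\int[mu]_(l in `[p, q]) cst 1 l)%E).
    by apply: ge0_le_integral => //; exact: measurable_funTS.
  rewrite integral_cst//= mul1e lebesgue_measure_itv/= lte_fin.
  by case: ltP => _; rewrite -?EFinB// lee_fin subr_ge0.
have bound (c : R) : 0 < c -> eta <= c -> 2 * M / c <= 2 * M / eta.
  move=> c0 ec; rewrite ler_wpM2l ?mulr_ge0// lef_pV2 ?posrE//.
have q'p' : q' - p' = be * (q - p) by rewrite q'E p'E; ring.
(* If [w' <= w], the Jacobian [be] is at most 1 and is dropped. Otherwise the excess [be - 1] is
   charged to the bound of [f] by 1, and the total loss is [1 - (q - p)]. *)
have [be1|be1] := leP be 1.
  apply: leeD.
    apply: le_trans Eg; rewrite -[leRHS]mul1e; exact: lee_wpmul2r.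
  rewrite lee_fin; have w'w : w' <= w.
    by move: be1; rewrite ler_pdivrMr// mul1r.
  apply: le_trans (bound _ w0 (le_trans etaw' w'w)).
  have -> : 1 - (q' - p') = (w - (m2 - m1)) / w.
    by rewrite /q' /p'; field; rewrite gt_eqF.
  by rewrite ler_pM2r ?invr_gt0//; lra.
have -> : be = 1 + (be - 1) by ring.
rewrite EFinD ge0_muleDl ?lee_fin ?subr_ge0 ?(ltW be1)// mul1e -addeA.
apply: leeD => //.
apply: (@le_trans _ _ ((be - 1)%:E * (q - p)%:E + (1 - (q' - p'))%:E)%E).
  by apply: leeD => //; apply: lee_wpmul2l; rewrite // lee_fin subr_ge0 ltW.
rewrite -EFinM -EFinD lee_fin q'p'.
apply: le_trans (bound _ w'0 etaw').
have -> : (be - 1) * (q - p) + (1 - be * (q - p)) = (w' - (m2 - m1)) / w'.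
  by rewrite /q /p; field; rewrite gt_eqF.
by rewrite ler_pM2r ?invr_gt0//; lra.
Qed.

End interval_coupling.

(** * Gaps inside the blocks under synchronized moves *)

Section block_sums.
Variables (R : realType) (n : nat).
Implicit Types (x y : n.-tuple R) (i j k : 'I_n) (q : 'I_n -> 'I_n) (M : R).

Lemma sum_split2 (P : pred 'I_n) (h : 'I_n -> R) i j : i != j ->
  \sum_(k | P k) h k =
  \sum_(k | [&& P k, k != i & k != j]) h k + (if P i then h i else 0) + (if P j then h j else 0).
Proof.
move=> ij; rewrite big_mkcond (bigD1 i)//= (bigD1 j) 1?eq_sym//=.
rewrite [in RHS](eq_bigl (fun k => ((k != i) && (k != j)) && P k)); last first.
  by move=> k; rewrite andbC.
by rewrite [in RHS]big_mkcondr /=; ring.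
Qed.

Definition gap x y k : R := tnth x k - tnth y k.

(* The block of [k] is [q^-1 (q k)]; [M] bounds all partial sums of the gap
   inside a block, and this bound does not deteriorate along the coupling. *)
Definition balanced q M x y :=
  (forall c, \sum_(k | q k == c) gap x y k = 0) /\
  (forall c (A : pred 'I_n), \sum_(k | A k && (q k == c)) gap x y k <= M).

Definition merge i j q : 'I_n -> 'I_n := fun k => if q k == q j then q i else q k.

Lemma sum_gap_move (P : pred 'I_n) i j x y l l' : i != j ->
  \sum_(k | P k) gap (move i j x l') (move i j y l) k =
  \sum_(k | [&& P k, k != i & k != j]) gap x y k +
  (if P i then l' * (tnth x i + tnth x j) - l * (tnth y i + tnth y j) else 0) +
  (if P j then (1 - l') * (tnth x i + tnth x j) - (1 - l) * (tnth y i + tnth y j) else 0).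
Proof.
move=> ij; rewrite (sum_split2 _ _ ij); congr (_ + _ + _).
- by apply: eq_bigr => k /and3P[_ ki kj]; rewrite /gap !tnth_move (negbTE ki) (negbTE kj).
- by rewrite /gap !tnth_move eqxx.
- by rewrite /gap !tnth_move eqxx [j == i]eq_sym (negbTE ij).
Qed.

(** Both chains use the same multiplier. With [s] the total gap of [i] and [j], a partial sum
    becomes [r], [r + l s], [r + (1 - l) s] or [r + s], all between [r] and [r + s], which are
    partial sums before the move. *)
Lemma balanced_move_in q M i j x y l : i != j -> q i = q j -> 0 <= l <= 1 ->
  balanced q M x y -> balanced q M (move i j x l) (move i j y l).
Proof.
move=> ij qij /andP[l0 l1] [xy0 xyM]; split => [c|c A].
  rewrite (sum_gap_move _ _ _ _ _ ij); have := xy0 c.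
  rewrite (sum_split2 _ _ ij) qij.
  by case: (q j == c); rewrite /gap /=; lra.
rewrite (sum_gap_move _ _ _ _ _ ij).
set r := \sum_(k | _) _.
have rM : r <= M.
  apply: le_trans (xyM c (fun k => [&& A k, k != i & k != j])).
  by rewrite le_eqVlt; apply/orP; left; apply/eqP; apply: eq_bigl => k /=; rewrite andbAC.
have [qc|qc] := eqVneq (q i) c; last first.
  by rewrite -qij (negbTE qc) !andbF !addr0.
have rM' : r + gap x y i + gap x y j <= M.
  have := xyM c (fun k => [|| A k, k == i | k == j]).
  rewrite (sum_split2 _ _ ij) /= !eqxx !orbT /= -qij qc eqxx.
  congr (_ + _ + _ <= _); apply: eq_bigl => k.
  by case: (k == i); case: (k == j); rewrite ?andbF ?orbF ?andbT.
rewrite -qij qc eqxx !andbT /gap in rM' *.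
by case: (A i); case: (A j); nra.
Qed.

(** The last hypothesis equates the masses of the block of [i]; the merged block had equal masses,
    so the block of [j] follows. A part of a new block that contains the endpoint of the edge is the
    complement of a part avoiding it, in a block of total gap 0; its gap is thus minus that of a set
    that the move leaves alone. *)
Lemma balanced_move_split q M i j x y l l' : i != j -> q i != q j ->
  balanced (merge i j q) M x y ->
  \sum_(k | (q k == q i) && (k != i)) tnth x k + l' * (tnth x i + tnth x j) =
  \sum_(k | (q k == q i) && (k != i)) tnth y k + l * (tnth y i + tnth y j) ->
  balanced q M (move i j x l') (move i j y l).
Proof.
move=> ij qij [xy0 xyM] sync.
have mergeE c k : q k == c -> c != q i -> c != q j -> merge i j q k == c.
  by rewrite /merge => /eqP -> ? /negbTE ->.
pose P c k := [&& q k == c, k != i & k != j].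
have Ri : \sum_(k | P (q i) k) gap x y k +
    (l' * (tnth x i + tnth x j) - l * (tnth y i + tnth y j)) = 0.
  have -> : \sum_(k | P (q i) k) gap x y k =
      \sum_(k | (q k == q i) && (k != i)) tnth x k - \sum_(k | (q k == q i) && (k != i)) tnth y k.
    rewrite -sumrB; apply: eq_big => [k|//]; rewrite /P.
    case: (eqVneq k j) => [->|_]; last by rewrite andbT.
    by rewrite [q j == _]eq_sym (negbTE qij).
  by lra.
have allE : \sum_(k | P (q i) k) gap x y k + \sum_(k | P (q j) k) gap x y k +
    gap x y i + gap x y j = 0.
  have := xy0 (q i); rewrite (sum_split2 _ _ ij) /merge.
  rewrite (negbTE qij) !eqxx => h; rewrite -[RHS]h; congr (_ + _ + _).
  rewrite [RHS](bigID (fun k => q k == q i)) /=; congr (_ + _); apply: eq_bigl => k; rewrite /P.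
    have [e|] := eqVneq (q k) (q i); last by rewrite andbF.
    by rewrite e (negbTE qij) eqxx !andbT.
  have [e|] := eqVneq (q k) (q j).
    by rewrite eqxx e [q j == _]eq_sym (negbTE qij) /= andbT.
  by move=> _; case: (q k == q i); rewrite ?andbF.
have Rj : \sum_(k | P (q j) k) gap x y k +
    ((1 - l') * (tnth x i + tnth x j) - (1 - l) * (tnth y i + tnth y j)) = 0.
  by move: allE Ri; rewrite /gap; lra.
have other c : c != q i -> c != q j -> forall A : pred 'I_n,
    \sum_(k | A k && (q k == c)) gap (move i j x l') (move i j y l) k =
    \sum_(k | A k && (merge i j q k == c)) gap x y k.
  move=> ci cj A; rewrite (sum_gap_move _ _ _ _ _ ij).
  rewrite [q i == c]eq_sym [q j == c]eq_sym (negbTE ci) (negbTE cj) !andbF !addr0.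
  apply: eq_bigl => k; rewrite /merge.
  have [e|e] := eqVneq (q k) (q j).
    by rewrite e [q j == c]eq_sym [q i == c]eq_sym (negbTE cj) (negbTE ci) andbF.
  have [->|] := eqVneq k i; first by rewrite [q i == c]eq_sym (negbTE ci) andbF.
  have [->|_ _] := eqVneq k j; first by rewrite [q j == c]eq_sym (negbTE cj) andbF.
  by rewrite !andbT.
have part_le c (A : pred 'I_n) : c = q i \/ c = q j ->
    \sum_(k | A k && P c k) gap x y k <= M.
  move=> cc; have := xyM (q i) (fun k => A k && P c k).
  congr (_ <= _); apply: eq_bigl => k; rewrite -andbA; congr (_ && _).
  rewrite /P; have [e|] := eqVneq (q k) c; last by [].
  rewrite /merge e; case: cc => ->; first by rewrite (negbTE qij) eqxx andbT.
  by rewrite !eqxx andbT.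
have compl c (A : pred 'I_n) : \sum_(k | P c k) gap x y k =
    \sum_(k | A k && P c k) gap x y k + \sum_(k | ~~ A k && P c k) gap x y k.
  by rewrite (bigID A) /=; congr (_ + _); apply: eq_bigl => k; rewrite andbC.
(* The merged block has total gap 0, so minus the gap of a part is the gap of its complement there,
   again a partial sum bounded by [M]. *)
have negpart_le c (A : pred 'I_n) : c = q i \/ c = q j ->
    - (\sum_(k | P c k) gap x y k - \sum_(k | A k && P c k) gap x y k) <= M.
  move=> cc; rewrite (compl c A) addrC addKr.
  pose B : pred 'I_n := fun k => ~~ (~~ A k && P c k).
  have := xy0 (q i); rewrite (bigID (fun k => ~~ A k && P c k)) /=.
  have -> : \sum_(k | (merge i j q k == q i) && (~~ A k && P c k)) gap x y k =
      \sum_(k | ~~ A k && P c k) gap x y k.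
    apply: eq_bigl => k; rewrite /P /merge.
    have [e|] := eqVneq (q k) c; last by rewrite !andbF.
    rewrite e; case: cc => ->; first by rewrite (negbTE qij) eqxx.
    by rewrite eqxx eqxx.
  have := xyM (q i) B; rewrite /B.
  have -> : \sum_(k | ~~ (~~ A k && P c k) && (merge i j q k == q i)) gap x y k =
     \sum_(k | (merge i j q k == q i) && ~~ (~~ A k && P c k)) gap x y k.
    by apply: eq_bigl => k; rewrite andbC.
  by lra.
have reorder (A : pred 'I_n) c :
    \sum_(k | [&& A k && (q k == c), k != i & k != j]) gap x y k =
    \sum_(k | A k && P c k) gap x y k.
  by apply: eq_bigl => k; rewrite /P -andbA.
split => [c|c A].
  have [->|ci] := eqVneq c (q i).
    rewrite (sum_gap_move _ _ _ _ _ ij) eqxx [q j == _]eq_sym (negbTE qij) addr0.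
    exact: Ri.
  have [->|cj] := eqVneq c (q j).
    by rewrite (sum_gap_move _ _ _ _ _ ij) eqxx (negbTE qij) addr0; exact: Rj.
  by have := other c ci cj predT; rewrite /= => ->; exact: xy0.
have [->|ci] := eqVneq c (q i).
  rewrite (sum_gap_move _ _ _ _ _ ij) eqxx [q j == _]eq_sym (negbTE qij) andbF addr0 andbT.
  rewrite reorder; case: (A i); last by rewrite addr0; apply: part_le; left.
  have := @negpart_le (q i) A (or_introl erefl).
  by move: Ri; lra.
have [->|cj] := eqVneq c (q j).
  rewrite (sum_gap_move _ _ _ _ _ ij) eqxx (negbTE qij) andbF addr0 andbT.
  rewrite reorder; case: (A j); last by rewrite addr0; apply: part_le; right.
  have := @negpart_le (q j) A (or_intror erefl).
  by move: Rj; lra.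
by rewrite other.
Qed.

End block_sums.

Section coalescence.
Variables (R : realType) (n : nat) (eta : R).
Local Notation mu := (@lebesgue_measure R).
Implicit Types (e : seq ('I_n * 'I_n)) (f : n.-tuple R -> \bar R) (x y : n.-tuple R).

(* The head of [e] is the first move; [partition_of] merges from the last move
   backwards, so that [partition_of e] is the partition into connected components
   of the edges of [e]; the moves of [e] preserve the mass of each block. *)
Definition moves_int e f := foldr (fun p h => move_int p.1 p.2 h) f e.

Definition partition_of e : 'I_n -> 'I_n := foldr (fun p q => merge p.1 p.2 q) id e.

Fixpoint splits e : nat :=
  if e is p :: e' then (partition_of e' p.1 != partition_of e' p.2) + splits e' else 0%N.

(* Expected number of moves which split a block of the remaining partition while
   the second chain has a coordinate below [eta] at the edge: there the affine
   coupling of the two multipliers may fail. *)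
Fixpoint bad e : n.-tuple R -> \bar R :=
  if e is p :: e' then
    fun y => (move_int p.1 p.2 (bad e') y +
      (if partition_of e' p.1 != partition_of e' p.2 then tail p.1 eta y else 0))%E
  else cst 0%E.

Lemma bad_ge0 e y : (0 <= bad e y)%E.
Proof.
elim: e y => [//|p e ih] y /=; rewrite adde_ge0//; first exact: move_int_ge0.
by case: ifP => // _; exact: tail_ge0.
Qed.

Lemma measurable_bad e : measurable_fun [set: n.-tuple R] (bad e).
Proof.
elim: e => [|p e ih] /=; first exact: measurable_cst.
apply: emeasurable_funD; first by apply: measurable_move_int => // y; exact: bad_ge0.
by case: (_ != _); [exact: measurable_tail|exact: measurable_cst].
Qed.

Section moves_int_theory.
Variable f : n.-tuple R -> \bar R.
Hypotheses (mf : measurable_fun [set: n.-tuple R] f) (f0 : forall x, (0 <= f x)%E).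

Lemma moves_int_ge0 e x : (0 <= moves_int e f x)%E.
Proof. by elim: e x => [//|p e ih] x /=; exact: move_int_ge0. Qed.

Lemma measurable_moves_int e : measurable_fun [set: n.-tuple R] (moves_int e f).
Proof.
elim: e => [//|p e ih] /=; apply: measurable_move_int => // x.
exact: moves_int_ge0.
Qed.

Hypothesis f1 : forall x, (f x <= 1)%E.

Lemma moves_int_le1 e x : (moves_int e f x <= 1)%E.
Proof.
elim: e x => [//|p e ih] x /=; apply: integral01_le1 => [|l|l //].
  by have := measurableT_comp (measurable_moves_int e) (measurable_move1 p.1 p.2 x).
exact: moves_int_ge0.
Qed.

(** Without moves the partition is discrete and [x = y]. A move inside a block uses the same
    multiplier for both chains. A separating move uses [interval_coupling] if the second chain has
    mass at least [eta] at [i]; otherwise the bound by 1 is paid by [bad]. *)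
Lemma coalesce e M x y : 0 < eta -> all (fun p => p.1 != p.2) e ->
  (forall i, 0 <= tnth y i) -> balanced (partition_of e) M x y ->
  (moves_int e f x <=
   moves_int e f y + bad e y + ((splits e)%:R * (2 * M / eta))%:E)%E.
Proof.
move=> eta0; elim: e x y => [x y _ _ [xy0 _]|p e ih x y].
  have -> : x = y.
    apply: eq_from_tnth => i; have := xy0 i.
    rewrite (big_pred1 i) => [/eqP|k]; last by [].
    by rewrite /gap subr_eq0 => /eqP.
  by rewrite /= mul0r !adde0.
rewrite [all _ _]/=; case: p => i j /andP[/= ij alle] y0 bal.
have M0 : 0 <= M.
  have [_ /(_ i pred0)] := bal; by rewrite big_pred0.
have c0 : 0 <= 2 * M / eta by rewrite divr_ge0 ?mulr_ge0// ltW.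
have K0 (z : n.-tuple R) l := moves_int_ge0 e (move i j z l).
have B0 (z : n.-tuple R) l := bad_ge0 e (move i j z l).
have mK z : measurable_fun [set: R] (fun l => moves_int e f (move i j z l)).
  by have := measurableT_comp (measurable_moves_int e) (measurable_move1 i j z).
have mB z : measurable_fun [set: R] (fun l => bad e (move i j z l)).
  by have := measurableT_comp (measurable_bad e) (measurable_move1 i j z).
have y0' l : 0 <= l <= 1 -> forall k, 0 <= tnth (move i j y l) k.
  move=> /andP[l0 l1] k; rewrite tnth_move; case: eqP => _.
    by rewrite mulr_ge0// addr_ge0.
  by case: eqP => _ //; rewrite mulr_ge0 ?subr_ge0// addr_ge0.
pose c := (splits e)%:R * (2 * M / eta).
have c0' : (0 <= c%:E)%E by rewrite lee_fin mulr_ge0.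
pose G l := (moves_int e f (move i j y l) + bad e (move i j y l) + c%:E)%E.
have mG : measurable_fun [set: R] G.
  by apply: emeasurable_funD => //; exact: emeasurable_funD.
have G0 l : (0 <= G l)%E by rewrite !adde_ge0.
have intG : (\int[mu]_(l in `[0%R, 1%R]) G l =
    move_int i j (moves_int e f) y + move_int i j (bad e) y + c%:E)%E.
  rewrite ge0_integralD//; last 2 first.
  - by move=> l _; rewrite adde_ge0.
  - apply: measurable_funTS; exact: (emeasurable_funD (mK y) (mB y)).
  rewrite ge0_integralD//; last 2 first.
  - by apply: measurable_funTS; exact: mK.
  - by apply: measurable_funTS; exact: mB.
  congr (_ + _)%E; rewrite integral_cst//= lebesgue_measure_itv/= lte_fin ltr01.
  by rewrite -EFinB subr0 mule1.
have [qij|qij] := eqVneq (partition_of e i) (partition_of e j).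
  rewrite /= add0n adde0 -intG; apply: ge0_le_integral => //.
  - by apply: measurable_funTS; exact: mK.
  - by apply: measurable_funTS; exact: mG.
  move=> l /=; rewrite in_itv/= => l01; apply: ih => //; first exact: y0'.
  apply: balanced_move_in => //.
  suff -> : partition_of e = partition_of ((i, j) :: e) by [].
  by apply/funext => k /=; rewrite /merge -qij; case: eqP.
rewrite /= natrD mulrDl mul1r -/c.
have [ye|ey] := ltP (tnth y i) eta.
  apply: (@le_trans _ _ 1%E); first exact: (moves_int_le1 ((i, j) :: e)).
  rewrite /tail ye; apply: (@le_trans _ _ (0 + (0 + 1) + 0)%E).
    by rewrite adde0 !add0e.
  apply: leeD; last by rewrite lee_fin addr_ge0// mulr_ge0.
  apply: leeD; first exact: (moves_int_ge0 ((i, j) :: e)).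
  by apply: leeD => //; apply: move_int_ge0 => z; exact: bad_ge0.
rewrite /tail ltNge ey /= adde0.
have -> : (move_int i j (moves_int e f) y + move_int i j (bad e) y +
    (2 * M / eta + c)%:E = \int[mu]_(l in `[0%R, 1%R]) G l + (2 * M / eta)%:E)%E.
  by rewrite intG -!addeA -EFinD [c + _]addrC.
(* [a] is the mass of the block of [i] without [i]; the multiplier places the mass of the whole
   block in [[a, a + w]]. The differences of both endpoints are partial gaps of the merged block:
   the block of [i] without [i], and the block of [i] together with [j]. *)
pose a (z : n.-tuple R) :=
  \sum_(k | (partition_of e k == partition_of e i) && (k != i)) tnth z k.
pose w (z : n.-tuple R) := tnth z i + tnth z j.
have upper A : \sum_(k | A k && (partition_of ((i, j) :: e) k == partition_of e i)) gap x y k <= M.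
  by have [_ h] := bal; exact: h.
have lower A : - M <= \sum_(k | A k && (partition_of ((i, j) :: e) k == partition_of e i)) gap x y k.
  have [h _] := bal; have := h (partition_of e i); rewrite (bigID A) /=.
  have := upper (fun k => ~~ A k).
  under [X in _ -> X + _ = _ -> _]eq_bigl do rewrite andbC.
  under [X in _ -> _ + X = _ -> _]eq_bigl do rewrite andbC.
  by rewrite /=; lra.
apply: (interval_coupling (a := a x) (w := w x) (a' := a y) (w' := w y) (M := M)
  (mK x) (K0 x) (fun l => moves_int_le1 e _) mG G0 eta0).
- by rewrite /w (le_trans ey)// lerDl.
- have -> : a x - a y = \sum_(k | ((partition_of e k == partition_of e i) && (k != i)) &&
      (partition_of ((i, j) :: e) k == partition_of e i)) gap x y k.
    rewrite /a -sumrB; apply: eq_bigl => k /=; rewrite /merge.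
    have [e1|] := eqVneq (partition_of e k) (partition_of e i); last by [].
    by rewrite e1 (negbTE qij) eqxx andbT.
  by rewrite ler_norml lower upper.
- have -> : a x + w x - (a y + w y) = \sum_(k | ((partition_of e k == partition_of e i) || (k == j)) &&
      (partition_of ((i, j) :: e) k == partition_of e i)) gap x y k.
    rewrite (sum_split2 _ _ ij) /= /merge !eqxx (negbTE qij) ?eqxx ?orbT /=.
    set r := \sum_(k | _) gap x y k; suff -> : r = a x - a y by rewrite /w /gap; ring.
    rewrite /a -sumrB; apply: eq_bigl => k.
    have [->|kj] := eqVneq k j.
      by rewrite [partition_of e j == _]eq_sym (negbTE qij) !andbF.
    rewrite orbF andbT; have [e1|] := eqVneq (partition_of e k) (partition_of e i); last by [].
    by rewrite e1 (negbTE qij) eqxx.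
  by rewrite ler_norml lower upper.
move=> l l' l01 l01' sync; apply: ih => //; first exact: y0'.
exact: balanced_move_split.
Qed.

End moves_int_theory.

End coalescence.

Section block_count.
Variables (R : realType) (n : nat).
Implicit Types (q : 'I_n -> 'I_n) (e : seq ('I_n * 'I_n)).

Definition blocks q : nat := #|[set q k | k : 'I_n]|.

Lemma blocks_merge i j q : (blocks (merge i j q) + (q i != q j) = blocks q)%N.
Proof.
have [qij|qij] := eqVneq (q i) (q j).
  rewrite addn0 /blocks (eq_imset (g := q))// => k.
  by rewrite /merge -qij; case: eqP.
rewrite /blocks [RHS](cardsD1 (q j)) imset_f// addnC; congr (_ + _)%N; apply: eq_card => c.
rewrite !inE; apply/imsetP/andP => [[k _ ->]|[cj /imsetP[k _ cE]]].
  rewrite /merge; have [_|kj] := eqVneq (q k) (q j).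
    by split => //; exact: imset_f.
  by split => //; exact: imset_f.
by exists k => //; rewrite /merge -cE (negbTE cj).
Qed.

(** The discrete partition has [n] blocks, and each separating move, read backwards, removes one. *)
Lemma splits_blocks e : (splits e + blocks (partition_of e) = n)%N.
Proof.
elim: e => [|p e ih] /=.
  by rewrite add0n /blocks card_imset ?card_ord//; exact: inj_id.
by rewrite -[RHS]ih -(blocks_merge p.1 p.2 (partition_of e)) -addnA addnC -addnA.
Qed.

Lemma blocks_gt0 q : (0 < n)%N -> (0 < blocks q)%N.
Proof.
move=> n0; rewrite /blocks; apply/card_gt0P; exists (q (Ordinal n0)).
exact: imset_f.
Qed.

(** With two blocks or more the last term is at least 1. With a single block, being balanced only
    asks for equal total masses, which holds on the simplex; so any two states may start the
    coupling, with [M] their l1 distance. *)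
Lemma coalesce_simplex e eta (f : n.-tuple R -> \bar R) (x y : n.-tuple R) :
  (0 < n)%N -> 0 < eta -> all (fun p => p.1 != p.2) e ->
  measurable_fun [set: _] f -> (forall x, 0 <= f x)%E -> (forall x, f x <= 1)%E ->
  simplex R n x -> simplex R n y ->
  (moves_int e f x <= moves_int e f y + bad eta e y +
    (n%:R * (2 * (\sum_k `|tnth x k - tnth y k|) / eta) +
     (blocks (partition_of e) - 1)%:R)%:E)%E.
Proof.
move=> n0 eta0 ee mf f0 f1 [x0 x1] [y0 y1].
set M := \sum_k _.
have M0 : 0 <= M by apply: sumr_ge0.
have c0 : 0 <= 2 * M / eta by rewrite divr_ge0 ?mulr_ge0// ltW.
have [b1|b1] := leqP (blocks (partition_of e)) 1; last first.
  apply: (@le_trans _ _ 1%E); first exact: moves_int_le1.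
  rewrite -[leLHS]add0e; apply: leeD.
    by rewrite adde_ge0// ?bad_ge0 ?moves_int_ge0.
  rewrite lee_fin -[leLHS]add0r; apply: lerD; first exact: mulr_ge0.
  by rewrite ler1n subn_gt0.
have bal : balanced (partition_of e) M x y.
  have cst : forall k, partition_of e k = partition_of e (Ordinal n0).
    move=> k; move: b1; rewrite /blocks => /card_le1_eqP; apply; exact: imset_f.
  split => [c|c A].
    rewrite (eq_bigl (fun=> partition_of e (Ordinal n0) == c)) => [|k]; last by rewrite cst.
    case: (_ == c); last by rewrite big_pred0.
    by rewrite /gap sumrB x1 y1 subrr.
  rewrite big_mkcond /M; apply: ler_sum => k _; case: ifP => _ //.
  exact: ler_norm.
apply: (le_trans (coalesce mf f0 f1 eta0 ee y0 bal)).
apply: leeD => //; rewrite lee_fin -[leLHS]addr0 lerD//.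
rewrite ler_wpM2r// ler_nat -[leqRHS](splits_blocks e).
exact: leq_addr.
Qed.

(** The second chain starts from [U] and keeps this law, so each separating move costs at most the
    tail bound [n eta]. *)
Lemma integral_bad e eta : (1 < n)%N -> 0 <= eta -> all (fun p => p.1 != p.2) e ->
  (\int[uniform_simplex R n]_x bad eta e x <= ((splits e)%:R * (n%:R * eta))%:E)%E.
Proof.
move=> n1 eta0; elim: e => [_|p e ih /= /andP[pp /ih {}ih]].
  by rewrite /= integral0 mul0r.
rewrite ge0_integralD//; last 4 first.
- by move=> x _; apply: move_int_ge0 => y; exact: bad_ge0.
- by apply: measurable_move_int; [exact: measurable_bad|move=> y; exact: bad_ge0].
- by move=> x _; case: ifP => // _; exact: tail_ge0.
- by case: (_ != _); [exact: measurable_tail|exact: measurable_cst].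
rewrite uniform_move//; [|exact: measurable_bad|move=> y; exact: bad_ge0].
rewrite natrD mulrDl addrC EFinD; apply: leeD => //.
case: (_ != _); last by rewrite integral0 mul0r.
by rewrite mul1r; exact: uniform_tail.
Qed.

End block_count.

Section expected_blocks.
Variables (R : realType) (gT : finGroupType) (S : {set gT}).
Hypothesis S_gen : <<S>>%g = [set: gT]%SET.
Hypothesis S_id : 1%g \notin S.
Hypothesis gT1 : (1 < #|gT|)%N.
Local Notation N := #|gT|.
Local Notation w := (#|edges S|%:R^-1 : R).
Local Notation gamma := (spectral_gap R S).

Definition idx (p : gT * gT) : 'I_N * 'I_N := (enum_rank p.1, enum_rank (p.1 * p.2)%g).

Lemma edge_energy_var (d : gT -> R) :
  gamma * (\sum_x d x ^+ 2 - (\sum_x d x) ^+ 2 / N%:R) <= edge_energy S d.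
Proof.
have n0 : (N%:R : R) != 0 by rewrite pnatr_eq0 -lt0n ltnW.
pose m := (\sum_x d x) / N%:R.
have sumc (c : R) : \sum_(x : gT) c = N%:R * c by rewrite sumr_const mulr_natl.
have d0 : \sum_x (d x - m) = 0.
  by rewrite sumrB sumc /m; field.
have -> : edge_energy S d = edge_energy S (fun x => d x - m).
  by congr (_ * _); apply: eq_bigr => g _; apply: eq_bigr => r _; congr (_ ^+ 2); ring.
apply: le_trans (edge_energy_ge S_gen S_id gT1 d0).
rewrite ler_pM2l ?spectral_gap_gt0// le_eqVlt; apply/orP; left; apply/eqP.
have -> : \sum_x (d x - m) ^+ 2 = \sum_x (d x ^+ 2 + (-2 * m) * d x + m ^+ 2).
  by apply: eq_bigr => x _; ring.
by rewrite !big_split /= -mulr_sumr sumc /m; field.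
Qed.

(* Spectral gap inequality for the indicators of the blocks. *)
Lemma crossing_prob (q : 'I_N -> 'I_N) :
  gamma / 2 * ((blocks q)%:R - 1) <=
  w * \sum_(p in edges S) (q (idx p).1 != q (idx p).2)%:R.
Proof.
pose Q (x : gT) := q (enum_rank x).
pose im := [set q k | k : 'I_N].
pose s c : R := \sum_x (Q x == c)%:R.
have gap0 := ltW (spectral_gap_gt0 R S_gen S_id gT1).
have n0 : 0 < (N%:R : R) by rewrite ltr0n ltnW.
have h c : gamma * (s c - s c ^+ 2 / N%:R) <= edge_energy S (fun x => (Q x == c)%:R).
  apply: le_trans (edge_energy_var _).
  rewrite le_eqVlt; apply/orP; left; apply/eqP; congr (_ * (_ - _)).
  by apply: eq_bigr => x _; case: (_ == c); rewrite ?expr1n ?expr0n.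
have sum_ind (x : gT) : \sum_(c in im) (Q x == c)%:R = 1 :> R.
  rewrite (bigD1 (Q x))/=; last exact: imset_f.
  by rewrite eqxx big1 ?addr0// => c /andP[_ /negbTE]; rewrite eq_sym => ->.
have sum_s : \sum_(c in im) s c = N%:R.
  rewrite exchange_big /=; under eq_bigr do rewrite sum_ind.
  by rewrite sumr_const.
have s_ge1 c : c \in im -> 1 <= s c.
  move=> /imsetP[k _ ->]; rewrite /s (bigD1 (enum_val k))//= /Q enum_valK eqxx lerDl.
  by apply: sumr_ge0.
(* The other blocks have at least one element each; so [s (n - s) / n] is at least
   [s (blocks q - 1) / n], and these sum to [blocks q - 1]. *)
have s_le c : c \in im -> s c <= N%:R - ((blocks q)%:R - 1).
  move=> cim; rewrite -sum_s (bigD1 c)//= -addrA lerDl subr_ge0.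
  apply: (@le_trans _ _ (\sum_(c' in im | c' != c) 1)); last first.
    by apply: ler_sum => c' /andP[c'im _]; exact: s_ge1.
  rewrite (_ : (blocks q)%:R = \sum_(c in im) 1 :> R); last by rewrite sumr_const.
  by rewrite [X in X - _](bigD1 c)//= addrAC subrr add0r.
have key : gamma * ((blocks q)%:R - 1) <= \sum_(c in im) edge_energy S (fun x => (Q x == c)%:R).
  apply: (@le_trans _ _ (\sum_(c in im) gamma * (s c - s c ^+ 2 / N%:R))); last first.
    by apply: ler_sum => c _; exact: h.
  rewrite -mulr_sumr ler_wpM2l//.
  apply: (@le_trans _ _ (\sum_(c in im) s c * (((blocks q)%:R - 1) / N%:R))).
    by rewrite -mulr_suml sum_s mulrC divfK// gt_eqF.
  apply: ler_sum => c cim.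
  have -> : s c - s c ^+ 2 / N%:R = s c * ((N%:R - s c) / N%:R).
    by field; rewrite gt_eqF.
  rewrite ler_wpM2l//; first by apply: (le_trans _ (s_ge1 _ cim)).
  by rewrite ler_pM2r ?invr_gt0//; have := s_le c cim; lra.
(* An edge joining two blocks appears in the energies of exactly these two indicators, whence
   [gamma / 2] instead of [gamma]. *)
have two : \sum_(c in im) edge_energy S (fun x => (Q x == c)%:R) =
    2 * (w * \sum_(p in edges S) (q (idx p).1 != q (idx p).2)%:R).
  rewrite /edge_energy -mulr_sumr card_edges mulrCA; congr (_ * _).
  rewrite exchange_big sum_edges mulr_sumr; apply: eq_bigr => g _ /=.
  rewrite exchange_big mulr_sumr; apply: eq_bigr => r _ /=.
  rewrite -/(Q g) -/(Q (g * r)%g).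
  have -> : \sum_(c in im) ((Q g == c)%:R - (Q (g * r)%g == c)%:R) ^+ 2 =
      \sum_(c in im) ((Q g == c)%:R + (Q (g * r)%g == c)%:R
        - 2 * ((Q g == c)%:R * (Q (g * r)%g == c)%:R)) :> R.
    by apply: eq_bigr => c _; case: (_ == c); case: (_ == c); rewrite /=; ring.
  rewrite sumrB big_split /= !sum_ind -mulr_sumr.
  rewrite (bigD1 (Q g))/=; last exact: imset_f.
  rewrite eqxx big1 ?addr0 => [|c /andP[_ /negbTE]]; last first.
    by rewrite eq_sym => ->; rewrite mul0r.
  by rewrite eq_sym; case: (_ == _) => /=; ring.
by move: key; rewrite two; lra.
Qed.

Lemma expected_merge_blocks (q : 'I_N -> 'I_N) :
  w * \sum_(p in edges S) (blocks (merge (idx p).1 (idx p).2 q) - 1)%:R <=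
  (1 - gamma / 2) * (blocks q - 1)%:R.
Proof.
have b0 (q' : 'I_N -> 'I_N) : (0 < blocks q')%N by apply: blocks_gt0; exact: ltnW.
have bE (q' : 'I_N -> 'I_N) : (blocks q' - 1)%:R = (blocks q')%:R - 1 :> R by rewrite natrB ?b0.
have -> : \sum_(p in edges S) (blocks (merge (idx p).1 (idx p).2 q) - 1)%:R =
    \sum_(p in edges S) ((blocks q - 1)%:R - (q (idx p).1 != q (idx p).2)%:R) :> R.
  apply: eq_bigr => p _; rewrite !bE -[in RHS](blocks_merge (idx p).1 (idx p).2).
  by rewrite natrD; ring.
rewrite sumrB mulrBr mulrBl mul1r bE lerB//; last exact: crossing_prob.
rewrite sumr_const -[X in w * X <= _]mulr_natl mulrA mulVf ?mul1r//.
by rewrite pnatr_eq0 -lt0n card_edges muln_gt0 (card_gen_gt0 S_gen gT1) ltnW.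
Qed.

End expected_blocks.

(** * Coalescence of the two chains *)

Section random_edges.
Variables (R : realType) (gT : finGroupType) (S : {set gT}).
Hypothesis S_gen : <<S>>%g = [set: gT]%SET.
Hypothesis S_id : 1%g \notin S.
Hypothesis gT1 : (1 < #|gT|)%N.
Local Notation N := #|gT|.
Local Notation vec := (N.-tuple R).
Local Notation w := (#|edges S|%:R^-1 : R).
Local Notation gamma := (spectral_gap R S).
Local Notation U := (uniform_simplex R N).
Implicit Types (f : vec -> \bar R) (e : seq (gT * gT)).

Fixpoint edge_seqs t : seq (seq (gT * gT)) :=
  if t is t'.+1 then [seq p :: e | p <- enum (edges S), e <- edge_seqs t'] else [:: [::]].

Let S0 : (0 < #|S|)%N. Proof. exact: card_gen_gt0 S_gen gT1. Qed.
Let E0 : (0 < #|edges S|)%N. Proof. exact: card_edges_gt0. Qed.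
Let w0 : 0 <= w. Proof. by rewrite invr_ge0. Qed.
Let wt0 t : (0 <= (w ^+ t)%:E)%E. Proof. by rewrite lee_fin exprn_ge0. Qed.

Lemma size_edge_seqs t : size (edge_seqs t) = (#|edges S| ^ t)%N.
Proof. by elim: t => [//|t ih] /=; rewrite size_allpairs ih -cardE expnS. Qed.

Lemma edge_seqsP t e : e \in edge_seqs t -> all (fun p => p.1 != p.2) (map (@idx gT) e).
Proof.
elim: t e => [|t ih] e /=; first by rewrite inE => /eqP ->.
move=> /allpairsP[[p e'] /= [pE /ih e'E ->]] /=.
rewrite e'E andbT (inj_eq enum_rank_inj) (edge_neq S_id)//.
by move: pE; rewrite mem_enum.
Qed.

Lemma rint_edge p f x : rint (@edge_map R gT) p f x = move_int (idx p).1 (idx p).2 f x.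
Proof. by apply: eq_integral => l _; rewrite edge_mapE. Qed.

(** The choice of the edges is averaged outside the integrals over the multipliers, which allows a
    coupling of the multipliers that depends on all the edges. *)
Lemma iter_gibbs_opE t f x : measurable_fun [set: _] f -> (forall x, 0 <= f x)%E ->
  iter t (gibbs_op S) f x =
  ((w ^+ t)%:E * \sum_(e <- edge_seqs t) moves_int (map (@idx gT) e) f x)%E.
Proof.
move=> mf f0; elim: t x => [|t ih] x; first by rewrite /= big_seq1 mul1e.
rewrite iterS /= big_allpairs_dep /= /gibbs_op /rop exprS EFinM -muleA; congr (_ * _)%E.
have -> : iter t (gibbs_op S) f = (fun x => (w ^+ t)%:E *
    \sum_(e <- edge_seqs t) moves_int (map (@idx gT) e) f x)%E by exact/funext.
rewrite ge0_sume_distrr; last first.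
  by move=> p _; apply: sume_ge0 => e _; exact: (moves_int_ge0 f0 (idx p :: _)).
rewrite -big_enum /=; apply: eq_bigr => p _.
rewrite rint_edge /move_int ge0_integralZl//.
- congr (_ * _)%E; rewrite ge0_integral_sum//.
  + move=> e; apply: measurable_funTS.
    by have := measurableT_comp (measurable_moves_int mf f0 (map (@idx gT) e))
      (measurable_move1 (idx p).1 (idx p).2 x).
  + by move=> e l _; exact: moves_int_ge0.
- apply: emeasurable_sum => e; apply: measurable_funTS.
  by have := measurableT_comp (measurable_moves_int mf f0 (map (@idx gT) e))
    (measurable_move1 (idx p).1 (idx p).2 x).
- by move=> l _; apply: sume_ge0 => e _; exact: moves_int_ge0.
Qed.

Lemma expected_blocks t :
  w ^+ t * \sum_(e <- edge_seqs t) (blocks (partition_of (map (@idx gT) e)) - 1)%:R <=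
  (1 - gamma / 2) ^+ t * N%:R.
Proof.
have g2 : 0 <= 1 - gamma / 2.
  have := spectral_gap_le R S_gen S_id gT1.
  have : 4 / N%:R <= 2 :> R.
    rewrite ler_pdivrMr ?ltr0n ?(ltnW gT1)//.
    by have N2 : (2 : R) <= N%:R; [rewrite ler_nat|lra].
  lra.
elim: t => [|t ih].
  rewrite !expr0 !mul1r /= big_seq1 ler_nat (leq_trans (leq_subr _ _))//.
  by rewrite /blocks -[leqRHS]card_ord max_card.
(* The head is the first move but the last one to be merged, so the induction fixes the tail [e] and
   averages over the head. *)
rewrite /= big_allpairs_dep /= exchange_big /= exprSr -mulrA.
rewrite [X in _ * X <= _]mulr_sumr exprS -mulrA.
apply: (@le_trans _ _ (w ^+ t * \sum_(e <- edge_seqs t) ((1 - gamma / 2) *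
   (blocks (partition_of (map (@idx gT) e)) - 1)%:R))).
  rewrite ler_wpM2l ?exprn_ge0//; apply: ler_sum => e _.
  by rewrite big_enum /=; exact: expected_merge_blocks.
by rewrite -mulr_sumr mulrCA ler_wpM2l.
Qed.

Definition expected_bad (eta : R) t (y : vec) : \bar R :=
  ((w ^+ t)%:E * \sum_(e <- edge_seqs t) bad eta (map (@idx gT) e) y)%E.

Lemma expected_bad_ge0 eta t y : (0 <= expected_bad eta t y)%E.
Proof. by rewrite mule_ge0// sume_ge0// => e _; exact: bad_ge0. Qed.

Lemma measurable_expected_bad eta t : measurable_fun [set: vec] (expected_bad eta t).
Proof.
apply: emeasurable_funM => //.
by apply: emeasurable_sum => e; exact: measurable_bad.
Qed.

Lemma avg_edge_seqs (c : R) t : w ^+ t * \sum_(e <- edge_seqs t) c = c.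
Proof.
rewrite big_const_seq count_predT iter_addr_0 size_edge_seqs -[c *+ _]mulr_natl mulrA natrX.
by rewrite -exprMn mulVf ?expr1n ?mul1r// pnatr_eq0 -lt0n.
Qed.

Lemma integral_expected_bad eta t : 0 <= eta ->
  (\int[U]_y expected_bad eta t y <= (N%:R * (N%:R * eta))%:E)%E.
Proof.
move=> eta0; rewrite ge0_integralZl//; last 2 first.
- by apply: emeasurable_sum => e; exact: measurable_bad.
- by move=> y _; apply: sume_ge0 => e _; exact: bad_ge0.
rewrite ge0_integral_sum//; last 2 first.
- by move=> e; exact: measurable_bad.
- by move=> e y _; exact: bad_ge0.
rewrite -[X in (_ <= X%:E)%E](avg_edge_seqs _ t) EFinM; apply: lee_wpmul2l => //.
rewrite -sumEFin big_seq [leRHS]big_seq; apply: lee_sum => e /edge_seqsP ee.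
apply: (le_trans (integral_bad gT1 eta0 ee)); rewrite lee_fin.
rewrite ler_wpM2r ?mulr_ge0// ler_nat -[leqRHS](splits_blocks (map (@idx gT) e)).
exact: leq_addr.
Qed.

Lemma coalesce_phase eta t f (x y : vec) : 0 < eta ->
  measurable_fun [set: _] f -> (forall x, 0 <= f x)%E -> (forall x, f x <= 1)%E ->
  simplex R N x -> simplex R N y ->
  (iter t (gibbs_op S) f x <= iter t (gibbs_op S) f y + expected_bad eta t y +
    (N%:R * (2 * (\sum_k `|tnth x k - tnth y k|) / eta) +
     (1 - gamma / 2) ^+ t * N%:R)%:E)%E.
Proof.
move=> eta0 mf f0 f1 sx sy; rewrite !iter_gibbs_opE//.
set c := N%:R * _.
have c0 : 0 <= c.
  by rewrite mulr_ge0// divr_ge0 ?(ltW eta0)// mulr_ge0// sumr_ge0.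
apply: (@le_trans _ _ ((w ^+ t)%:E * \sum_(e <- edge_seqs t)
  (moves_int (map (@idx gT) e) f y + bad eta (map (@idx gT) e) y +
   (c + (blocks (partition_of (map (@idx gT) e)) - 1)%:R)%:E))%E).
  apply: lee_wpmul2l => //; rewrite big_seq [leRHS]big_seq.
  apply: lee_sum => e /edge_seqsP ee; apply: coalesce_simplex => //.
  exact: ltnW.
rewrite big_split ge0_muleDr/=; last 2 first.
- by apply: sume_ge0 => e _; rewrite adde_ge0// ?bad_ge0// moves_int_ge0.
- by apply: sume_ge0 => e _; rewrite lee_fin addr_ge0.
rewrite big_split ge0_muleDr/=; last 2 first.
- by apply: sume_ge0 => e _; exact: moves_int_ge0.
- by apply: sume_ge0 => e _; exact: bad_ge0.
apply: leeD => //.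
rewrite sumEFin -EFinM lee_fin big_split /= mulrDr avg_edge_seqs lerD2l.
exact: expected_blocks.
Qed.

End random_edges.

(** * Contraction of two chains driven by the same moves *)

Section pair_averaging.
Variables (R : realType) (n : nat).
Implicit Types (F G : 'I_n -> 'I_n -> R) (u : 'I_n -> R) (a b g h : 'I_n).

Definition quad F u : R := \sum_g \sum_h F g h * u g * u h.

(* The mean of [quad F] after a common move at [a, b] is [quad (pairT a b F)]. *)
Definition pairT a b F : 'I_n -> 'I_n -> R := fun g h =>
  if (g == a) || (g == b) then
    if (h == a) || (h == b) then (F a a + F b b) / 3 + (F a b + F b a) / 6
    else (F a h + F b h) / 2
  else if (h == a) || (h == b) then (F g a + F g b) / 2 else F g h.

Let out a b := [pred g : 'I_n | (g != a) && (g != b)].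

Lemma sum3 a b (f : 'I_n -> R) : a != b ->
  \sum_g f g = \sum_(g | out a b g) f g + f a + f b.
Proof. by move=> ab; rewrite (sum_split2 _ _ ab). Qed.

Lemma sum3_pair a b (f : 'I_n -> 'I_n -> R) : a != b ->
  \sum_g \sum_h f g h =
  \sum_(g | out a b g) \sum_(h | out a b h) f g h +
  (\sum_(g | out a b g) (f g a + f g b) + \sum_(h | out a b h) (f a h + f b h)) +
  (f a a + f a b + f b a + f b b).
Proof.
move=> ab; rewrite (sum3 _ ab) !(sum3 (f _) ab).
under eq_bigr do rewrite (sum3 _ ab).
by rewrite !big_split /=; ring.
Qed.

Section pairT_values.
Variables (a b : 'I_n) (F : 'I_n -> 'I_n -> R).

Lemma pairT_oo g h : out a b g -> out a b h -> pairT a b F g h = F g h.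
Proof. by move=> /andP[/negbTE ga /negbTE gb] /andP[/negbTE ha /negbTE hb]; rewrite /pairT ga gb ha hb. Qed.

Lemma pairT_oe g h : out a b g -> (h == a) || (h == b) -> pairT a b F g h = (F g a + F g b) / 2.
Proof. by move=> /andP[/negbTE ga /negbTE gb] he; rewrite /pairT ga gb he. Qed.

Lemma pairT_eo g h : (g == a) || (g == b) -> out a b h -> pairT a b F g h = (F a h + F b h) / 2.
Proof. by move=> ge /andP[/negbTE ha /negbTE hb]; rewrite /pairT ge ha hb. Qed.

Lemma pairT_ee g h : (g == a) || (g == b) -> (h == a) || (h == b) ->
  pairT a b F g h = (F a a + F b b) / 3 + (F a b + F b a) / 6.
Proof. by move=> ge he; rewrite /pairT ge he. Qed.

End pairT_values.

Let ina a b : (a == a) || (a == b). Proof. by rewrite eqxx. Qed.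
Let inb a b : (b == a) || (b == b). Proof. by rewrite eqxx orbT. Qed.

(** A polynomial in [l], ready for [integral01_quadratic]: the gaps at [a] and [b] enter only
    through their sum [s], which both chains redistribute with the same [l]. *)
Lemma quad_move a b F (x y : n.-tuple R) l : a != b ->
  let rr := \sum_(g | out a b g) \sum_(h | out a b h) F g h * gap x y g * gap x y h in
  let s := gap x y a + gap x y b in
  let ra := \sum_(g | out a b g) (F g a + F a g) * gap x y g in
  let rb := \sum_(g | out a b g) (F g b + F b g) * gap x y g in
  quad F (gap (move a b x l) (move a b y l)) =
  (rr + s * rb + s ^+ 2 * F b b) +
  (s * (ra - rb) + s ^+ 2 * (F a b + F b a - 2 * F b b)) * l +
  (s ^+ 2 * (F a a + F b b - F a b - F b a)) * l ^+ 2.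
Proof.
move=> ab rr s ra rb; rewrite /quad (sum3_pair _ ab).
have ga : gap (move a b x l) (move a b y l) a = l * s.
  by rewrite /gap !tnth_move eqxx /s /gap; ring.
have gb : gap (move a b x l) (move a b y l) b = (1 - l) * s.
  by rewrite /gap !tnth_move eqxx [b == a]eq_sym (negbTE ab) /s /gap; ring.
have go g : out a b g -> gap (move a b x l) (move a b y l) g = gap x y g.
  by move=> /andP[/negbTE ha /negbTE hb]; rewrite /gap !tnth_move ha hb.
rewrite ga gb.
have -> : \sum_(g | out a b g) \sum_(h | out a b h)
   F g h * gap (move a b x l) (move a b y l) g * gap (move a b x l) (move a b y l) h = rr.
  by apply: eq_bigr => g og; apply: eq_bigr => h oh; rewrite !go.
rewrite -big_split /=.
have -> : \sum_(i | out a b i)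
   (F i a * gap (move a b x l) (move a b y l) i * (l * s) +
    F i b * gap (move a b x l) (move a b y l) i * ((1 - l) * s) +
    (F a i * (l * s) * gap (move a b x l) (move a b y l) i +
     F b i * ((1 - l) * s) * gap (move a b x l) (move a b y l) i)) =
   l * s * ra + (1 - l) * s * rb.
  rewrite /ra /rb !mulr_sumr -big_split /=; apply: eq_bigr => g og; rewrite go//; ring.
ring.
Qed.

Lemma quad_pairT a b F (x y : n.-tuple R) : a != b ->
  let rr := \sum_(g | out a b g) \sum_(h | out a b h) F g h * gap x y g * gap x y h in
  let s := gap x y a + gap x y b in
  let ra := \sum_(g | out a b g) (F g a + F a g) * gap x y g in
  let rb := \sum_(g | out a b g) (F g b + F b g) * gap x y g in
  quad (pairT a b F) (gap x y) =
  rr + s * (ra + rb) / 2 + s ^+ 2 * ((F a a + F b b) / 3 + (F a b + F b a) / 6).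
Proof.
move=> ab rr s ra rb; rewrite /quad (sum3_pair _ ab).
rewrite !(pairT_ee F (ina a b) (ina a b), pairT_ee F (ina a b) (inb a b),
  pairT_ee F (inb a b) (ina a b), pairT_ee F (inb a b) (inb a b)).
have -> : \sum_(g | out a b g) \sum_(h | out a b h)
   pairT a b F g h * gap x y g * gap x y h = rr.
  by apply: eq_bigr => g og; apply: eq_bigr => h oh; rewrite pairT_oo.
rewrite -big_split /=.
have -> : \sum_(i | out a b i)
    (pairT a b F i a * gap x y i * gap x y a + pairT a b F i b * gap x y i * gap x y b +
    (pairT a b F a i * gap x y a * gap x y i + pairT a b F b i * gap x y b * gap x y i)) =
    s / 2 * (ra + rb).
  rewrite /ra /rb -big_split mulr_sumr /=; apply: eq_bigr => g og.
  by rewrite (pairT_oe F og (ina a b)) (pairT_oe F og (inb a b)) (pairT_eo F (ina a b) og) (pairT_eo F (inb a b) og) /s; field.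
by rewrite /s; field.
Qed.

(* The weight for which every [pairT a b] is an orthogonal projection. *)
Definition pw g h : R := 1 + (g == h)%:R.

Definition pdot F G : R := \sum_g \sum_h pw g h * F g h * G g h.

Lemma pw_out a b g : out a b g ->
  [/\ pw g a = 1, pw a g = 1, pw g b = 1 & pw b g = 1].
Proof.
move=> /andP[ga gb]; rewrite /pw [a == g]eq_sym [b == g]eq_sym.
by rewrite (negbTE ga) (negbTE gb) addr0.
Qed.

Lemma pw_in a b : a != b -> [/\ pw a a = 2, pw b b = 2, pw a b = 1 & pw b a = 1].
Proof.
by move=> ab; rewrite /pw !eqxx [b == a]eq_sym (negbTE ab) addr0.
Qed.

(** [pairT a b] replaces [F] by its mean for the weights [pw] on each class of a partition of the
    index pairs: [{(g, a), (g, b)}], [{(a, h), (b, h)}], and the four pairs inside [{a, b}], whose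
    weights 2, 2, 1, 1 give the coefficients 1/3 and 1/6. Such an averaging is an orthogonal
    projection. *)
Lemma pdot_pairT_orth a b F G : a != b ->
  pdot (fun g h => F g h - pairT a b F g h) (pairT a b G) = 0.
Proof.
move=> ab; have [paa pbb pab pba] := pw_in ab.
rewrite /pdot (sum3_pair _ ab) paa pbb pab pba.
rewrite !(pairT_ee _ (ina a b) (ina a b), pairT_ee _ (ina a b) (inb a b),
  pairT_ee _ (inb a b) (ina a b), pairT_ee _ (inb a b) (inb a b)).
rewrite big1 => [|g og]; last first.
  by rewrite big1// => h oh; rewrite pairT_oo// subrr mulr0 mul0r.
rewrite big1 => [|g og]; last first.
  have [pga pag pgb pbg] := pw_out og.
  by rewrite !(pairT_oe _ og (ina a b), pairT_oe _ og (inb a b)) pga pgb; field.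
rewrite big1 => [|g og]; last first.
  have [pga pag pgb pbg] := pw_out og.
  by rewrite !(pairT_eo _ (ina a b) og, pairT_eo _ (inb a b) og) pag pbg; field.
by field.
Qed.

(** Two outer entries lose [(F g a - F g b)^2 / 2]; the factor is lowered to 1/3 so that the four
    inner entries satisfy the same bound. *)
Lemma pnorm_pairT a b F : a != b ->
  3^-1 * (\sum_h (F a h - F b h) ^+ 2 + \sum_g (F g a - F g b) ^+ 2) <=
  pdot (fun g h => F g h - pairT a b F g h) (fun g h => F g h - pairT a b F g h).
Proof.
move=> ab; have [paa pbb pab pba] := pw_in ab.
rewrite /pdot (sum3_pair _ ab) paa pbb pab pba.
rewrite !(pairT_ee _ (ina a b) (ina a b), pairT_ee _ (ina a b) (inb a b),
  pairT_ee _ (inb a b) (ina a b), pairT_ee _ (inb a b) (inb a b)).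
rewrite [X in _ <= X + _ + _]big1 => [|g og]; last first.
  by rewrite big1// => h oh; rewrite pairT_oo// subrr mulr0.
have -> : \sum_(g | out a b g) (pw g a * (F g a - pairT a b F g a) * (F g a - pairT a b F g a) +
    pw g b * (F g b - pairT a b F g b) * (F g b - pairT a b F g b)) =
    2^-1 * \sum_(g | out a b g) (F g a - F g b) ^+ 2.
  rewrite mulr_sumr; apply: eq_bigr => g og.
  have [pga pag pgb pbg] := pw_out og.
  by rewrite !(pairT_oe _ og (ina a b), pairT_oe _ og (inb a b)) pga pgb; field.
have -> : \sum_(g | out a b g) (pw a g * (F a g - pairT a b F a g) * (F a g - pairT a b F a g) +
    pw b g * (F b g - pairT a b F b g) * (F b g - pairT a b F b g)) =
    2^-1 * \sum_(g | out a b g) (F a g - F b g) ^+ 2.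
  rewrite mulr_sumr; apply: eq_bigr => g og.
  have [pga pag pgb pbg] := pw_out og.
  by rewrite !(pairT_eo _ (ina a b) og, pairT_eo _ (inb a b) og) pag pbg; field.
rewrite !(sum3 _ ab).
have X0 : 0 <= \sum_(g | out a b g) (F a g - F b g) ^+ 2.
  by apply: sumr_ge0 => g _; exact: sqr_ge0.
have Y0 : 0 <= \sum_(g | out a b g) (F g a - F g b) ^+ 2.
  by apply: sumr_ge0 => g _; exact: sqr_ge0.
have := sqr_ge0 (F a a - F b b); have := sqr_ge0 (F a b - F b a).
move: X0 Y0; set X := \sum_(g | _) _; set Y := \sum_(g | _) _.
move: (F a a) (F a b) (F b a) (F b b) => p q r s X0 Y0 h1 h2.
rewrite -subr_ge0 (_ : _ - _ = 6^-1 * X + 6^-1 * Y + 6^-1 * (q - r) ^+ 2 + 4 / 6 * (p - s) ^+ 2).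
  by rewrite !addr_ge0// mulr_ge0.
by field.
Qed.

End pair_averaging.

(** * Contraction of quadratic forms, modulo constants *)

Section pair_contraction.
Variables (R : realType) (gT : finGroupType) (S : {set gT}).
Hypothesis S_gen : <<S>>%g = [set: gT]%SET.
Hypothesis S_id : 1%g \notin S.
Hypothesis gT1 : (1 < #|gT|)%N.
Local Notation N := #|gT|.
Local Notation vec := (N.-tuple R).
Local Notation w := (#|edges S|%:R^-1 : R).
Local Notation gamma := (spectral_gap R S).
Implicit Types F G : 'I_N -> 'I_N -> R.

Let w0 : 0 <= w. Proof. by rewrite invr_ge0. Qed.

Let E0 : (0 < #|edges S|)%N.
Proof. by apply: card_edges_gt0; exact: card_gen_gt0 S_gen gT1. Qed.

Let idx_neq p : p \in edges S -> (@idx gT p).1 != (idx p).2.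
Proof. by move=> pS; rewrite (inj_eq enum_rank_inj) (edge_neq S_id). Qed.

Let wsum (c : R) : w * (\sum_(p in edges S) c) = c.
Proof. by rewrite sumr_const -[c *+ _]mulr_natl mulrA mulVf ?mul1r// pnatr_eq0 -lt0n. Qed.

Definition edgeT p F := pairT (@idx gT p).1 (idx p).2 F.

Definition pairL F : 'I_N -> 'I_N -> R := fun g h => w * \sum_(p in edges S) edgeT p F g h.

Definition pone : 'I_N -> 'I_N -> R := fun _ _ => 1.

Lemma pdotC F G : pdot F G = pdot G F.
Proof. by apply: eq_bigr => g _; apply: eq_bigr => h _; ring. Qed.

Lemma pdotDr F G H : pdot F (fun g h => G g h + H g h) = pdot F G + pdot F H.
Proof.
rewrite /pdot -big_split /=; apply: eq_bigr => g _; rewrite -big_split /=.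
by apply: eq_bigr => h _; ring.
Qed.

Lemma pdotZr F (c : R) G : pdot F (fun g h => c * G g h) = c * pdot F G.
Proof.
rewrite /pdot mulr_sumr; apply: eq_bigr => g _; rewrite mulr_sumr.
by apply: eq_bigr => h _; ring.
Qed.

Lemma pdotBr F G H : pdot F (fun g h => G g h - H g h) = pdot F G - pdot F H.
Proof.
rewrite -[- pdot F H]mulN1r -pdotZr -pdotDr /pdot; apply: eq_bigr => g _.
by apply: eq_bigr => h _; ring.
Qed.

Lemma pdot_sqrB F G : pdot (fun g h => F g h - G g h) (fun g h => F g h - G g h) =
  pdot F F - 2 * pdot F G + pdot G G.
Proof.
rewrite /pdot mulr_sumr -sumrB -big_split /=; apply: eq_bigr => g _.
rewrite mulr_sumr -sumrB -big_split /=; apply: eq_bigr => h _; ring.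
Qed.

Lemma pdot_ge0 F : 0 <= pdot F F.
Proof.
apply: sumr_ge0 => g _; apply: sumr_ge0 => h _; rewrite -mulrA mulr_ge0//.
  by rewrite /pw addr_ge0.
exact: sqr_ge0.
Qed.

Lemma pdot_pairLr F G : pdot F (pairL G) = w * \sum_(p in edges S) pdot F (edgeT p G).
Proof.
rewrite /pdot [in RHS]exchange_big mulr_sumr; apply: eq_bigr => g _.
rewrite [in RHS]exchange_big mulr_sumr; apply: eq_bigr => h _ /=.
by rewrite /pairL mulrCA; congr (_ * _); rewrite mulr_sumr.
Qed.

Lemma pdot_edgeT p F G : p \in edges S -> pdot F (edgeT p G) = pdot (edgeT p F) (edgeT p G).
Proof.
move=> pE; have := @pdot_pairT_orth R N _ _ F G (idx_neq pE).
by rewrite pdotC pdotBr [pdot (pairT _ _ G) F]pdotC [pdot (pairT _ _ G) _]pdotC => /eqP;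
  rewrite subr_eq0 => /eqP.
Qed.

Lemma pnorm_sub_edgeT p F : p \in edges S ->
  pdot (fun g h => F g h - edgeT p F g h) (fun g h => F g h - edgeT p F g h) =
  pdot F F - pdot (edgeT p F) (edgeT p F).
Proof.
by move=> pE; rewrite pdot_sqrB pdot_edgeT//; ring.
Qed.

Lemma edgeT_one p : edgeT p pone = pone.
Proof.
apply/funext => g; apply/funext => h; rewrite /edgeT /pairT /pone.
by case: ifP => _; case: ifP => _; field.
Qed.

Lemma pdot_pairL_one F : pdot pone (pairL F) = pdot pone F.
Proof.
rewrite pdot_pairLr -[RHS]wsum; congr (_ * _); apply: eq_bigr => p pE.
by rewrite pdot_edgeT// pdotC -pdot_edgeT// edgeT_one pdotC.
Qed.

Lemma sum_idx_energy (d : 'I_N -> R) :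
  w * \sum_(p in edges S) (d (idx p).1 - d (idx p).2) ^+ 2 =
  edge_energy S (fun x => d (enum_rank x)).
Proof. by rewrite sum_edges /edge_energy card_edges. Qed.

Lemma gap_var (d : 'I_N -> R) :
  gamma * (\sum_k d k ^+ 2 - (\sum_k d k) ^+ 2 / N%:R) <=
  w * \sum_(p in edges S) (d (idx p).1 - d (idx p).2) ^+ 2.
Proof.
rewrite sum_idx_energy.
apply: le_trans (edge_energy_var S_gen S_id gT1 (fun x => d (enum_rank x))).
rewrite -!sum_enum_val le_eqVlt; apply/orP; left; apply/eqP.
by congr (_ * (_ - _ ^+ 2 / _)); apply: eq_bigr => k _; rewrite enum_valK.
Qed.

(** The constant 1/6 is 1/3 from [pnorm_pairT] times 1/2 from the weights [pw], which are at most 2.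
    In between, the variance of [F] on the product is at most the sum of its variances along columns
    and rows, to each of which the Poincare inequality of the walk applies. *)
Lemma pdot_spread F : pdot pone F = 0 ->
  gamma / 6 * pdot F F <=
  w * \sum_(p in edges S) pdot (fun g h => F g h - edgeT p F g h) (fun g h => F g h - edgeT p F g h).
Proof.
move=> F0.
have gap0 := ltW (spectral_gap_gt0 R S_gen S_id gT1).
have n0 : 0 < (N%:R : R) by rewrite ltr0n ltnW.
pose row g := \sum_h F g h; pose col h := \sum_g F g h.
pose tot := \sum_g row g.
have totE : tot = \sum_h col h by rewrite /tot /row exchange_big.
pose sq := \sum_g \sum_h F g h ^+ 2.
pose V := sq - tot ^+ 2 / N%:R ^+ 2.
have sumc (c : R) : \sum_(k < N) c = N%:R * c by rewrite sumr_const card_ord mulr_natl.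
(* Tensorization of the variance: the square expanded here is that of [F] stripped of its row and
   column means. *)
have tensor : V <= (sq - \sum_h col h ^+ 2 / N%:R) + (sq - \sum_g row g ^+ 2 / N%:R).
  have : 0 <= \sum_g \sum_h (F g h - row g / N%:R - col h / N%:R + tot / N%:R ^+ 2) ^+ 2.
    by apply: sumr_ge0 => g _; apply: sumr_ge0 => h _; exact: sqr_ge0.
  have inner g : \sum_h (F g h - row g / N%:R - col h / N%:R + tot / N%:R ^+ 2) ^+ 2 =
     \sum_h F g h ^+ 2 - row g ^+ 2 / N%:R + (\sum_h col h ^+ 2) / N%:R ^+ 2
     - tot ^+ 2 / N%:R ^+ 3
     - 2 / N%:R * (\sum_h F g h * col h) + 2 * row g * tot / N%:R ^+ 2.
    pose r := tot / N%:R ^+ 2 - row g / N%:R.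
    have -> : \sum_h (F g h - row g / N%:R - col h / N%:R + tot / N%:R ^+ 2) ^+ 2 =
       \sum_h (F g h ^+ 2 + N%:R ^- 2 * col h ^+ 2 + r ^+ 2 + (- 2 / N%:R) * (F g h * col h)
         + (2 * r) * F g h + (- 2 * r / N%:R) * col h).
      by apply: eq_bigr => h _; rewrite /r; field; rewrite gt_eqF.
    rewrite !big_split /= -!mulr_sumr sumc -totE -/(row g) /r.
    by field; rewrite gt_eqF.
  under eq_bigr do rewrite inner.
  have cross : \sum_g \sum_h F g h * col h = \sum_h col h ^+ 2.
    rewrite exchange_big; apply: eq_bigr => h _ /=.
    by rewrite -mulr_suml -/(col h) expr2.
  rewrite !big_split /= !sumrN !sumc -!mulr_sumr cross -!mulr_suml -mulr_sumr -/tot -/sq.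
  rewrite /V => h; rewrite -subr_ge0; apply: le_trans h _.
  by rewrite le_eqVlt; apply/orP; left; apply/eqP; field; rewrite gt_eqF.
(* [F] is orthogonal to the constants for [pdot], so subtracting its unweighted mean [c] can only
   increase the norm. *)
have FV : pdot F F <= 2 * V.
  pose c := tot / N%:R ^+ 2.
  have h1 : pdot F F <= pdot (fun g h => F g h - c * pone g h) (fun g h => F g h - c * pone g h).
    rewrite pdot_sqrB pdotZr pdotC F0 !mulr0 subr0 lerDl; exact: pdot_ge0.
  apply: (le_trans h1).
  have -> : 2 * V = \sum_g \sum_h 2 * (F g h - c) ^+ 2.
    have -> : \sum_g \sum_h 2 * (F g h - c) ^+ 2 =
      \sum_g \sum_h (2 * F g h ^+ 2 + (- 4 * c) * F g h + 2 * c ^+ 2).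
      by apply: eq_bigr => g _; apply: eq_bigr => h _; ring.
    under eq_bigr do rewrite !big_split /= -!mulr_sumr sumc.
    rewrite !big_split /= -!mulr_sumr sumc -/tot -/sq /V /c.
    by field; rewrite gt_eqF.
  apply: ler_sum => g _; apply: ler_sum => h _; rewrite /pone mulr1 -mulrA -expr2.
  rewrite ler_wpM2r ?sqr_ge0// /pw; case: (g == h); rewrite /=; lra.
have step : 3^-1 * (gamma * V) <= w * \sum_(p in edges S)
    pdot (fun g h => F g h - edgeT p F g h) (fun g h => F g h - edgeT p F g h).
  apply: (@le_trans _ _ (w * \sum_(p in edges S) 3^-1 *
    (\sum_h (F (idx p).1 h - F (idx p).2 h) ^+ 2 + \sum_g (F g (idx p).1 - F g (idx p).2) ^+ 2))).
    rewrite -mulr_sumr [leRHS]mulrCA ler_wpM2l//.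
    have swap_sum (f : gT * gT -> 'I_N -> R) : w * (\sum_(p in edges S) \sum_k f p k) =
        \sum_k w * (\sum_(p in edges S) f p k).
      by rewrite exchange_big mulr_sumr.
    rewrite big_split [leRHS]mulrDr !swap_sum.
    apply: (@le_trans _ _ (gamma * ((sq - \sum_h col h ^+ 2 / N%:R) + (sq - \sum_g row g ^+ 2 / N%:R)))).
      by rewrite ler_wpM2l.
    rewrite [leLHS]mulrDr; apply: lerD.
      rewrite {1}/sq exchange_big -sumrB mulr_sumr; apply: ler_sum => h _.
      exact: gap_var.
    rewrite /sq -sumrB mulr_sumr; apply: ler_sum => g _.
    exact: gap_var.
  rewrite ler_wpM2l//; apply: ler_sum => p pE.
  exact: pnorm_pairT (idx_neq pE).
apply: le_trans step.
have := ler_wpM2l gap0 FV; lra.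
Qed.

Let kap := gamma / 6.

Lemma contraction_gt0 : 0 < 1 - kap.
Proof.
have := spectral_gap_le R S_gen S_id gT1.
have : 4 / N%:R <= 2 :> R.
  rewrite ler_pdivrMr ?ltr0n ?(ltnW gT1)//.
  by have N2 : (2 : R) <= N%:R; [rewrite ler_nat|lra].
rewrite /kap; lra.
Qed.

(** The spread bounds the form [<F, L F>] by [s <F, F>]. As [L] averages projections, AM-GM upgrades
    this to the norm: with [G = L F], [2 <G, G> <= s^2 <F, F> + <G, G>]. *)
Lemma pnorm_pairL F : pdot pone F = 0 ->
  pdot (pairL F) (pairL F) <= (1 - kap) ^+ 2 * pdot F F.
Proof.
move=> F0; have s0 := contraction_gt0; pose s := 1 - kap.
have avg G : pdot pone G = 0 ->
    w * \sum_(p in edges S) pdot (edgeT p G) (edgeT p G) <= s * pdot G G.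
  move=> G0; have := pdot_spread G0.
  rewrite (eq_bigr (fun p => pdot G G - pdot (edgeT p G) (edgeT p G))) => [|p pE]; last exact: pnorm_sub_edgeT.
  by rewrite sumrB mulrBr wsum -/kap /s; lra.
pose G := pairL F.
have G0 : pdot pone G = 0 by rewrite pdot_pairL_one.
have h1 := avg F F0; have h2 := avg G G0.
have h3 : 2 * pdot G G <= s * (w * \sum_(p in edges S) pdot (edgeT p F) (edgeT p F)) +
    s^-1 * (w * \sum_(p in edges S) pdot (edgeT p G) (edgeT p G)).
  rewrite {2}/G pdot_pairLr mulrCA [s * (w * _)]mulrCA [s^-1 * (w * _)]mulrCA -mulrDr.
  rewrite ler_wpM2l// !mulr_sumr -big_split /=; apply: ler_sum => p pE.
  rewrite pdot_edgeT//.
  have := pdot_ge0 (fun g h => s * edgeT p F g h - edgeT p G g h).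
  rewrite pdot_sqrB pdotZr [pdot _ (edgeT p F)]pdotC pdotZr.
  rewrite [pdot _ (edgeT p G)]pdotC pdotZr [pdot (edgeT p G) _]pdotC => hh.
  rewrite -(ler_pM2l s0) -/s mulrDr mulVKf ?gt_eqF//; lra.
have h4 : s^-1 * (w * \sum_(p in edges S) pdot (edgeT p G) (edgeT p G)) <= pdot G G.
  by rewrite -(ler_pM2l s0) -/s mulVKf ?gt_eqF.
have h5 : s * (w * \sum_(p in edges S) pdot (edgeT p F) (edgeT p F)) <= s * (s * pdot F F).
  by rewrite ler_pM2l.
by rewrite -/G -/s expr2 -mulrA; lra.
Qed.

End pair_contraction.

(** * Mean squared distance of two chains driven by the same moves *)

Section pair_operator.
Variables (R : realType) (gT : finGroupType) (S : {set gT}).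
Hypothesis S_gen : <<S>>%g = [set: gT]%SET.
Hypothesis S_id : 1%g \notin S.
Hypothesis gT1 : (1 < #|gT|)%N.
Local Notation N := #|gT|.
Local Notation vec := (N.-tuple R).
Local Notation w := (#|edges S|%:R^-1 : R).
Local Notation gamma := (spectral_gap R S).
Local Notation mu := (@lebesgue_measure R).
Implicit Types F : 'I_N -> 'I_N -> R.

Definition edge_map2 (p : gT * gT) (z : vec * vec) (l : measurableTypeR R) : vec * vec :=
  (edge_map p z.1 l, edge_map p z.2 l).

Lemma measurable_edge_map2 p :
  measurable_fun [set: (vec * vec) * measurableTypeR R] (fun z => edge_map2 p z.1 z.2).
Proof.
have m1 : measurable_fun [set: (vec * vec) * measurableTypeR R] (fun z => (z.1.1, z.2)).
  apply/measurable_fun_pairP; split; last exact: measurable_snd.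
  exact: (measurableT_comp measurable_fst measurable_fst).
have m2 : measurable_fun [set: (vec * vec) * measurableTypeR R] (fun z => (z.1.2, z.2)).
  apply/measurable_fun_pairP; split; last exact: measurable_snd.
  exact: (measurableT_comp measurable_snd measurable_fst).
apply/measurable_fun_pairP; split.
  exact: (measurableT_comp (@measurable_edge_map R gT p) m1).
exact: (measurableT_comp (@measurable_edge_map R gT p) m2).
Qed.

Definition pair_op := @rop _ (vec * vec)%type R _ (edges S) edge_map2.

Lemma pair_op_fst t (f : vec -> \bar R) z :
  iter t pair_op (f \o fst) z = iter t (gibbs_op S) f z.1.
Proof.
elim: t z => [//|t ih] z; rewrite !iterS /pair_op /gibbs_op /rop.
congr (_ * _)%E; apply: eq_bigr => p _; apply: eq_integral => l _.
by rewrite ih.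
Qed.

Lemma pair_op_snd t (f : vec -> \bar R) z :
  iter t pair_op (f \o snd) z = iter t (gibbs_op S) f z.2.
Proof.
elim: t z => [//|t ih] z; rewrite !iterS /pair_op /gibbs_op /rop.
congr (_ * _)%E; apply: eq_bigr => p _; apply: eq_integral => l _.
by rewrite ih.
Qed.

Definition quad_pair F (z : vec * vec) : \bar R := (quad F (gap z.1 z.2))%:E.

Lemma rint_quad p F z : p \in edges S ->
  rint edge_map2 p (quad_pair F) z = quad_pair (edgeT p F) z.
Proof.
move=> pE.
have pne : (@idx gT p).1 != (idx p).2.
  by rewrite (inj_eq enum_rank_inj) (edge_neq S_id).
rewrite /rint /quad_pair; under eq_integral => l _.
  rewrite /= !edge_mapE -/(idx p).1 -/(idx p).2 (quad_move _ _ _ _ pne).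
  over.
rewrite integral01_quadratic /edgeT (quad_pairT _ _ _ pne); congr EFin; by field.
Qed.

Lemma pair_op_quad F z : pair_op (quad_pair F) z = quad_pair (pairL S F) z.
Proof.
rewrite /pair_op /rop (eq_bigr (fun p => quad_pair (edgeT p F) z)) => [|p pE]; last exact: rint_quad.
rewrite /quad_pair sumEFin -EFinM; congr EFin.
rewrite /quad [in LHS]exchange_big mulr_sumr; apply: eq_bigr => g _.
rewrite [in LHS]exchange_big mulr_sumr; apply: eq_bigr => h _ /=.
by rewrite /pairL -!mulr_suml -!mulrA.
Qed.

Definition delta : 'I_N -> 'I_N -> R := fun g h => (g == h)%:R.

Lemma iter_pair_op_quad t F z :
  iter t pair_op (quad_pair F) z = quad_pair (iter t (pairL S) F) z.
Proof.
elim: t z => [//|t ih] z; rewrite !iterS -pair_op_quad; congr (pair_op _ _).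
exact/funext.
Qed.

Lemma quad_delta u : quad delta u = \sum_k u k ^+ 2.
Proof.
apply: eq_bigr => g _; rewrite (bigD1 g)//= /delta eqxx mul1r big1 ?addr0 ?expr2// => h.
by rewrite eq_sym => /negbTE ->; rewrite !mul0r.
Qed.

(* The constant making [delta - cc] orthogonal to the constants for [pdot]; it does
   not matter on gaps, whose coordinates sum to 0. *)
Let cc : R := 2 / (N%:R + 1).
Let F0 : 'I_N -> 'I_N -> R := fun g h => delta g h - cc.

Let wsum (c : R) : w * (\sum_(p in edges S) c) = c.
Proof.
rewrite sumr_const -[c *+ _]mulr_natl mulrA mulVf ?mul1r// pnatr_eq0 -lt0n.
by apply: card_edges_gt0; exact: card_gen_gt0 S_gen gT1.
Qed.

Let pairL_sub (c : R) F : pairL S (fun g h => F g h - c) = fun g h => pairL S F g h - c.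
Proof.
apply/funext => g; apply/funext => h; rewrite /pairL -[in RHS](wsum c) -mulrBr -sumrB.
congr (_ * _); apply: eq_bigr => p _; rewrite /edgeT /pairT.
by case: ifP => _; case: ifP => _; field.
Qed.

Let iter_F0 t : iter t (pairL S) F0 = fun g h => iter t (pairL S) delta g h - cc.
Proof. by elim: t => [//|t ih]; rewrite iterS ih pairL_sub. Qed.

Let sumc (c : R) : \sum_(k < N) c = N%:R * c.
Proof. by rewrite sumr_const card_ord mulr_natl. Qed.

Let sum_delta (g : 'I_N) : \sum_(h < N) (g == h)%:R = 1 :> R.
Proof.
rewrite (bigD1 g)//= eqxx big1 ?addr0// => h.
by rewrite eq_sym => /negbTE ->.
Qed.

Let pdot_F0 : pdot (@pone R gT) F0 = 0.
Proof.
rewrite /pdot.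
have inner g : \sum_h pw R g h * pone R g h * F0 g h = 2 - cc * (N%:R + 1).
  have -> : \sum_h pw R g h * pone R g h * F0 g h =
      \sum_h ((2 - cc) * (g == h)%:R - cc).
    apply: eq_bigr => h _; rewrite /pw /pone /F0 /delta.
    by case: (g == h); rewrite /=; ring.
  by rewrite sumrB -mulr_sumr sum_delta sumc; ring.
under eq_bigr do rewrite inner.
by rewrite /cc divfK ?subrr ?sumc ?mulr0// natr1 pnatr_eq0.
Qed.

Let pnorm_F0 : pdot F0 F0 <= 2 * N%:R.
Proof.
have n0 : 0 < (N%:R : R) by rewrite ltr0n ltnW.
have cc0 : 0 <= cc by rewrite divr_ge0 ?addr_ge0 ?(ltW n0).
have ccE : cc * (N%:R + 1) = 2 by rewrite /cc divfK// natr1 pnatr_eq0.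
rewrite /pdot.
have inner g : \sum_h pw R g h * F0 g h * F0 g h = 2 - 2 * cc.
  have -> : \sum_h pw R g h * F0 g h * F0 g h =
      \sum_h ((2 - 4 * cc + cc ^+ 2) * (g == h)%:R + cc ^+ 2).
    apply: eq_bigr => h _; rewrite /pw /F0 /delta.
    by case: (g == h); rewrite /=; ring.
  rewrite big_split /= -mulr_sumr sum_delta sumc.
  have -> : (2 - 4 * cc + cc ^+ 2) * 1 + N%:R * cc ^+ 2 = 2 - 4 * cc + cc * (cc * (N%:R + 1)) by ring.
  by rewrite ccE; ring.
under eq_bigr do rewrite inner.
by rewrite sumc; nra.
Qed.

Lemma iter_pnorm t : pdot (@pone R gT) (iter t (pairL S) F0) = 0 /\
  pdot (iter t (pairL S) F0) (iter t (pairL S) F0) <=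
  ((1 - gamma / 6) ^+ t) ^+ 2 * (2 * N%:R).
Proof.
elim: t => [|t [ih0 ih]]; first by rewrite expr0 expr1n mul1r.
rewrite iterS; split; first by rewrite pdot_pairL_one.
apply: (le_trans (pnorm_pairL S_gen S_id gT1 ih0)).
rewrite (_ : _ ^+ 2 * (2 * _) = (1 - gamma / 6) ^+ 2 *
  (((1 - gamma / 6) ^+ t) ^+ 2 * (2 * N%:R))); last by rewrite [_ ^+ t.+1]exprS; ring.
by apply: ler_wpM2l => //; exact: sqr_ge0.
Qed.

(** The mean squared distance is the form [L^t delta] at the initial gap [u]. It is estimated by
    AM-GM, weighted by the contraction factor [th], from [|H|^2 <= 2 n th^2] and [|u|^2 <= 2]. *)
Lemma iter_pair_op_delta t z : simplex R N z.1 -> simplex R N z.2 ->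
  (iter t pair_op (quad_pair delta) z <= ((1 - gamma / 6) ^+ t * (4 * N%:R))%:E)%E.
Proof.
case: z => x y /= [x0 x1] [y0 y1]; rewrite iter_pair_op_quad lee_fin.
have n2 : 2 <= (N%:R : R) by rewrite ler_nat.
set u := gap x y.
have u0 : \sum_k u k = 0 by rewrite sumrB x1 y1 subrr.
have le1 (z : vec) k : (forall i, 0 <= tnth z i) -> \sum_i tnth z i = 1 -> tnth z k <= 1.
  by move=> z0 <-; rewrite (bigD1 k)//= lerDl sumr_ge0.
have u1 k : u k ^+ 2 <= tnth x k + tnth y k.
  have := le1 x k x0 x1; have := le1 y k y0 y1.
  by have := x0 k; have := y0 k; rewrite /u /gap; nra.
have u2 : \sum_k u k ^+ 2 <= 2.
  apply: (@le_trans _ _ (\sum_k (tnth x k + tnth y k))); first exact: ler_sum.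
  by rewrite big_split /= x1 y1.
have u2' : 0 <= \sum_k u k ^+ 2 by apply: sumr_ge0 => k _; exact: sqr_ge0.
set G := iter t (pairL S) delta.
have GE : quad G u = quad (fun g h => G g h - cc) u.
  have -> : quad (fun g h => G g h - cc) u = quad G u - cc * (\sum_k u k) ^+ 2.
    rewrite /quad expr2 !mulr_suml mulr_sumr -sumrB; apply: eq_bigr => g _.
    rewrite !mulr_sumr -sumrB; apply: eq_bigr => h _; ring.
  by rewrite u0 expr0n mulr0 subr0.
rewrite GE -/(quad _ _) -iter_F0.
set H := iter t (pairL S) F0.
have [_ HN] := iter_pnorm t.
pose th := (1 - gamma / 6) ^+ t.
have th0 : 0 < th by rewrite exprn_gt0//; exact: contraction_gt0.
have H2 : \sum_g \sum_h H g h ^+ 2 <= th ^+ 2 * (2 * N%:R).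
  apply: le_trans HN; apply: ler_sum => g _; apply: ler_sum => h _.
  rewrite -mulrA -expr2 ler_peMl ?sqr_ge0// /pw lerDl; by case: (g == h).
have : 2 * quad H u <= th^-1 * (\sum_g \sum_h H g h ^+ 2) + th * (\sum_k u k ^+ 2) ^+ 2.
  rewrite /quad expr2 !mulr_suml !mulr_sumr -big_split /=; apply: ler_sum => g _.
  rewrite !mulr_sumr -big_split /=; apply: ler_sum => h _.
  have := sqr_ge0 (H g h - th * (u g * u h)).
  move=> hh; rewrite -(ler_pM2l th0) [leRHS]mulrDr mulVKf ?gt_eqF//.
  by nra.
have : th^-1 * (\sum_g \sum_h H g h ^+ 2) <= th * (2 * N%:R).
  by rewrite -(ler_pM2l th0) mulVKf ?gt_eqF// [leRHS]mulrA -expr2.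
rewrite -/th => hA hq.
have s4 : (\sum_k u k ^+ 2) ^+ 2 <= 4 by nra.
have t4 := ler_wpM2l (ltW th0) s4; have tN := ler_wpM2l (ltW th0) n2.
by lra.
Qed.

End pair_operator.

(** * The upper bound *)

Section mixing.
Variables (R : realType) (gT : finGroupType) (S : {set gT}).
Hypothesis S_gen : <<S>>%g = [set: gT]%SET.
Hypothesis S_id : 1%g \notin S.
Hypothesis gT1 : (1 < #|gT|)%N.
Local Notation N := #|gT|.
Local Notation vec := (N.-tuple R).
Local Notation gamma := (spectral_gap R S).
Local Notation U := (uniform_simplex R N).
Local Notation P := (gibbs_op S).
Local Notation delta := (@delta R gT).

Let S0 : (0 < #|S|)%N. Proof. exact: card_gen_gt0 S_gen gT1. Qed.
Let E0 : (0 < #|edges S|)%N. Proof. exact: card_edges_gt0. Qed.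
Let N0 : (0 < N)%N. Proof. exact: ltnW. Qed.
Let mE (p : gT * gT) := @measurable_edge_map R gT p.
Let mE2 (p : gT * gT) := @measurable_edge_map2 R gT p.

Lemma edge_map_simplex (p : gT * gT) (x : vec) l : p \in edges S -> 0 <= l <= 1 ->
  simplex R N x -> simplex R N (edge_map p x l).
Proof.
move=> pS l01 sx; rewrite edge_mapE; apply: move_simplex => //.
by rewrite (inj_eq enum_rank_inj) (edge_neq S_id).
Qed.

Lemma integral_uniform_gibbs_op t (f : vec -> \bar R) :
  measurable_fun [set: _] f -> (forall x, 0 <= f x)%E ->
  (\int[U]_x iter t P f x = \int[U]_x f x)%E.
Proof.
move=> mf f0; elim: t => [//|t <-].
set g := iter t P f.
have mg : measurable_fun [set: vec] g by exact: measurable_iter_rop.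
have g0 x : (0 <= g x)%E by exact: iter_rop_ge0.
rewrite iterS -/g /gibbs_op /rop ge0_integralZl//; last 2 first.
- rewrite (_ : (fun x => \sum_(p in edges S) _)%E = fun x =>
      (\sum_(p <- enum (edges S)) rint (@edge_map R gT) p g x)%E); last first.
    by apply/funext => x; rewrite big_enum.
  by apply: emeasurable_sum => p; apply: measurable_rint.
- by move=> x _; apply: sume_ge0 => p _; exact: rint_ge0.
under eq_integral do rewrite -big_enum /=.
rewrite ge0_integral_sum//; last 2 first.
- by move=> p; exact: measurable_rint.
- by move=> p x _; exact: rint_ge0.
rewrite big_enum /= (eq_bigr (fun=> \int[U]_x g x)%E); last first.
  move=> p pS; under eq_integral do rewrite rint_edge.
  by rewrite uniform_move// (inj_eq enum_rank_inj) (edge_neq S_id).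
rewrite sume_const; last by exact: integral_ge0.
by rewrite muleA -EFinM mulVf ?mul1e// pnatr_eq0 -lt0n.
Qed.

(** AM-GM in each coordinate. Unlike Cauchy-Schwarz, the result is linear in the quadratic form, so
    that the transition operator can be applied to it; [theta] is chosen at the end. *)
Lemma sum_gap_le (theta : R) (x y : vec) : 0 < theta ->
  \sum_k `|tnth x k - tnth y k| <= N%:R * theta + theta^-1 * quad delta (gap x y).
Proof.
move=> th0; rewrite quad_delta mulr_sumr.
have -> : N%:R * theta = \sum_(k < N) theta by rewrite sumr_const card_ord mulr_natl.
rewrite -big_split /=; apply: ler_sum => k _; rewrite -/(gap x y k).
rewrite -(ler_pM2l th0) mulrDr mulVKf ?gt_eqF//.
rewrite -real_normK ?num_real//.
have := sqr_ge0 (theta - `|gap x y k|); have := normr_ge0 (gap x y k); nra.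
Qed.

Lemma measurable_quad_pair_delta :
  measurable_fun [set: vec * vec] (quad_pair delta).
Proof.
apply/measurable_EFinP; under eq_fun do rewrite quad_delta.
apply: measurable_sum => k; apply: measurable_funX.
apply: measurable_funB.
  by apply: (measurableT_comp (measurable_tnth k)); exact: measurable_fst.
by apply: (measurableT_comp (measurable_tnth k)); exact: measurable_snd.
Qed.

(** The first summand is the l1 distance left by the contraction, bounded through [sum_gap_le],
    relative to [eta] and for at most [n] separations; the second bounds the expected number of
    extra blocks. *)
Definition mix_error (eta theta : R) t1 t2 : R :=
  N%:R * (2 * (N%:R * theta + theta^-1 * ((1 - gamma / 6) ^+ t1 * (4 * N%:R))) / eta) +
  (1 - gamma / 2) ^+ t2 * N%:R.

(** [coalesce_phase] holds for all pairs of states; [t1] steps of the pair operator replace its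
    distance term by the contracted one. Each marginal of the pair is the chain itself, so the other
    terms become those of a single chain. *)
Lemma iter_gibbs_op_le (eta theta : R) t1 t2 (f : vec -> \bar R) (x y : vec) :
  0 < eta -> 0 < theta ->
  measurable_fun [set: _] f -> (forall x, 0 <= f x)%E -> (forall x, f x <= 1)%E ->
  simplex R N x -> simplex R N y ->
  (iter (t1 + t2) P f x <= iter (t1 + t2) P f y + iter t1 P (expected_bad S eta t2) y +
    (mix_error eta theta t1 t2)%:E)%E.
Proof.
move=> eta0 th0 mf f0 f1 sx sy; rewrite !iterD.
set h := iter t2 P f.
have mh : measurable_fun [set: vec] h by exact: measurable_iter_rop.
have h0 z : (0 <= h z)%E by exact: iter_rop_ge0.
have mb := measurable_expected_bad S eta t2.
have b0 := @expected_bad_ge0 R gT S eta t2.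
set c := N%:R * 2 / eta * theta^-1.
set q := N%:R * 2 / eta * (N%:R * theta) + (1 - gamma / 2) ^+ t2 * N%:R.
have g2 : 0 <= 1 - gamma / 2.
  have := spectral_gap_le R S_gen S_id gT1.
  have n2 : 2 <= (N%:R : R) by rewrite ler_nat.
  have : 4 / N%:R <= 2 :> R by rewrite ler_pdivrMr ?ltr0n//; lra.
  by lra.
have c0 : 0 <= c by rewrite !mulr_ge0// invr_ge0 ltW.
have q0 : 0 <= q.
  by rewrite addr_ge0// !mulr_ge0// ?invr_ge0 ?exprn_ge0// ltW.
pose D := [set z : vec * vec | simplex R N z.1 /\ simplex R N z.2].
have FD (p : gT * gT) (z : vec * vec) l : p \in edges S -> 0 <= l <= 1 -> D z ->
    D (edge_map2 p z l).
  by move=> pS l01 [z1 z2]; split; exact: edge_map_simplex.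
pose hs := h \o (@snd vec vec); pose bs := expected_bad S eta t2 \o (@snd vec vec).
have mhs : measurable_fun [set: vec * vec] hs by exact: measurableT_comp.
have mbs : measurable_fun [set: vec * vec] bs by exact: measurableT_comp.
have mq := measurable_quad_pair_delta.
have Q0 z : (0 <= quad_pair delta z)%E.
  by rewrite lee_fin quad_delta sumr_ge0// => k _; exact: sqr_ge0.
have mcq : measurable_fun [set: vec * vec] (fun z => c%:E * quad_pair delta z)%E.
  exact: measurable_funeM.
have cq0 z : (0 <= c%:E * quad_pair delta z)%E by rewrite mule_ge0.
have hs0 z : (0 <= hs z)%E by exact: h0.
have bs0 z : (0 <= bs z)%E by exact: b0.
have mcst : measurable_fun [set: vec * vec] (fun=> q%:E) by exact: measurable_cst.
have step z : D z -> (((h \o fst) z) <= (hs z + bs z) + (c%:E * quad_pair delta z + q%:E))%E.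
  move=> [z1 z2]; apply: (le_trans (coalesce_phase S_gen S_id gT1 _ eta0 mf f0 f1 z1 z2)).
  rewrite leeD2l// /quad_pair -EFinM -EFinD lee_fin /q addrA lerD2r.
  have := sum_gap_le z.1 z.2 th0.
  have a0 : 0 <= N%:R * 2 / eta :> R by rewrite !mulr_ge0// invr_ge0 ltW.
  move/(ler_wpM2l a0); rewrite /c; set u := \sum_k _; set v := quad _ _ => uv.
  rewrite (_ : N%:R * (2 * u / eta) = N%:R * 2 / eta * u); last by ring.
  by apply: (le_trans uv); rewrite le_eqVlt; apply/orP; left; apply/eqP; ring.
have := le_iter_rop mE2 t1 FD _ _ _ _ step (conj sx sy : D (x, y)).
rewrite -/(pair_op S) pair_op_fst /= => H; apply: (le_trans (H _ _ _ _)).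
- by exact: measurableT_comp.
- by move=> z; exact: h0.
- by apply: emeasurable_funD; apply: emeasurable_funD.
- by move=> z; rewrite !adde_ge0.
rewrite [in leLHS]iter_ropD//; last 4 first.
- exact: emeasurable_funD.
- by move=> z; rewrite adde_ge0.
- exact: emeasurable_funD.
- by move=> z; rewrite adde_ge0.
rewrite iter_ropD// -/(pair_op S) !pair_op_snd /= leeD2l//.
rewrite iter_ropD// iter_ropZ// iter_rop_cst// -/(pair_op S).
have H2 := iter_pair_op_delta S_gen S_id gT1 t1 (z := (x, y)) sx sy.
apply: (@le_trans _ _ (c%:E * ((1 - gamma / 6) ^+ t1 * (4 * N%:R))%:E + q%:E)%E).
  by rewrite leeD2r// lee_wpmul2l// lee_fin.
rewrite -EFinM -EFinD lee_fin /c /q /mix_error.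
by rewrite le_eqVlt; apply/orP; left; apply/eqP; ring.
Qed.

(** The second start is drawn from [U]: by stationarity it contributes [U A], and [expected_bad]
    contributes at most [n^2 eta]. The first start lies in the simplex only almost surely, hence the
    almost everywhere comparison. *)
Lemma gibbs_law_le (eta theta : R) t1 t2 (mu0 : probability vec R) (A : set vec) :
  0 < eta -> 0 < theta -> mu0 (simplex R N) = 1%E -> measurable A ->
  (gibbs_law S mu0 (t1 + t2) A <= U A +
    (N%:R * (N%:R * eta) + mix_error eta theta t1 t2)%:E)%E.
Proof.
move=> eta0 th0 mu1 mA.
pose f : vec -> \bar R := fun x => (\1_A x)%:E.
have mf : measurable_fun [set: vec] f by apply/measurable_EFinP; exact: measurable_indic.
have f0 x : (0 <= f x)%E by rewrite lee_fin.
have f1 x : (f x <= 1)%E by rewrite lee_fin indicE; case: (_ \in _).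
have intf (m : {measure set vec -> \bar R}) : (\int[m]_x f x = m A)%E.
  by rewrite integral_indic// setIT.
have mT : mu0 setT = 1%E by exact: probability_setT.
rewrite -!intf (integral_gibbs_law S0)//.
set t := (t1 + t2)%N; set B := (_ + _)%:E.
have mP : measurable_fun [set: vec] (iter t P f) by exact: measurable_iter_rop.
have P0 x : (0 <= iter t P f x)%E by exact: iter_rop_ge0.
set b := iter t1 P (expected_bad S eta t2).
have mb : measurable_fun [set: vec] b.
  by apply: measurable_iter_rop => //; [exact: measurable_expected_bad|exact: expected_bad_ge0].
have b0 x : (0 <= b x)%E by apply: iter_rop_ge0; exact: expected_bad_ge0.
have g2 : 0 <= 1 - gamma / 2.
  have := spectral_gap_le R S_gen S_id gT1.
  have n2 : 2 <= (N%:R : R) by rewrite ler_nat.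
  have : 4 / N%:R <= 2 :> R by rewrite ler_pdivrMr ?ltr0n//; lra.
  by lra.
have e0 : 0 <= mix_error eta theta t1 t2.
  have g6 : 0 <= 1 - gamma / 6 by apply: ltW; exact: contraction_gt0.
  have ti0 : 0 <= theta^-1 by rewrite invr_ge0 ltW.
  have ei0 : 0 <= eta^-1 by rewrite invr_ge0 ltW.
  have th0' := ltW th0.
  by rewrite /mix_error; repeat (assumption || apply: addr_ge0 || apply: mulr_ge0 || apply: exprn_ge0).
have pointwise x : simplex R N x -> (iter t P f x <= \int[U]_y f y + B)%E.
  move=> sx.
  have -> : iter t P f x = (\int[U]_y cst (iter t P f x) y)%E.
    by rewrite integral_cst// [X in (_ * X)%E](probability_setT U) mule1.
  pose k := (mix_error eta theta t1 t2)%:E.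
  have k0 : (0 <= k)%E by rewrite /k lee_fin.
  apply: (@le_trans _ _ (\int[U]_y (iter t P f y + b y + cst k y))%E).
    apply: le_uniform => //.
    - by move=> y; exact: P0.
    - apply: emeasurable_funD => //; exact: emeasurable_funD.
    - by move=> y; rewrite !adde_ge0 ?P0 ?b0 ?k0.
    - move=> y sy; exact: iter_gibbs_op_le.
  rewrite ge0_integralD//; last 2 first.
  - by move=> y _; rewrite adde_ge0 ?P0 ?b0.
  - exact: emeasurable_funD.
  rewrite ge0_integralD// integral_cst// [X in (k * X)%E](probability_setT U) mule1.
  rewrite integral_uniform_gibbs_op// -addeA leeD2l// /B EFinD leeD2r//.
  rewrite integral_uniform_gibbs_op//; last 2 first.
  - exact: measurable_expected_bad.
  - exact: expected_bad_ge0.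
  by apply: integral_expected_bad => //; exact: ltW.
set c := (_ + B)%E in pointwise *.
have -> : c = (\int[mu0]_x cst c x)%E by rewrite integral_cst// [X in (_ * X)%E]mT mule1.
apply: ae_ge0_le_integral => //.
- by move=> x _; rewrite adde_ge0 ?integral_ge0// lee_fin addr_ge0// !mulr_ge0// ltW.
have muC : mu0 (~` simplex R N) = 0%E.
  by rewrite (probability_setC mu0 (@measurable_simplex R N)) mu1 subee.
exists (~` simplex R N); split.
- by apply: measurableC; exact: measurable_simplex.
- exact: muC.
by move=> x /= hx sx; apply: hx => _; exact: pointwise.
Qed.

End mixing.

(** * Choice of the parameters *)

Section upper_bound.
Variables (R : realType) (gT : finGroupType) (S : {set gT}).
Hypothesis S_gen : <<S>>%g = [set: gT]%SET.
Hypothesis S_id : 1%g \notin S.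
Local Notation N := #|gT|.
Local Notation vec := (N.-tuple R).
Local Notation n := (N%:R : R).
Local Notation gamma := (spectral_gap R S).
Local Notation U := (uniform_simplex R N).

Lemma expr_le_expR (x : R) t : x <= 1 -> (1 - x) ^+ t <= expR (- (x * t%:R)).
Proof.
move=> x1; rewrite -mulNr expRM_natr lerXn2r ?nnegrE ?subr_ge0 ?expR_ge0//.
exact: expR_ge1Dx.
Qed.

(* The run is cut into a contraction phase of length [T - T %/ 8] and a coalescence
   phase of length [T %/ 8]. *)
Lemma mix_error_le (C : R) (T : nat) : 0 < C -> 1 < n -> gamma <= 1 / 2 -> 0 < gamma -> 4 <= n ->
  8 * C / gamma * ln n < T%:R ->
  n * (n * (n `^ (- (C / 4)))) +
    mix_error S (n `^ (- (C / 4))) (n `^ (- (C / 2))) (T - T %/ 8) (T %/ 8) <=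
  7 * n `^ (9 / 2 - C / 6).
Proof.
move=> C0 n1 g1 g0 n4; set L := ln n => TC.
have n0 : 0 < n by lra.
have nE : n = expR L by rewrite lnK.
have L0 : 1 / 2 <= L.
  have := expR_ge1Dx (- L); rewrite expRN -nE.
  have : n^-1 <= 1 / 2 by rewrite div1r lef_pV2 ?posrE//; lra.
  by lra.
have powE x : n `^ x = expR (x * L) by rewrite /powR gt_eqF.
have T8 : (T %/ 8 * 8 <= T)%N := leq_trunc_div T 8.
have T8' : (T < (T %/ 8).+1 * 8)%N by apply: ltn_ceil.
have gT8 : 8 * C * L < gamma * T%:R.
  move: TC; rewrite -(ltr_pM2l g0); congr (_ < _).
  by field; rewrite gt_eqF.
have t2 : 8 * C * L - 8 * gamma <= 8 * (gamma * (T %/ 8)%:R).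
  have : T%:R <= (T %/ 8)%:R * 8 + 8 :> R.
    by rewrite -natrM -natrD ler_nat -mulSnr; exact: ltnW.
  by move=> /(ler_wpM2l (ltW g0)); lra.
have t1 : 7 * C * L <= gamma * (T - T %/ 8)%:R.
  rewrite natrB ?leq_div//.
  have : (T %/ 8)%:R * 8 <= T%:R :> R by rewrite -natrM ler_nat.
  by move=> /(ler_wpM2l (ltW g0)); lra.
(* The four errors are bounded by multiples of [K], with factors 1, 2, 8 and 1. *)
set K := expR ((2 - C / 6) * L).
have K0 : 0 < K by exact: expR_gt0.
have CL0 : 0 < C * L by rewrite mulr_gt0//; lra.
have q1 : (1 - gamma / 6) ^+ (T - T %/ 8) <= expR (- (7 / 6 * C * L)).
  apply: (le_trans (expr_le_expR _ _)); first by lra.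
  by rewrite ler_expR; lra.
(* The extra [L] absorbs the rounding of [T / 8], as [gamma / 2 <= 1/4 < L]. *)
have q2 : (1 - gamma / 2) ^+ (T %/ 8) <= expR (- (C / 2 * L) + L).
  apply: (le_trans (expr_le_expR _ _)); first by lra.
  by rewrite ler_expR; lra.
have e1 : n * (n * n `^ (- (C / 4))) <= K.
  by rewrite powE {1 2}nE -!expRD ler_expR; lra.
have e2 : n * (2 * (n * n `^ (- (C / 2))) / n `^ (- (C / 4))) <= 2 * K.
  rewrite !powE -expRN (_ : n * _ = 2 * (n * (n * expR (- (C / 2) * L)) * expR (- (- (C / 4) * L)))); last by ring.
  by rewrite ler_pM2l// {1 2}nE -!expRD ler_expR; lra.
have e3 : n * (2 * ((n `^ (- (C / 2)))^-1 * ((1 - gamma / 6) ^+ (T - T %/ 8) * (4 * n))) / n `^ (- (C / 4))) <= 8 * K.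
  set q := _ ^+ _ in q1 *.
  rewrite !powE -!expRN (_ : n * _ = 8 * (n * (n * (expR (- (- (C / 2) * L)) * expR (- (- (C / 4) * L)))) * q)); last by ring.
  rewrite ler_pM2l//.
  apply: (@le_trans _ _ (n * (n * (expR (- (- (C / 2) * L)) * expR (- (- (C / 4) * L)))) * expR (- (7 / 6 * C * L)))).
    by rewrite ler_wpM2l// !mulr_ge0 ?expR_ge0 ?(ltW n0).
  by rewrite {1 2}nE -!expRD ler_expR; lra.
have e4 : (1 - gamma / 2) ^+ (T %/ 8) * n <= K.
  apply: (le_trans (ler_wpM2r (ltW n0) q2)).
  by rewrite nE -expRD ler_expR; lra.
apply: (@le_trans _ _ (12 * K)).
  rewrite /mix_error [2 * (_ + _)]mulrDr mulrDl [n * (_ + _)]mulrDr; lra.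
(* The remaining factor [n^(5/2)] absorbs [12 / 7]. *)
rewrite powE (_ : (9 / 2 - C / 6) * L = (2 - C / 6) * L + 5 / 2 * L); last by lra.
rewrite expRD -/K; have := expR_ge1Dx (5 / 2 * L); nra.
Qed.

Theorem gibbs_mixing (C : R) (T : nat) (mu0 : probability vec R) :
  8 * C / gamma * ln n < T%:R -> 0 < C -> 8 <= n ->
  mu0 (simplex R N) = 1%E ->
  (tv_dist (gibbs_law S mu0 T) U <= (7 * n `^ (9 / 2 - C / 6))%:E)%E.
Proof.
move=> TC C0 n8 mu1.
have gT1 : (1 < N)%N by rewrite -(ltr_nat R); lra.
have g0 := spectral_gap_gt0 R S_gen S_id gT1.
have g1 : gamma <= 1 / 2.
  apply: (le_trans (spectral_gap_le R S_gen S_id gT1)).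
  by rewrite ler_pdivrMr; lra.
apply: ge_ereal_sup => _ [A mA <-].
have e0 x : 0 < n `^ x by apply: powR_gt0; lra.
have := gibbs_law_le S_gen S_id gT1 (T - T %/ 8) (T %/ 8) (e0 (- (C / 4))) (e0 (- (C / 2))) mu1 mA.
rewrite subnK ?leq_div// => le.
have UA : U A \is a fin_num by exact: fin_num_measure.
rewrite leeBlDl//; apply: (le_trans le); rewrite leeD2l// lee_fin.
by apply: mix_error_le => //; lra.
Qed.

End upper_bound.

(** * The lower bound *)

Section linear_statistic.
Variables (R : realType) (gT : finGroupType) (S : {set gT}).
Hypothesis S_gen : <<S>>%g = [set: gT]%SET.
Hypothesis S_id : 1%g \notin S.
Hypothesis gT1 : (1 < #|gT|)%N.
Local Notation N := #|gT|.
Local Notation vec := (N.-tuple R).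
Local Notation n := (N%:R : R).
Local Notation gamma := (spectral_gap R S).
Local Notation U := (uniform_simplex R N).
Local Notation P := (gibbs_op S).
Local Notation coord := Defs.coord.

Variable phi : gT -> R.
Hypothesis phi1 : forall g, `|phi g| <= 1.
Hypothesis phi0 : \sum_g phi g = 0.
Hypothesis phiE : forall x, (N * #|S|)%:R^-1 *
  (\sum_g \sum_(r in S) phi (tperm g (g * r)%g x)) = (1 - gamma) * phi x.

Let S0 : (0 < #|S|)%N. Proof. exact: card_gen_gt0 S_gen gT1. Qed.
Let E0 : (0 < #|edges S|)%N. Proof. exact: card_edges_gt0. Qed.

Definition lin (x : vec) : R := \sum_g phi g * coord x g.

Definition vertex (g : gT) : vec := vec_of (fun h => (h == g)%:R).

Lemma coord_vec_of (f : gT -> R) g : coord (vec_of f) g = f g.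
Proof. by rewrite /coord tnth_mktuple enum_rankK. Qed.

Lemma sum_coord (f : gT -> R) (x : vec) :
  \sum_g f g * coord x g = \sum_(i < N) f (enum_val i) * tnth x i.
Proof. by rewrite -sum_enum_val; apply: eq_bigr => i _; rewrite /coord enum_valK. Qed.

Lemma simplex_coord (x : vec) : simplex R N x ->
  (forall g, 0 <= coord x g) /\ \sum_g coord x g = 1.
Proof.
move=> [x0 x1]; split => [g|]; first exact: x0.
by rewrite -x1 -sum_enum_val; apply: eq_bigr => i _; rewrite /coord enum_valK.
Qed.

Lemma vertex_simplex g : simplex R N (vertex g).
Proof.
split => [i|]; first by rewrite tnth_mktuple.
under eq_bigr do rewrite tnth_mktuple.
rewrite (sum_enum_val (fun h => (h == g)%:R)) (bigD1 g)//= eqxx big1 ?addr0// => h.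
by move=> /negbTE ->.
Qed.

Lemma lin_vertex g : lin (vertex g) = phi g.
Proof.
rewrite /lin (bigD1 g)//= coord_vec_of eqxx mulr1 big1 ?addr0// => h /negbTE hg.
by rewrite coord_vec_of hg mulr0.
Qed.

Lemma lin_le1 x : simplex R N x -> `|lin x| <= 1.
Proof.
move=> /simplex_coord[x0 x1]; rewrite -x1; apply: (le_trans (ler_norm_sum _ _ _)).
by apply: ler_sum => g _; rewrite normrM (ger0_norm (x0 g)) ler_piMl.
Qed.

Lemma measurable_lin : measurable_fun [set: vec] lin.
Proof.
by apply: measurable_sum => g; apply: measurable_funM => //; exact: measurable_tnth.
Qed.

Lemma lin_edge_map p (x : vec) (l : measurableTypeR R) : p \in edges S ->
  lin (edge_map p x l) = lin x + (phi p.1 - phi (p.1 * p.2)%g) *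
    (l * (coord x p.1 + coord x (p.1 * p.2)%g) - coord x p.1).
Proof.
move=> pS; have ne := edge_neq S_id p.1 pS.
set g := p.1 in ne *; set h := (g * p.2)%g in ne *.
rewrite /lin (bigD1 g)//= (bigD1 h) 1?eq_sym//= [X in _ = X + _](bigD1 g)//= [X in _ = _ + X + _](bigD1 h) 1?eq_sym//=.
rewrite /edge_map !coord_vec_of -/g -/h eqxx [h == g]eq_sym (negbTE ne) eqxx.
rewrite (eq_bigr (fun k => phi k * coord x k)) => [|k /andP[kg kh]]; last first.
  by rewrite coord_vec_of -/h (negbTE kg) (negbTE kh).
by ring.
Qed.

(** This change of [lin] is twice the one of [lin_edge_map] at [l = 1/2]: in mean, a Gibbs move acts
    on [lin] like half a step of the walk, whence the factor [1 - gamma / 2]. *)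
Lemma lin_tperm p (x : vec) : p \in edges S ->
  \sum_k phi (tperm p.1 (p.1 * p.2)%g k) * coord x k =
  lin x + (phi p.1 - phi (p.1 * p.2)%g) * (coord x (p.1 * p.2)%g - coord x p.1).
Proof.
move=> pS; have ne := edge_neq S_id p.1 pS.
set g := p.1 in ne *; set h := (g * p.2)%g in ne *.
rewrite /lin (bigD1 g)//= (bigD1 h) 1?eq_sym//= [X in _ = X + _](bigD1 g)//= [X in _ = _ + X + _](bigD1 h) 1?eq_sym//=.
rewrite tpermL tpermR.
rewrite (eq_bigr (fun k => phi k * coord x k)) => [|k /andP[kg kh]]; last first.
  by rewrite tpermD// eq_sym.
by ring.
Qed.

(* Equal to [1 + c * lin x] on the simplex, and nonnegative everywhere. *)
Definition shifted_lin (c : R) (x : vec) : \bar R := (`|1 + c * lin x|)%:E.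

Lemma measurable_shifted_lin c : measurable_fun [set: vec] (shifted_lin c).
Proof.
apply/measurable_EFinP; apply: measurableT_comp => //.
by apply: measurable_funD => //; apply: measurable_funM => //; exact: measurable_lin.
Qed.

Lemma shifted_linE c x : 0 <= c <= 1 -> simplex R N x -> shifted_lin c x = (1 + c * lin x)%:E.
Proof.
move=> c01 /lin_le1; rewrite ler_norml => lx.
by rewrite /shifted_lin ger0_norm//; nra.
Qed.

Lemma gibbs_op_shifted_lin c x : 0 <= c <= 1 -> simplex R N x ->
  P (shifted_lin c) x = shifted_lin (c * (1 - gamma / 2)) x.
Proof.
move=> c01 sx.
have g0 := spectral_gap_gt0 R S_gen S_id gT1.
have g2 : gamma <= 2.
  apply: (le_trans (spectral_gap_le R S_gen S_id gT1)).
  have n2 : 2 <= n by rewrite ler_nat.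
  by rewrite ler_pdivrMr; lra.
rewrite shifted_linE//; last by nra.
rewrite /gibbs_op /rop (eq_bigr (fun p => (1 + c * ((lin x +
    \sum_k phi (tperm p.1 (p.1 * p.2)%g k) * coord x k) / 2))%:E)); last first.
  move=> p pS; rewrite lin_tperm//.
  set d := phi p.1 - _; set a := coord x p.1; set b := coord x _.
  rewrite /rint (_ : (1 + _)%:E = ((1 + c * (lin x - d * a)) + (c * d * (a + b)) / 2 + 0 / 3)%:E).
    rewrite -integral01_quadratic; apply: eq_integral => l; rewrite inE/= in_itv/= => l01.
    rewrite shifted_linE//; last exact: (edge_map_simplex S_id).
    by rewrite lin_edge_map// -/d -/a -/b; congr EFin; ring.
  by congr EFin; field.
rewrite sumEFin -EFinM; congr EFin.
set w := _^-1.
have ww : w * #|edges S|%:R = 1 by rewrite mulVf// pnatr_eq0 -lt0n.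
rewrite big_split /= sumr_const -[1 *+ _]/(_%:R) mulrDr ww; congr (1 + _).
rewrite -mulr_sumr -mulr_suml big_split /= sumr_const -[lin x *+ _]mulr_natl.
have tw : w * (\sum_(p in edges S) \sum_k phi (tperm p.1 (p.1 * p.2)%g k) * coord x k) =
    (1 - gamma) * lin x.
  rewrite exchange_big mulr_sumr /lin mulr_sumr; apply: eq_bigr => k _ /=.
  rewrite -mulr_suml sum_edges /= !mulrA; congr (_ * _).
  by rewrite -phiE /w card_edges.
rewrite (_ : w * _ = c * ((w * #|edges S|%:R * lin x + w * (\sum_(p in edges S) \sum_k phi (tperm p.1 (p.1 * p.2)%g k) * coord x k)) / 2)); last by ring.
by rewrite ww tw; field.
Qed.

End linear_statistic.

Section lower_bound.
Variables (R : realType) (gT : finGroupType) (S : {set gT}).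
Hypothesis S_gen : <<S>>%g = [set: gT]%SET.
Hypothesis S_id : 1%g \notin S.
Local Notation N := #|gT|.
Local Notation vec := (N.-tuple R).
Local Notation n := (N%:R : R).
Local Notation gamma := (spectral_gap R S).
Local Notation U := (uniform_simplex R N).
Local Notation P := (gibbs_op S).
Local Notation coord := Defs.coord.

(** Division by the value at a point where the absolute value is largest, rather than by that
    absolute value, makes the value there [+1]. *)
Lemma normalized_eigenfunction : (1 < N)%N -> exists2 phi : gT -> R,
  (forall g, `|phi g| <= 1) /\ (exists g, phi g = 1) &
  \sum_g phi g = 0 /\
  forall x, (N * #|S|)%:R^-1 * (\sum_g \sum_(r in S) phi (tperm g (g * r)%g x)) =
    (1 - gamma) * phi x.
Proof.
move=> gT1; have [phi [x0 x0n] [s0 sE]] := spectral_gap_eigenfunction R S_gen S_id gT1.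
pose g := [arg max_(i > x0) `|phi i|]%O.
have gmax x : `|phi x| <= `|phi g|.
  by rewrite /g; case: Order.TotalTheory.arg_maxP => // i _; apply.
have gn : phi g != 0.
  by rewrite -normr_gt0 (lt_le_trans _ (gmax x0))// normr_gt0.
exists (fun x => phi x / phi g); split.
- by move=> x; rewrite normrM normfV ler_pdivrMr ?normr_gt0// mul1r.
- by exists g; rewrite divff.
- by rewrite -mulr_suml s0 mul0r.
move=> x; rewrite mulrA -sE -[RHS]mulrA; congr (_ * _).
by rewrite mulr_suml; apply: eq_bigr => h _; rewrite mulr_suml.
Qed.

(** From [expR x >= 1 + x] and [(1 + x) (1 - x/2) >= 1] on [[0, 1]]. *)
Lemma expR_le_expr (x : R) t : 0 <= x <= 1 -> expR (- (x * t%:R)) <= (1 - x / 2) ^+ t.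
Proof.
move=> x01; rewrite -mulNr expRM_natr lerXn2r ?nnegrE ?expR_ge0//; first lra.
rewrite expRN -[leRHS]invrK lef_pV2 ?posrE ?expR_gt0 ?invr_gt0//; last by lra.
apply: le_trans (expR_ge1Dx x); rewrite -div1r ler_pdivrMr; last by lra.
by nra.
Qed.

Lemma tv_dist_ge0 d (T : measurableType d) (mu nu : {measure set T -> \bar R}) :
  (0 <= tv_dist mu nu)%E.
Proof. by apply: ereal_sup_ubound; exists set0 => //; rewrite !measure0 sube0. Qed.

(** The test set is [A = {lin > a}]. Chebyshev gives [U A <= 1 / ((n + 1) a^2) <= a]. Under the law,
    [lin] has mean [(1 - gamma/2)^t] and is at most [a + 1_A] on the simplex, which bounds the
    probability of [A] from below. *)
Lemma tv_gibbs_law_ge (a : R) : (1 < N)%N -> 0 < a -> N.+1%:R^-1 <= a ^+ 3 -> exists2 X0, simplex R N X0 &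
  forall t, (((1 - gamma / 2) ^+ t - 2 * a)%:E <= tv_dist (gibbs_law S \d_X0 t) U)%E.
Proof.
move=> gT1 a0 a3.
have [phi [phi1 [g phig]] [phi0 phiE]] := normalized_eigenfunction gT1.
have S0 : (0 < #|S|)%N := card_gen_gt0 S_gen gT1.
have E0 := card_edges_gt0 S0.
have N0 : (0 < N)%N := ltnW gT1.
exists (vertex R g) => [|t]; first exact: vertex_simplex.
set X0 := vertex R g.
have sX : simplex R N X0 by exact: vertex_simplex.
have g0 := spectral_gap_gt0 R S_gen S_id gT1.
have g2 : gamma <= 2.
  apply: (le_trans (spectral_gap_le R S_gen S_id gT1)).
  have n2 : 2 <= n by rewrite ler_nat.
  by rewrite ler_pdivrMr; lra.
have c01 k : 0 <= (1 - gamma / 2) ^+ k <= 1.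
  by rewrite exprn_ge0 ?exprn_ile1//; lra.
have FD p x l : p \in edges S -> 0 <= l <= 1 -> simplex R N x -> simplex R N (edge_map p x l).
  exact: (edge_map_simplex S_id).
have mE (p : gT * gT) := @measurable_edge_map R gT p.
have iterE k c x : 0 <= c <= 1 -> simplex R N x ->
    iter k P (shifted_lin phi c) x = shifted_lin phi (c * (1 - gamma / 2) ^+ k) x.
  elim: k c => [|k ih] c hc sx; first by rewrite mulr1.
  rewrite iterSr (eq_iter_rop k FD (g := shifted_lin phi (c * (1 - gamma / 2)))) => [|z sz|//].
    by rewrite ih// ?exprS ?mulrA//; nra.
  exact: gibbs_op_shifted_lin.
pose A : set vec := lin phi @^-1` `]a, +oo[.
have mA : measurable A.
  by rewrite -[A]setTI; apply: (measurable_lin phi) => //; exact: measurable_itv.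
have AE x : x \in A = (a < lin phi x) by apply/idP/idP; rewrite inE /A/= in_itv/= andbT.
have UA : (U A <= a%:E)%E.
  have -> : (U A = \int[U]_x (\1_A x)%:E)%E by rewrite integral_indic// setIT.
  have m2 : measurable_fun [set: vec] (fun x => (lin phi x ^+ 2)%:E).
    by apply/measurable_EFinP; apply: measurable_funX; exact: measurable_lin.
  apply: (@le_trans _ _ (\int[U]_x ((a ^- 2)%:E * (lin phi x ^+ 2)%:E))%E).
    apply: ge0_le_integral => //.
    - by apply/measurable_EFinP; exact: measurable_indic.
    - exact: measurable_funeM.
    - move=> x _; rewrite -EFinM lee_fin indicE AE; case: (ltP a) => [ax|_] /=.
        by rewrite mulrC ler_pdivlMr ?exprn_gt0// mul1r; nra.
      by rewrite mulr_ge0 ?invr_ge0 ?sqr_ge0.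
  rewrite ge0_integralZl//; last 2 first.
  - by move=> x _; rewrite lee_fin sqr_ge0.
  - by rewrite lee_fin invr_ge0 sqr_ge0.
  apply: (@le_trans _ _ ((a ^- 2)%:E * (N.+1%:R^-1)%:E)%E).
    apply: lee_wpmul2l; first by rewrite lee_fin invr_ge0 sqr_ge0.
    under eq_integral do rewrite /lin sum_coord.
    by apply: uniform_linear_var => //; rewrite sum_enum_val.
  rewrite -EFinM lee_fin mulrC ler_pdivrMr ?exprn_gt0//.
set law := gibbs_law _ _ _.
have lawT : law setT = 1%E by apply: gibbs_law_setT => //; exact: diracT.
have lawA : (((1 - gamma / 2) ^+ t)%:E <= a%:E + law A)%E.
  have mi : measurable_fun [set: vec] (fun x => (\1_A x)%:E : \bar R).
    by apply/measurable_EFinP; exact: measurable_indic.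
  have -> : (law A = \int[law]_x (\1_A x)%:E)%E by rewrite integral_indic// setIT.
  rewrite (integral_gibbs_law S0)//; last by exact: diracT.
  rewrite integral_dirac//; last by apply: measurable_iter_rop.
  rewrite diracT mul1e.
  (* The comparison of [lin] with [a + 1_A] is shifted by 1, which makes the functions
     nonnegative. *)
  have := iterE t 1 X0 _ sX; rewrite mul1r shifted_linE// lin_vertex phig mulr1 => /(_ _)/esym e1.
  rewrite -(leeD2lE (x := 1%:E))// -EFinD e1 ?lexx ?ler01// addeA -EFinD.
  apply: (@le_trans _ _ (iter t P (fun x => ((1 + a)%:E + (\1_A x)%:E)%E) X0)).
    apply: (le_iter_rop mE t FD) => //.
    - exact: measurable_shifted_lin.
    - by move=> x; rewrite lee_fin.
    - by apply: emeasurable_funD.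
    - by move=> x; rewrite adde_ge0// lee_fin; lra.
    - move=> x sx; rewrite shifted_linE ?lexx ?ler01// -EFinD lee_fin mul1r indicE AE.
      have := lin_le1 phi1 sx; rewrite ler_norml => lx.
      by case: (ltP a) => /= ?; lra.
  have a1 : 0 <= 1 + a by lra.
  have a1e (x : vec) : (0 <= (1 + a)%:E)%E by rewrite lee_fin.
  by rewrite iter_ropD// ?iter_rop_cst.
have fA : law A \is a fin_num.
  rewrite ge0_fin_numE//; apply: (@le_lt_trans _ _ 1%E); last exact: ltry.
  by rewrite -lawT; apply: le_measure; rewrite ?inE.
apply: (@le_trans _ _ (law A - U A)%E); last first.
  by apply: ereal_sup_ubound; exists A.
have fU : U A \is a fin_num by exact: fin_num_measure.
by move: lawA UA; rewrite -(fineK fA) -(fineK fU) -EFinD -EFinB !lee_fin; lra.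
Qed.

(** The matrix has a single eigenvalue, so the second entry of the list is the default 0 of
    [nth]. *)
Lemma spectral_gap_trivial : N = 1%N -> gamma = 1.
Proof.
move=> N1; rewrite /spectral_gap /eigenvalues.
case: xgetP => [s _ [_ cp]|_]; last by rewrite nth_nil subr0.
have := size_char_poly (walk_matrix R S); rewrite cp size_prod_XsubC => -[sz].
by rewrite nth_default ?subr0// sz N1.
Qed.

Theorem gibbs_lower_bound : exists2 X0 : vec, simplex R N X0 &
  forall (k : R) (T : nat), T%:R < k / gamma ->
  ((expR (- k) / 2 - 4 * n `^ (- (1 / 3)))%:E <= tv_dist (gibbs_law S \d_X0 T) U)%E.
Proof.
have N0 : (0 < N)%N by apply/card_gt0P; exists 1%g.
have n0 : 0 < n by rewrite ltr0n.
set a := n `^ (- (1 / 3)).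
have a0 : 0 < a by exact: powR_gt0.
have a3 : a ^+ 3 = n^-1.
  rewrite /a -powR_mulrn ?powR_ge0// -powRrM (_ : - (1 / 3) * _ = -1); last by field.
  by rewrite powR_inv1// ltW.
have g0 : 0 < gamma.
  move: N0; rewrite leq_eqVlt => /predU1P[/esym/spectral_gap_trivial ->//|].
  exact: spectral_gap_gt0.
have [N4|N4] := leqP 4 N.
  have gT1 : (1 < N)%N by exact: leq_trans N4.
  have [|X0 sX H] := @tv_gibbs_law_ge a gT1 a0.
    by rewrite a3 lef_pV2 ?posrE ?ltr0n// ler_nat.
  exists X0 => // k T Tk; apply: le_trans (H T); rewrite lee_fin.
  have n4 : 4 <= n by rewrite ler_nat.
  (* Needed for [expR_le_expr]; it follows from [gamma <= 4 / n] and [n >= 4]. *)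
  have g1 : gamma <= 1.
    apply: (le_trans (spectral_gap_le R S_gen S_id (ltnW (ltnW N4)))).
    by rewrite ler_pdivrMr; lra.
  have e1 : expR (- k) <= expR (- (gamma * T%:R)).
    by rewrite ler_expR lerN2 mulrC -ler_pdivlMr// ltW.
  have := @expR_le_expr gamma T; have := expR_ge0 (- k : R); lra.
(* For [n <= 3] the left-hand side is negative: [k >= 0], so the exponential is at most 1, while
   [4 n^(-1/3)] is at least 1. *)
exists (vertex R 1%g) => [|k T Tk]; first exact: vertex_simplex.
apply: le_trans (tv_dist_ge0 _ _); rewrite lee_fin.
have k0 : 0 <= k.
  have : 0 < k / gamma by apply: le_lt_trans Tk.
  by rewrite pmulr_lgt0 ?invr_gt0// => /ltW.
have e1 : expR (- k) <= 1 by rewrite -expR0 ler_expR oppr_le0.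
have n3 : n <= 3 by rewrite ler_nat.
have : 1 / 3 <= a ^+ 3 by rewrite a3 div1r lef_pV2 ?posrE.
have := sqr_ge0 a; rewrite exprS; case: (lerP (1 / 4) a); nra.
Qed.

End lower_bound.

Theorem theorem1 (R : realType) (gT : finGroupType) (S : {set gT})
    (S_sym : (S^-1)%g = S) (S_gen : <<S>>%g = [set: gT]%SET)
    (S_id : 1%g \notin S) :
  let n : R := #|gT|%:R in
  let gamma : R := spectral_gap R S in
  let U := uniform_simplex R #|gT| in
  (forall (C : R) (T : nat),
     8 * C / gamma * ln n < T%:R ->
     103 / 4 < C ->
     Num.max 4096 (Num.max (C / 3 + 10 / 3) ((C / 3 - 13 / 12) * ln n)) < n ->
     forall mu0 : probability (#|gT|.-tuple R) R,
       mu0 (simplex R #|gT|) = 1%E ->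
       (tv_dist (gibbs_law S mu0 T) U <= (7 * n `^ (9 / 2 - C / 6))%:E)%E) /\
  (exists2 X0 : #|gT|.-tuple R, simplex R #|gT| X0 &
     forall (k : R) (T : nat),
       T%:R < k / gamma ->
       ((expR (- k) / 2 - 4 * n `^ (- (1 / 3)))%:E
          <= tv_dist (gibbs_law S \d_X0 T) U)%E).
Proof.
move=> n gamma U; split; last exact: gibbs_lower_bound.
move=> C T TC C0 nC mu0 mu1.
have n4096 : 4096 < n by move: nC; rewrite gt_max => /andP[].
by apply: gibbs_mixing => //; lra.
Qed.
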